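(* Suppose that the conductances $\omega$ satisfy $$\sup_{x\in\mathbb{Z}^d}\langle x\rangle^{-2}\sum_{y\sim x}\omega(x,y)<\infty .$$ Then the variable speed random walk on $\mathcal{C}(\omega)$ is non-explosive (i.e. $\mathbf{P}^\omega_x[\zeta=\infty]=1$ for every $x\in\mathcal{C}(\omega)$), and the SDE $$d\phi_t(x)=\sum_{y\sim x}\omega(x,y)(\phi_t(y)-\phi_t(x))\,dt+\sqrt{2}\,dB_t(x),\qquad x\in\mathcal{C}(\omega),$$ is well-posed for initial values in $\mathcal{S}'$ in the following sense. For every initial condition $\phi_0\in\mathcal{S}'$ and every family $(B_t(x))_{x\in\mathcal{C}(\omega),t\ge 0}$ of independent standard Brownian motions there exists a unique adapted process $\phi\in C([0,\infty);\mathcal{S}')$ such that there is an $N=N(\phi_0,\omega)\in\mathbb{N}$ for which $\phi\in C([0,\infty);H_{-N})$ almost surely and $$\phi_t=\phi_0-\int_0^t\Delta_\omega\phi_s\,ds+\sqrt{2}\,B_t,\qquad 0\le t<\infty,$$ holds as an identity in $H_{-(N+2)}$. Moreover, for every $x\in\mathcal{C}(\omega)$ and $t\ge 0$ the solution is given pointwise by $$\phi_t(x)=(P^\omega_t\phi_0)(x)+\sqrt{2}\sum_{y\in\mathcal{C}(\omega)}\int_0^t p^\omega_{t-s}(x,y)\,dB_s(y),$$ where $p_t^\omega(x,y)=\mathbf{P}^\omega_x[X_t=y]$ and $(P^\omega_t)_{t\ge0}$ is the semigroup of the variable speed random walk acting on $\mathcal{S}'$.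
   Context: Let $d\ge1$; $x\sim y$ means that $x,y\in\mathbb{Z}^d$ are nearest neighbours. The conductances $\omega=(\omega(x,y))_{x,y\in\mathbb{Z}^d}$ are non-negative, symmetric and vanish unless $x\sim y$. Standing assumption: the graph on $\mathbb{Z}^d$ whose edges are the pairs $\{x,y\}$ with $\omega(x,y)>0$ has exactly one infinite connected component, denoted $\mathcal{C}(\omega)$. The formal Laplacian is $(\Delta_\omega u)(x)=\sum_{y\sim x}\omega(x,y)[u(x)-u(y)]$ (for functions on $\mathcal{C}(\omega)$). The variable speed random walk $(X_t)_{t\ge0}$ is the continuous-time Markov chain on $\mathcal{C}(\omega)$ with generator $-\Delta_\omega$ (jumping from $x$ to $y$ at rate $\omega(x,y)$), law $\mathbf{P}^\omega_x$ when started at $x$, and explosion time $\zeta$; in general $p^\omega_t(x,y)=\mathbf{P}^\omega_x[X_t=y,\zeta>t]$. Write $\langle x\rangle=(1+|x|^2)^{1/2}$. For $N\ge 0$, $H_{\pm N}$ is the space of functions $f:\mathcal{C}(\omega)\to\mathbb{R}$ with $\|f\|_{H_{\pm N}}^2=\sum_{x\in\mathcal{C}(\omega)}\langle x\rangle^{\pm2N}|f(x)|^2<\infty$. $\mathcal{S}=\bigcap_{N\ge0}H_N$ with the topology of convergence in all $H_N$-norms, and $\mathcal{S}'=\bigcup_{N\ge0}H_{-N}$ is its dual (functions of at most polynomial growth), with pairing $\langle\xi,u\rangle=\sum_x\xi(x)u(x)$. The semigroup acts on $\mathcal{S}'$ by $(P^\omega_t\xi)(x)=\sum_{y\in\mathcal{C}(\omega)}p^\omega_t(x,y)\xi(y)$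 (equivalently, by duality with its action on $\mathcal{S}$). Adaptedness is with respect to the filtration generated by the Brownian motions. *)

(* Defs.v *)
From HB Require Import structures.
From mathcomp Require Import all_boot all_order all_algebra finmap.
From mathcomp Require Import all_classical all_reals all_analysis.
From mathcomp.analysis.showcase Require summability.
Set Implicit Arguments.
Unset Strict Implicit.
Unset Printing Implicit Defensive.
Import Order.TTheory GRing.Theory Num.Theory.
Import numFieldNormedType.Exports.
Local Open Scope classical_set_scope.
Local Open Scope ring_scope.

Definition lattice (d : nat) := 'rV[int]_d.

Definition neighbours d (x y : lattice d) : bool :=
  \sum_(i < d) `|x ord0 i - y ord0 i| == 1.

Definition japanese (R : realType) d (x : lattice d) : R :=
  Num.sqrt (1 + \sum_(i < d) (x ord0 i)%:~R ^+ 2).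

Definition conductances (R : realType) d (omega : lattice d -> lattice d -> R) :=
  [/\ forall x y, 0 <= omega x y,
      forall x y, omega x y = omega y x &
      forall x y, ~~ neighbours x y -> omega x y = 0].

Definition connected_by (R : realType) d (omega : lattice d -> lattice d -> R)
    (x y : lattice d) : Prop :=
  exists2 p : seq (lattice d), path (fun a b => 0 < omega a b) x p & last x p = y.

Definition is_component (R : realType) d (omega : lattice d -> lattice d -> R)
    (C : set (lattice d)) : Prop :=
  exists x, C = [set y | connected_by omega x y].

Definition unique_infinite_component (R : realType) d
    (omega : lattice d -> lattice d -> R) (C : set (lattice d)) : Prop :=
  [/\ is_component omega C, infinite_set C &
      forall C', is_component omega C' -> infinite_set C' -> C' = C].

Definition total_rate (R : realType) d (omega : lattice d -> lattice d -> R)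
    (x : lattice d) : R :=
  \sum_(y \in [set y | neighbours x y]) omega x y.

(* Functions on the cluster are functions on the subtype of [C].  Neighbours of
   a point of [C] that lie outside [C] carry zero conductance. *)
Definition laplacian (R : realType) d (omega : lattice d -> lattice d -> R)
    (C : set (lattice d)) (u : C -> R) (x : C) : R :=
  \sum_(y \in [set y : C | neighbours (val x) (val y)])
     omega (val x) (val y) * (u x - u y).

(* The chain with Q-matrix [- laplacian], given through its embedded jump chain
   [site] and holding times [holding]: the former jumps from [z] to [z'] with
   probability [omega z z' / total_rate z], and conditionally on it the holding
   times are independent, exponential with parameter [total_rate] of the
   current site.  [vsrw_lawE] is the resulting joint law of the first [n + 1]
   sites and holding times; [total_rate] is positive on an infinite component,
   so there are no absorbing states. *)
Record vsrw (R : realType) d (omega : lattice d -> lattice d -> R)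
    (C : set (lattice d)) := Vsrw {
  vsrw_display : measure_display ;
  vsrw_space : measurableType vsrw_display ;
  law : C -> probability vsrw_space R ;
  site : nat -> vsrw_space -> C ;
  holding : nat -> vsrw_space -> R ;
  measurable_site : forall n z, measurable (site n @^-1` [set z]) ;
  measurable_holding : forall n, measurable_fun [set: vsrw_space] (holding n) ;
  holding_ge0 : forall n w, 0 <= holding n w ;
  vsrw_lawE : forall (x : C) (n : nat) (z : nat -> C) (s : nat -> R),
    (forall i, 0 <= s i) ->
    law x [set w | forall i, (i <= n)%N -> site i w = z i /\ s i < holding i w] =
    ((z 0%N == x)%:R *
     (\prod_(i < n) (omega (val (z i)) (val (z i.+1)) /
                     total_rate omega (val (z i)))) *
     (\prod_(i < n.+1) expR (- total_rate omega (val (z i)) * s i)))%:E }.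

Definition jump_time (R : realType) d (omega : lattice d -> lattice d -> R)
    (C : set (lattice d)) (X : vsrw omega C) (n : nat) (w : vsrw_space X) : R :=
  \sum_(i < n) holding i w.

Definition explosion_time (R : realType) d (omega : lattice d -> lattice d -> R)
    (C : set (lattice d)) (X : vsrw omega C) (w : vsrw_space X) : \bar R :=
  (\sum_(0 <= k <oo) (holding k w)%:E)%E.

Definition walk_at (R : realType) d (omega : lattice d -> lattice d -> R)
    (C : set (lattice d)) (X : vsrw omega C) (t : R) (y : C) :
    set (vsrw_space X) :=
  [set w | exists2 n : nat,
     jump_time n w <= t < jump_time n.+1 w & site n w = y].

Definition heat_kernel (R : realType) d (omega : lattice d -> lattice d -> R)
    (C : set (lattice d)) (X : vsrw omega C) (t : R) (x y : C) : R :=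
  fine (law X x (walk_at t y `&` [set w : vsrw_space X | (t%:E < explosion_time w)%E])).

Definition Hnorm2 (R : realType) d (C : set (lattice d)) (r : R)
    (f : C -> R) : \bar R :=
  (\esum_(x in [set: C]) (japanese R (val x) `^ (2 * r) * `|f x| ^+ 2)%:E)%E.

Definition Hspace (R : realType) d (C : set (lattice d)) (r : R) : set (C -> R) :=
  [set f | (Hnorm2 r f < +oo)%E].

Definition Sspace (R : realType) d (C : set (lattice d)) : set (C -> R) :=
  [set f | forall N : R, 0 <= N -> Hspace N f].

Definition Sdual (R : realType) d (C : set (lattice d)) : set (C -> R) :=
  [set f | exists2 N : R, 0 <= N & Hspace (- N) f].

(* Sum of an absolutely convergent family: positive minus negative part. *)
Definition csum (R : realType) (I : choiceType) (f : I -> R) : R :=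
  fine (\esum_(i in [set: I]) (Num.max (f i) 0)%:E)%E -
  fine (\esum_(i in [set: I]) (Num.max (- f i) 0)%:E)%E.

Definition pairing (R : realType) d (C : set (lattice d)) (xi u : C -> R) : R :=
  csum (fun x => xi x * u x).

Definition semigroup (R : realType) d (omega : lattice d -> lattice d -> R)
    (C : set (lattice d)) (X : vsrw omega C) (t : R) (xi : C -> R) (x : C) : R :=
  csum (fun y => heat_kernel X t x y * xi y).

Definition continuous_in_H (R : realType) d (C : set (lattice d)) (r : R)
    (f : R -> C -> R) : Prop :=
  (forall t : R, 0 <= t -> Hspace r (f t)) /\
  forall t : R, 0 <= t ->
    Hnorm2 r (fun x => f s x - f t x) @[s --> within [set s | 0 <= s] (nbhs t)]
      --> (0 : \bar R)%E.

(* [Sdual] carries the weak-* topology of the duality with [Sspace]. *)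
Definition continuous_in_Sdual (R : realType) d (C : set (lattice d))
    (f : R -> C -> R) : Prop :=
  (forall t : R, 0 <= t -> Sdual (f t)) /\
  forall u : C -> R, Sspace u ->
    {within `[0, +oo[, continuous (fun s : R => pairing (f s) u)}.

(* [J] is the integral of [f] over [0, t] in the Hilbert space [Hspace r], as
   the norm limit of Riemann sums over tagged partitions of vanishing mesh. *)
Definition is_integral_in_H (R : realType) d (C : set (lattice d)) (r : R)
    (f : R -> C -> R) (t : R) (J : C -> R) : Prop :=
  Hspace r J /\
  forall eps : R, 0 < eps -> exists2 delta : R, 0 < delta &
    forall (n : nat) (s tag : nat -> R),
      s 0%N = 0 -> s n = t ->
      (forall i, (i < n)%N ->
         s i <= tag i <= s i.+1 /\ s i.+1 - s i < delta) ->
      (Hnorm2 r (fun x => J x - \sum_(i < n) (s i.+1 - s i) * f (tag i) x)%R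
         < eps%:E)%E.

Definition mutually_independent (R : realType) (dT : measure_display)
    (T : measurableType dT) (P : probability T R) (I : choiceType)
    (F : I -> set (set T)) : Prop :=
  forall (J : {fset I}) (E : I -> set T),
    (forall i, i \in J -> F i (E i)) ->
    fine (P (\bigcap_(i in [set` J]) E i)) = \prod_(i <- J) fine (P (E i)).

Definition brownian_motion (R : realType) (dT : measure_display)
    (T : measurableType dT) (P : probability T R) (B : R -> {RV P >-> R}) : Prop :=
  [/\ {ae P, forall w, B 0 w = 0},
      forall t : nat -> R, 0 <= t 0%N -> (forall i, t i <= t i.+1) ->
        mutually_independent P (fun i : nat =>
          preimage_set_system setT
            (fun w => B (t i.+1) w - B (t i) w) measurable),
      forall s t : R, 0 <= s -> s < t -> forall A : set R, measurable A ->
        P [set w | A (B t w - B s w)] = normal_prob 0 (Num.sqrt (t - s)) A &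
      {ae P, forall w, {within `[0, +oo[, continuous (fun t : R => B t w)}} ].

Definition process_sigma_algebra (R : realType) (dT : measure_display)
    (T : measurableType dT) (P : probability T R) (B : R -> {RV P >-> R}) :
    set (set T) :=
  <<s \bigcup_(t in [set t : R | 0 <= t]) preimage_set_system setT (B t) measurable >>.

Definition independent_brownian_motions (R : realType) (dT : measure_display)
    (T : measurableType dT) (P : probability T R) (I : choiceType)
    (B : I -> R -> {RV P >-> R}) : Prop :=
  (forall i, brownian_motion (B i)) /\
  mutually_independent P (fun i => process_sigma_algebra (B i)).

Definition brownian_filtration (R : realType) (dT : measure_display)
    (T : measurableType dT) (P : probability T R) (I : choiceType)
    (B : I -> R -> {RV P >-> R}) (t : R) : set (set T) :=
  <<s \bigcup_(i in [set: I]) \bigcup_(s in [set s : R | 0 <= s <= t])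
        preimage_set_system setT (B i s) measurable >>.

(* Coordinatewise measurability; on the space of functions on the countable set
   [C] this is measurability for the sigma-algebra of the evaluations. *)
Definition adapted (R : realType) (dT : measure_display)
    (T : measurableType dT) (P : probability T R) d (C : set (lattice d))
    (B : C -> R -> {RV P >-> R}) (phi : R -> T -> C -> R) : Prop :=
  forall (t : R) (x : C), 0 <= t ->
    preimage_set_system setT (fun w => phi t w x) measurable
      `<=` brownian_filtration B t.

(* A list of triples [(a, u, v)] encodes the step function
   [\sum a * \1_(]u, v])], whose integral is [\sum a * (B v - B u)]. *)
Definition step_fun (R : realType) (g : seq (R * R * R)) (s : R) : R :=
  \sum_(p <- g) p.1.1 * \1_(`]p.1.2, p.2] : set R) s.

Definition step_integral (R : realType) (T : Type) (B : R -> T -> R)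
    (g : seq (R * R * R)) (w : T) : R :=
  \sum_(p <- g) p.1.1 * (B p.2 w - B p.1.2 w).

(* [J] is the stochastic integral over [0, t] of the deterministic [f] against
   [B]: the extension of [step_integral] by L^2-isometry. *)
Definition is_wiener_integral (R : realType) (dT : measure_display)
    (T : measurableType dT) (P : probability T R) (B : R -> {RV P >-> R})
    (t : R) (f : R -> R) (J : {RV P >-> R}) : Prop :=
  measurable_fun `[0, t] f /\
  forall eps : R, 0 < eps -> exists g : seq (R * R * R),
    [/\ forall p : R * R * R, p \in g -> [/\ 0 <= p.1.2, p.1.2 <= p.2 & p.2 <= t],
        (\int[lebesgue_measure]_(s in `[0%R, t]) ((f s - step_fun g s) ^+ 2)%:E
           < eps%:E)%E &
        (\int[P]_w ((J w - step_integral B g w) ^+ 2)%:E < eps%:E)%E].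

(* Unconditional convergence in L^2(P), along the net of finite subsets. *)
Definition is_L2_sum (R : realType) (dT : measure_display)
    (T : measurableType dT) (P : probability T R) (I : choiceType)
    (J : I -> {RV P >-> R}) (Z : {RV P >-> R}) : Prop :=
  (fun F : {fset I} => \int[P]_w ((Z w - \sum_(i <- F) J i w)%R ^+ 2)%:E)%E
    @ @summability.totally I --> (0 : \bar R)%E.

(* The remaining terms of the identity, [phi t w] and [phi0] (its value at time
   0), already lie in the smaller space [Hspace (- N)]. *)
Definition is_solution (R : realType) d (omega : lattice d -> lattice d -> R)
    (C : set (lattice d)) (dT : measure_display) (T : measurableType dT)
    (P : probability T R) (B : C -> R -> {RV P >-> R}) (phi0 : C -> R)
    (N : nat) (phi : R -> T -> C -> R) : Prop :=
  adapted B phi /\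
  {ae P, forall w,
    [/\ continuous_in_Sdual (fun t => phi t w),
        continuous_in_H (- N%:R) (fun t => phi t w) &
        forall t : R, 0 <= t -> exists J : C -> R,
          [/\ is_integral_in_H (- (N + 2)%:R)
                (fun s => laplacian omega (phi s w)) t J,
              Hspace (- (N + 2)%:R) (fun x => B x t w) &
              forall x, phi t w x = phi0 x - J x + Num.sqrt 2 * B x t w] ]}.

Definition indistinguishable (R : realType) (dT : measure_display)
    (T : measurableType dT) (P : probability T R) (E : Type)
    (phi psi : R -> T -> E) : Prop :=
  {ae P, forall w, forall t : R, 0 <= t -> phi t w = psi t w}.

(* Main.v *)
Require Import Defs.
From HB Require Import structures.
From mathcomp Require Import all_boot all_order all_algebra finmap.
From mathcomp Require Import all_classical all_reals all_analysis.
From mathcomp Require Import measurable_realfun ring lra zify.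
Set Implicit Arguments.
Unset Strict Implicit.
Unset Printing Implicit Defensive.
Import Order.TTheory GRing.Theory Num.Theory.
Import numFieldNormedType.Exports.
Local Open Scope classical_set_scope.
Local Open Scope ring_scope.

(* The minimal heat kernel p is constructed analytically, as the increasing limit of the probabilities
   of reaching y from x after fewer than N jumps.  Since the rates grow at most quadratically, a weighted
   l^2 energy estimate, with weights whose logarithm is Lipschitz in log <x>, has bounded errors; it
   yields p_t(x, y) <= e^(ct) <x>^r <y>^(-r) for every r, and uniqueness of polynomially bounded solutions
   of the heat equation.  Mass conservation of p is non-explosion once p is identified with the kernel
   of the walk, which follows from the joint law of sites and holding times: the probability of being
   at y after exactly n jumps satisfies the same recursive differential equations.

   The equation is solved path by path.  Almost surely |B_t(x)| <= K <x>^q locally uniformly in t, by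
   dyadic chaining, so U_t = int_0^t P_(t-s) B_s ds converges, U' = B - Delta U, and
   phi_t = P_t phi_0 + sqrt 2 (B_t - Delta U_t) is the solution.  By uniqueness for the heat equation,
   two solutions agree.  Integrating by parts, B_t - Delta U_t is the sum over y of the Wiener integrals
   of p_(t-s)(x, y), whose second moments decay faster than any power of <y>, so the triangle inequality
   in L^2 gives the convergence of the sum. *)

(** * Calculus on a compact interval *)

(** The rates may be unbounded, so summation by parts is carried out on the finite boxes [J <= n],
    up to the edges that leave the box. Such an edge has [J >= n / 2] at both ends, so a summand
    decaying like [J ^- (q + 3)], with [q = 2 d + 1], costs only [O(1 / n)]. The obstacle is that
    the kernel is a priori only bounded by one, so growing weights must be damped, with an energy
    constant that does not see the damping. Once the decay is known, the kernel is symmetric: decay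
    in one variable becomes growth in the other, and the forward equation becomes the backward one,
    which differentiates the semigroup. Of the walk only cylinder probabilities are given;
    conditional independence is recovered from them by pi-lambda arguments, and the memoryless
    property by subdividing time. Brownian paths are not differentiable in time, but [U] is, so the
    equation is solved by classical calculus for [U]. The filtration is not completed, so the field
    needs a formula that is measurable at every outcome: an upper limit of Riemann sums. *)

Section Calculus.
Context {R : realType}.
Implicit Types (T e d s t : R) (f g : R -> R).

(* Continuity and differentiability on [0, T] with a modulus uniform in the base point: no values
   outside [0, T] are involved, and both notions pass to uniform limits. *)
Definition ucont T f := forall e, 0 < e -> exists2 d, 0 < d &
  forall s t, 0 <= s -> s <= t -> t <= T -> t - s <= d -> `|f t - f s| <= e.

Definition uderiv T f g := forall e, 0 < e -> exists2 d, 0 < d &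
  forall s t, 0 <= s -> s <= t -> t <= T -> t - s <= d ->
    `|f t - f s - (t - s) * g s| <= e * (t - s).

Lemma exists_nat_gt (x : R) : exists n : nat, x < n.+1%:R.
Proof.
exists (Num.bound `|x|); apply: le_lt_trans (ler_norm x) _.
apply: lt_trans (archi_boundP (normr_ge0 x)) _; by rewrite ltr_nat.
Qed.

Lemma ler_eps (x y c : R) : 0 <= c -> (forall e, 0 < e -> x <= y + e * c) -> x <= y.
Proof.
move=> c0 h; rewrite leNgt; apply/negP => yx.
have c1 : 0 < c + 1 by lra.
have := h ((x - y) / (2 * (c + 1))) _.
have e0 : 0 < (x - y) / (2 * (c + 1)) by apply: divr_gt0; lra.
move=> /(_ e0); set e := _ / _ in e0 *.
have : e * (2 * (c + 1)) = x - y by rewrite /e; field; lra.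
nra.
Qed.

Lemma ucont_le T S f : S <= T -> ucont T f -> ucont S f.
Proof.
move=> ST h e /h[d d0 H]; exists d => // s t s0 st tS.
by apply: H => //; lra.
Qed.

Lemma uderiv_le T S f g : S <= T -> uderiv T f g -> uderiv S f g.
Proof.
move=> ST h e /h[d d0 H]; exists d => // s t s0 st tS.
by apply: H => //; lra.
Qed.

Lemma eq_ucont T f f' : (forall t, 0 <= t -> t <= T -> f t = f' t) ->
  ucont T f -> ucont T f'.
Proof.
move=> ff h e /h[d d0 H]; exists d => // s t s0 st tS ts.
by rewrite -!ff //; [apply: H|lra..].
Qed.

Lemma eq_uderiv T f g f' g' : (forall t, 0 <= t -> t <= T -> f t = f' t) ->
  (forall t, 0 <= t -> t <= T -> g t = g' t) -> uderiv T f g -> uderiv T f' g'.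
Proof.
move=> ff gg h e /h[d d0 H]; exists d => // s t s0 st tS ts.
by rewrite -!ff -?gg //; [apply: H|lra..].
Qed.

Lemma ucont_bounded T f : ucont T f ->
  exists2 K, 0 <= K & forall t, 0 <= t -> t <= T -> `|f t| <= K.
Proof.
move=> /(_ 1 ltr01)[d d0 H].
have key (n : nat) t : 0 <= t -> t <= T -> t <= n%:R * d -> `|f t| <= `|f 0| + n%:R.
  elim: n t => [|n ih] t t0 tT; first by rewrite mul0r addr0 => t1; have -> : t = 0 by lra.
  rewrite -natr1 mulrDl mul1r => tn.
  have [tnd|tnd] := leP t (n%:R * d); first by have := ih _ t0 tT tnd; lra.
  have nd0 : 0 <= n%:R * d by apply: mulr_ge0 => //; exact: ltW.
  have := ih _ nd0 (ltW (lt_le_trans tnd tT)) (lexx _).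
  have := H (n%:R * d) t nd0 (ltW tnd) tT _.
  have td : t - n%:R * d <= d by lra.
  move=> /(_ td).
  have := ler_normD (f t - f (n%:R * d)) (f (n%:R * d)); rewrite subrK; lra.
have [n nT] := exists_nat_gt (T / d).
exists (`|f 0| + n.+1%:R); first by apply: addr_ge0.
move=> t t0 tT; apply: key => //.
by rewrite -ler_pdivrMr //; apply: le_trans (ltW nT); rewrite ler_pM2r ?invr_gt0.
Qed.

Lemma ucont_cst T (c : R) : ucont T (fun=> c).
Proof. by move=> e e0; exists 1 => // *; rewrite subrr normr0 ltW. Qed.

Lemma ucont_lip T f (L : R) :
  (forall s t, 0 <= s -> s <= t -> t <= T -> `|f t - f s| <= L * (t - s)) -> ucont T f.
Proof.
move=> h e e0; exists (e / (`|L| + 1)); first by apply: divr_gt0 => //; have := normr_ge0 L; lra.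
move=> s t s0 st tT ts; apply: le_trans (h _ _ s0 st tT) _.
have L0 := normr_ge0 L; have := ler_norm L => Ll.
have : (t - s) * (`|L| + 1) <= e by rewrite -ler_pdivlMr //; lra.
nra.
Qed.

Lemma ucontD T f g : ucont T f -> ucont T g -> ucont T (fun t => f t + g t).
Proof.
move=> hf hg e e0; have e20 : 0 < e / 2 by lra.
have [d1 d10 H1] := hf _ e20; have [d2 d20 H2] := hg _ e20.
exists (Num.min d1 d2); first by rewrite lt_min d10.
move=> s t s0 st tT; rewrite le_min => /andP[t1 t2].
have := H1 _ _ s0 st tT t1; have := H2 _ _ s0 st tT t2.
have -> : f t + g t - (f s + g s) = (f t - f s) + (g t - g s) by ring.
have := ler_normD (f t - f s) (g t - g s); lra.
Qed.

Lemma ucontZ T (c : R) f : ucont T f -> ucont T (fun t => c * f t).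
Proof.
move=> hf e e0; have c0 := normr_ge0 c.
have c1 : 0 < `|c| + 1 by lra.
have [d d0 H] := hf (e / (`|c| + 1)) (divr_gt0 e0 c1).
exists d => // s t s0 st tT ts; have := H _ _ s0 st tT ts.
rewrite -mulrBr normrM ler_pdivlMr // => h.
have := normr_ge0 (f t - f s); nra.
Qed.

Lemma ucontN T f : ucont T f -> ucont T (fun t => - f t).
Proof. by move=> /(ucontZ (-1)); apply: eq_ucont => t _ _; rewrite mulN1r. Qed.

Lemma ucontB T f g : ucont T f -> ucont T g -> ucont T (fun t => f t - g t).
Proof. by move=> hf hg; apply: ucontD => //; exact: ucontN. Qed.

Lemma ucont_sum T (I : Type) (r : seq I) (F : I -> R -> R) :
  (forall i, ucont T (F i)) -> ucont T (fun t => \sum_(i <- r) F i t).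
Proof.
move=> h; elim: r => [|i r ih].
  by apply: eq_ucont (ucont_cst T 0) => t _ _; rewrite big_nil.
by apply: eq_ucont (ucontD (h i) ih) => t _ _; rewrite big_cons.
Qed.

Lemma ucontM T f g : ucont T f -> ucont T g -> ucont T (fun t => f t * g t).
Proof.
move=> hf hg e e0.
have [K K0 fK] := ucont_bounded hf; have [L L0 gL] := ucont_bounded hg.
have e20 : 0 < e / (K + L + 1) by apply: divr_gt0; lra.
have [d1 d10 H1] := hf _ e20; have [d2 d20 H2] := hg _ e20.
exists (Num.min d1 d2); first by rewrite lt_min d10.
move=> s t s0 st tT; rewrite le_min => /andP[t1 t2].
have := H1 _ _ s0 st tT t1; have := H2 _ _ s0 st tT t2.
have sT : s <= T by lra.
have := fK _ s0 sT; have := gL t (le_trans s0 st) tT.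
set a := e / _; have ae : a * (K + L + 1) = e by rewrite /a; field; lra.
have -> : f t * g t - f s * g s = (f t - f s) * g t + f s * (g t - g s) by ring.
move=> h1 h2 h3 h4; apply: le_trans (ler_normD _ _) _; rewrite !normrM.
have a0 : 0 < a by [].
have : `|f t - f s| * `|g t| <= a * L by apply: ler_pM.
have : `|f s| * `|g t - g s| <= K * a by apply: ler_pM.
nra.
Qed.

Lemma ucont_rev T f : ucont T f -> ucont T (fun t => f (T - t)).
Proof.
move=> h e /h[d d0 H]; exists d => // s t s0 st tT ts.
by rewrite distrC; apply: H; lra.
Qed.

Lemma ucont_norm T f : ucont T f -> ucont T (fun t => `|f t|).
Proof.
move=> h e /h[d d0 H]; exists d => // s t s0 st tT ts.
exact: le_trans (ler_dist_dist _ _) (H _ _ s0 st tT ts).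
Qed.

Lemma uderiv_cst T (c : R) : uderiv T (fun=> c) (fun=> 0).
Proof.
by move=> e e0; exists 1 => // s t *; rewrite subrr mulr0 subrr normr0 mulr_ge0 ?subr_ge0 // ltW.
Qed.

Lemma uderivD T f g f' g' : uderiv T f f' -> uderiv T g g' ->
  uderiv T (fun t => f t + g t) (fun t => f' t + g' t).
Proof.
move=> hf hg e e0; have e20 : 0 < e / 2 by lra.
have [d1 d10 H1] := hf _ e20; have [d2 d20 H2] := hg _ e20.
exists (Num.min d1 d2); first by rewrite lt_min d10.
move=> s t s0 st tT; rewrite le_min => /andP[t1 t2].
have := H1 _ _ s0 st tT t1; have := H2 _ _ s0 st tT t2.
set a := _ - (t - s) * g' s; set b := _ - (t - s) * f' s.
have -> : f t + g t - (f s + g s) - (t - s) * (f' s + g' s) = b + a by rewrite /a /b; ring.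
have := ler_normD b a; lra.
Qed.

Lemma uderivZ T (c : R) f f' : uderiv T f f' -> uderiv T (fun t => c * f t) (fun t => c * f' t).
Proof.
move=> hf e e0; have c0 := normr_ge0 c.
have c1 : 0 < `|c| + 1 by lra.
have [d d0 H] := hf (e / (`|c| + 1)) (divr_gt0 e0 c1).
exists d => // s t s0 st tT ts; have := H _ _ s0 st tT ts.
have -> : c * f t - c * f s - (t - s) * (c * f' s) = c * (f t - f s - (t - s) * f' s) by ring.
rewrite normrM mulrAC ler_pdivlMr // => h.
have := normr_ge0 (f t - f s - (t - s) * f' s); nra.
Qed.

Lemma uderivN T f f' : uderiv T f f' -> uderiv T (fun t => - f t) (fun t => - f' t).
Proof. by move=> /(uderivZ (-1)); apply: eq_uderiv => t _ _; rewrite mulN1r. Qed.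

Lemma uderivB T f g f' g' : uderiv T f f' -> uderiv T g g' ->
  uderiv T (fun t => f t - g t) (fun t => f' t - g' t).
Proof. by move=> hf hg; apply: uderivD => //; exact: uderivN. Qed.

Lemma uderiv_sum T (I : Type) (r : seq I) (F F' : I -> R -> R) :
  (forall i, uderiv T (F i) (F' i)) ->
  uderiv T (fun t => \sum_(i <- r) F i t) (fun t => \sum_(i <- r) F' i t).
Proof.
move=> h; elim: r => [|i r ih].
  by apply: eq_uderiv (uderiv_cst T 0) => t _ _; rewrite big_nil.
by apply: eq_uderiv (uderivD (h i) ih) => t _ _; rewrite big_cons.
Qed.

Lemma uderiv_lip_near T f f' : ucont T f' -> uderiv T f f' -> ucont T f.
Proof.
move=> /ucont_bounded[K K0 fK] h e e0.
have [d d0 H] := h 1 ltr01.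
exists (Num.min d (e / (K + 1))); first by rewrite lt_min d0 divr_gt0 //; lra.
move=> s t s0 st tT; rewrite le_min ler_pdivlMr; last lra.
move=> /andP[t1 t2]; have := H _ _ s0 st tT t1.
have := fK _ s0 (le_trans st tT); rewrite mul1r.
have := ler_normD (f t - f s - (t - s) * f' s) ((t - s) * f' s); rewrite subrK.
rewrite normrM (ger0_norm (_ : 0 <= t - s)); last by lra.
have := normr_ge0 (f' s); nra.
Qed.

Lemma uderiv_ucont T f f' : ucont T f' -> uderiv T f f' -> ucont T f.
Proof. exact: uderiv_lip_near. Qed.

Lemma uderivM T f g f' g' : ucont T f' -> ucont T g' -> uderiv T f f' -> uderiv T g g' ->
  uderiv T (fun t => f t * g t) (fun t => f' t * g t + f t * g' t).
Proof.
move=> cf' cg' df dg.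
have cg := uderiv_ucont cg' dg; have cf := uderiv_ucont cf' df.
have [K K0 fK] := ucont_bounded cf; have [L L0 gL] := ucont_bounded cg.
have [K' K'0 fK'] := ucont_bounded cf'.
move=> e e0; set a := e / (K + L + K' + 1).
have a0 : 0 < a by apply: divr_gt0; lra.
have [d1 d10 H1] := df _ a0; have [d2 d20 H2] := dg _ a0; have [d3 d30 H3] := cg _ a0.
exists (Num.min d1 (Num.min d2 d3)); first by rewrite !lt_min d10 d20.
move=> s t s0 st tT; rewrite !le_min => /and3P[t1 t2 t3].
have := H1 _ _ s0 st tT t1; have := H2 _ _ s0 st tT t2; have := H3 _ _ s0 st tT t3.
have sT : s <= T by lra.
have := fK _ s0 sT; have := fK' _ s0 sT; have := gL t (le_trans s0 st) tT.
have ae : a * (K + L + K' + 1) = e by rewrite /a; field; lra.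
set A := f t - f s - _; set B := g t - g s - _.
have -> : f t * g t - f s * g s - (t - s) * (f' s * g s + f s * g' s)
   = (A * g t + f s * B) + (t - s) * (f' s * (g t - g s)) by rewrite /A /B; ring.
move=> h1 h2 h3 h4 h5 h6.
apply: le_trans (ler_normD _ _) _; apply: le_trans (lerD (ler_normD _ _) (lexx _)) _.
rewrite !normrM (ger0_norm (_ : 0 <= t - s)); last by lra.
have ts : 0 <= t - s by lra.
have i1 : `|A| * `|g t| <= a * (t - s) * L by apply: ler_pM.
have i2 : `|f s| * `|B| <= K * (a * (t - s)) by apply: ler_pM.
have i3 : `|f' s| * `|g t - g s| <= K' * a by apply: ler_pM.
have i4 : (t - s) * (`|f' s| * `|g t - g s|) <= (t - s) * (K' * a) by apply: ler_pM => //; apply: mulr_ge0.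
rewrite -ae; have : 0 <= a * (t - s) by apply: mulr_ge0 => //; lra.
lra.
Qed.

Lemma uderiv_rev T f f' : ucont T f' -> uderiv T f f' ->
  uderiv T (fun t => f (T - t)) (fun t => - f' (T - t)).
Proof.
move=> cf' df e e0; have e20 : 0 < e / 2 by lra.
have [d1 d10 H1] := df _ e20; have [d2 d20 H2] := cf' _ e20.
exists (Num.min d1 d2); first by rewrite lt_min d10.
move=> s t s0 st tT; rewrite le_min => /andP[t1 t2].
have a1 : 0 <= T - t by lra.
have a2 : T - t <= T - s by lra.
have a3 : T - s <= T by lra.
have a4 : T - s - (T - t) = t - s by ring.
have := H1 _ _ a1 a2 a3; have := H2 _ _ a1 a2 a3; rewrite !a4 => /(_ t2) h2 /(_ t1) h1.
set A := _ - (t - s) * f' (T - t) in h1.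
have -> : f (T - t) - f (T - s) - (t - s) * - f' (T - s) = - A + (t - s) * (f' (T - s) - f' (T - t))
  by rewrite /A; ring.
apply: le_trans (ler_normD _ _) _; rewrite normrN normrM (ger0_norm (_ : 0 <= t - s)); last by lra.
have : (t - s) * `|f' (T - s) - f' (T - t)| <= (t - s) * (e / 2) by apply: ler_wpM2l => //; lra.
lra.
Qed.

(** A mean value inequality. On [n + 1] equal pieces of length [h], finer than the modulus, each
    increment is at most [(M + e) h]; the errors add up to [e (t - s)], and [e] is arbitrary. *)
Lemma uderiv_incr T f g s t (M : R) : uderiv T f g -> 0 <= s -> s <= t -> t <= T ->
  (forall u, s <= u -> u <= t -> g u <= M) -> f t - f s <= M * (t - s).
Proof.
move=> df s0 st tT gM; apply: (@ler_eps _ _ (t - s)); first by lra.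
move=> e /df[d d0 H].
have [n nd] := exists_nat_gt ((t - s) / d).
set h := (t - s) / n.+1%:R.
have n0 : (0 : R) < n.+1%:R by rewrite ltr0n.
have h0 : 0 <= h by apply: divr_ge0 => //; lra.
have hn : h * n.+1%:R = t - s by rewrite /h; field; rewrite nat1r (gt_eqF n0).
have hd : h <= d by rewrite /h ler_pdivrMr // mulrC -ler_pdivrMr // ltW.
have key (i : nat) : (i <= n.+1)%N -> f (s + i%:R * h) - f s <= (M + e) * (i%:R * h).
  elim: i => [_|i ih ilt]; first by rewrite mul0r mulr0 addr0 subrr.
  have := ih (ltnW ilt).
  have i1 : i%:R * h <= n.+1%:R * h - h.
    by rewrite lerBrDr -[X in _ + X]mul1r -mulrDl ler_wpM2r // natr1 ler_nat.
  have i0 : 0 <= i%:R * h by apply: mulr_ge0.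
  set u := s + i%:R * h.
  have uE : s + i.+1%:R * h = u + h by rewrite /u -natr1; ring.
  have a1 : 0 <= u by rewrite /u; lra.
  have a2 : u <= u + h by lra.
  have a3 : u + h <= T by rewrite /u; lra.
  have a4 : u + h - u <= d by lra.
  have uh : u + h - u = h by ring.
  have := H _ _ a1 a2 a3 a4; rewrite uh => h1.
  have gu : g u <= M by apply: gM; rewrite /u; lra.
  rewrite uE -natr1; have := ler_norm (f (u + h) - f u - h * g u).
  have : h * g u <= h * M by apply: ler_wpM2l.
  lra.
have := key n.+1 (leqnn _); have -> : n.+1%:R * h = t - s by rewrite mulrC.
by rewrite (addrC s) subrK; lra.
Qed.

Lemma uderiv_decr T f g s t (M : R) : uderiv T f g -> 0 <= s -> s <= t -> t <= T ->
  (forall u, s <= u -> u <= t -> M <= g u) -> M * (t - s) <= f t - f s.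
Proof.
move=> /uderivN df s0 st tT gM.
have := uderiv_incr (M := - M) df s0 st tT.
have -> : (forall u, s <= u -> u <= t -> - g u <= - M) = True.
  by apply: propext; split=> // _ u su ut; rewrite lerN2 gM.
by move=> /(_ I); lra.
Qed.

Lemma uderiv_lip T f g s t (M : R) : uderiv T f g -> 0 <= s -> s <= t -> t <= T ->
  (forall u, s <= u -> u <= t -> `|g u| <= M) -> `|f t - f s| <= M * (t - s).
Proof.
move=> df s0 st tT gM; rewrite ler_norml; apply/andP; split.
  rewrite -mulNr; apply: (uderiv_decr df) => // u su ut.
  by have := gM _ su ut; rewrite ler_norml => /andP[].
apply: (uderiv_incr df) => // u su ut.
by have := gM _ su ut; rewrite ler_norml => /andP[].
Qed.

Lemma uderiv_id T : uderiv T id (fun=> 1).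
Proof.
move=> e e0; exists 1 => // s t s0 st tT _.
by rewrite mulr1 subrr normr0 mulr_ge0 // ?subr_ge0 // ltW.
Qed.

(** The Lipschitz bound for [f - g s * id], whose derivative at [u] is [g u - g s]. *)
Lemma uderiv_taylor T f g s t (L : R) : uderiv T f g -> 0 <= s -> s <= t -> t <= T ->
  (forall u, s <= u -> u <= t -> `|g u - g s| <= L) ->
  `|f t - f s - (t - s) * g s| <= L * (t - s).
Proof.
move=> df s0 st tT gL.
have := uderiv_lip (uderivB df (uderivZ (g s) (uderiv_id T))) s0 st tT (M := L).
have -> : f t - g s * id t - (f s - g s * id s) = f t - f s - (t - s) * g s by rewrite /=; ring.
by apply => u su ut; rewrite mulr1; exact: gL.
Qed.

Lemma uderiv_eq T f1 f2 g t : uderiv T f1 g -> uderiv T f2 g -> f1 0 = f2 0 ->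
  0 <= t -> t <= T -> f1 t = f2 t.
Proof.
move=> d1 d2 e0 t0 tT.
have := uderiv_lip (uderivB d1 d2) (lexx 0) t0 tT (M := 0).
move=> h; have {}h : `|f1 t - f2 t - (f1 0 - f2 0)| <= 0 * (t - 0).
  by apply: h => u _ _; rewrite subrr normr0.
move: h; rewrite e0 subrr subr0 mul0r normr_le0 subr_eq0 => /eqP //.
Qed.

(** A quadratic remainder is a closed condition and survives pointwise limits; [heat] and [Psem] are
    differentiated through it. *)
Lemma uderiv_quad T f g (L : R) :
  (forall s t, 0 <= s -> s <= t -> t <= T -> `|f t - f s - (t - s) * g s| <= L * (t - s) ^+ 2) ->
  uderiv T f g.
Proof.
move=> h e e0; exists (e / (`|L| + 1)); first by apply: divr_gt0 => //; have := normr_ge0 L; lra.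
move=> s t s0 st tT; have L0 := normr_ge0 L; have := ler_norm L => Ll.
rewrite ler_pdivlMr; last by lra.
move=> ts; apply: le_trans (h _ _ s0 st tT) _.
have ts0 : 0 <= t - s by lra.
by rewrite expr2 mulrA ler_wpM2r //; nra.
Qed.

(** Compactness of [[0, T]], packaged once: a parameter that works near every point can be chosen
    uniformly. It serves for uniform continuity and for the boundedness of paths continuous in
    [H]. *)
Lemma segment_covering T (P : R -> R -> Prop) :
  (forall t, 0 <= t -> t <= T -> exists2 d, 0 < d & forall s e, 0 <= s -> s <= T ->
     `|s - t| < d -> 0 < e -> e < d -> P e s) ->
  exists2 d, 0 < d & forall t, 0 <= t -> t <= T -> P d t.
Proof.
move=> h.
have /compact_near_coveringP cov := @segment_compact R 0 T.
have hn : \forall e \near 0^'+, `[0, T]%classic `<=` (fun s => 0 <= s <= T -> P e s).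
  apply: cov => t /=; rewrite in_itv /= => /andP[t0 tT].
  have [d d0 H] := h t t0 tT.
  exists (ball t d, [set e | 0 < e < d]).
    split => /=; first exact: nbhsx_ballx.
    near=> e; rewrite /=; apply/andP; split; near: e; first exact: nbhs_right_gt.
    exact: nbhs_right_lt.
  move=> [s e] /= [ts /andP[e0 ed]] /andP[s0 sT]; apply: H => //.
  by rewrite distrC; exact: ts.
near (0 : R)^'+ => e.
exists e; first by near: e; exact: nbhs_right_gt.
move=> t t0 tT; have : (`[0, T]%classic `<=` (fun s => 0 <= s <= T -> P e s)).
  by near: e; exact: hn.
by move=> /(_ t); rewrite /= in_itv /= t0 tT; apply.
Unshelve. all: by end_near. Qed.

Lemma cvg_withinP (A : set R) f t (l : R) :
  f s @[s --> within A (nbhs t)] --> l <->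
  (forall e, 0 < e -> exists2 d, 0 < d & forall s, A s -> `|s - t| < d -> `|f s - l| <= e).
Proof.
split.
  move=> /cvgrPdist_le h e /h [d /= d0 H]; exists d => // s As st.
  by rewrite distrC; apply: H => //=; rewrite distrC.
move=> h; apply/cvgrPdist_le => e /h[d d0 H]; exists d => //= s st As.
by rewrite distrC; apply: H => //; rewrite distrC.
Qed.

Lemma continuous_ucont T f : {within `[0, T], continuous f} -> ucont T f.
Proof.
move=> /subspace_continuousP cf e e0.
have [|d d0 H] := @segment_covering T
  (fun d t => forall s, 0 <= s -> s <= T -> `|s - t| <= d -> `|f s - f t| <= e); last first.
  exists d => // s t s0 st tT ts.
  by apply: H; rewrite ?ger0_norm; lra.
move=> t t0 tT; have e20 : 0 < e / 2 by lra.
have [|d d0 H] := (cvg_withinP _ _ _ _).1 (cf t _) _ e20; first by rewrite /= in_itv /= t0 tT.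
exists (d / 2); first by lra.
move=> s h s0 sT ts h0 hd u u0 uT us.
have hs : `|f s - f t| <= e / 2 by apply: H; rewrite /= ?in_itv /= ?s0 ?sT //; lra.
have hu : `|f u - f t| <= e / 2.
  apply: H; rewrite /= ?in_itv /= ?u0 ?uT //.
  by have := ler_normD (u - s) (s - t); rewrite subrKA; lra.
have := ler_normD (f u - f t) (f t - f s); rewrite subrKA (distrC (f t)); lra.
Qed.

Lemma ucont_continuous T f : ucont T f -> {within `[0, T], continuous f}.
Proof.
move=> cf; apply/subspace_continuousP => t /=; rewrite in_itv /= => /andP[t0 tT].
apply/cvg_withinP => e e0.
have [d d0 H] := cf e e0; exists d => // s; rewrite /= in_itv /= => /andP[s0 sT].
move=> h; have := ler_norm (s - t); have := ler_norm (t - s); rewrite distrC => h3 h4.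
have [st|ts] := leP s t; first by rewrite distrC; apply: H; lra.
by apply: H; lra.
Qed.

Lemma is_derive_uderiv T f g : (forall t, is_derive t 1 f (g t)) -> ucont T g -> uderiv T f g.
Proof.
move=> df cg e e0; have [d d0 H] := cg _ e0; exists d => // s t s0 st tT ts.
move: st; rewrite le_eqVlt => /predU1P[<-|st]; first by rewrite !subrr mul0r subrr normr0 mulr0.
have [|u] := MVT st (fun x _ => df x).
  by apply: derivable_within_continuous => x _; have := df x.
rewrite in_itv /= => /andP[su ut] ->.
have -> : g u * (t - s) - (t - s) * g s = (g u - g s) * (t - s) by ring.
rewrite normrM (ger0_norm (_ : 0 <= t - s)); last by lra.
by apply: ler_wpM2r; [lra|apply: H; lra].
Qed.

Lemma ucont_expR T (c : R) : ucont T (fun t => expR (c * t)).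
Proof.
apply: continuous_ucont; apply: continuous_subspaceT => t.
apply: (@continuous_comp _ _ _ ( *%R c) expR); first exact: mulrl_continuous.
exact: continuous_expR.
Qed.

Lemma uderiv_expR T (c : R) : uderiv T (fun t => expR (c * t)) (fun t => c * expR (c * t)).
Proof.
apply: is_derive_uderiv; last by apply: ucontZ; exact: ucont_expR.
move=> t; rewrite mulrC.
apply: (@is_derive1_comp _ expR ( *%R c)).
rewrite -[X in is_derive _ _ _ X]mulr1; exact: is_deriveZ.
Qed.

Definition primitive (g : R -> R) (t : R) : R := \int[lebesgue_measure]_(s in `[0, t]) g s.

Lemma ucont_integrable T g a b : 0 <= a -> b <= T -> ucont T g ->
  lebesgue_measure.-integrable `[a, b] (EFin \o g).
Proof.
move=> a0 bT cg; apply: continuous_compact_integrable; first exact: segment_compact.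
apply: continuous_subspaceW (ucont_continuous cg) => s /=; rewrite !in_itv /=; lra.
Qed.

Lemma uderiv_primitive T g : ucont T g -> uderiv T (primitive g) g.
Proof.
move=> cg e e0; have [d d0 H] := cg _ e0; exists d => // s t s0 st tT ts.
rewrite /primitive Rintegral_itvB ?bnd_simp //; last first.
  exact: ucont_integrable cg.
rewrite Rintegral_itv_obnd_cbnd; last first.
  apply: (integrableS _ _ _ (ucont_integrable s0 tT cg)) => //.
  by move=> u /=; rewrite !in_itv /= => /andP[/ltW -> ->].
have cstE (c : R) : (t - s) * c = \int[lebesgue_measure]_(u in `[s, t]) (cst c) u.
  rewrite Rintegral_cst //= lebesgue_measure_itv /= lte_fin.
  case: ltP => //= ts0; first by rewrite mulrC.
  have -> : t - s = 0 by lra.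
  by rewrite !(mul0r, mulr0).
have cB : ucont T (fun u => g u - cst (g s) u) by apply: ucontB => //; exact: ucont_cst.
rewrite cstE -RintegralB //; last first.
- exact: ucont_integrable (ucont_cst _ _).
- exact: ucont_integrable cg.
apply: le_trans (le_normr_Rintegral _ _) _ => //.
  exact: ucont_integrable cB.
rewrite mulrC cstE; apply: le_Rintegral => //.
- exact: ucont_integrable (ucont_norm cB).
- exact: ucont_integrable (ucont_cst _ _).
- by move=> u /=; rewrite in_itv /= => /andP[su ut]; apply: H; lra.
Qed.

Lemma primitive0 g : primitive g 0 = 0.
Proof. by rewrite /primitive set_itv1 Rintegral_set1. Qed.

(** Induction along the partition with an error budget proportional to elapsed time: a piece costs
    [a] times its length for the derivative, and as much again for moving the tag to the left
    endpoint. Hence one mesh serves all [t <= T] and all tags. *)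
Lemma riemann_sum T F g : 0 <= T -> ucont T g -> uderiv T F g ->
  forall e, 0 < e -> exists2 d, 0 < d & forall (t : R) (n : nat) (s u : nat -> R),
    0 <= t -> t <= T -> s 0%N = 0 -> s n = t ->
    (forall i, (i < n)%N -> s i <= u i <= s i.+1 /\ s i.+1 - s i < d) ->
    `|F t - F 0 - \sum_(i < n) (s i.+1 - s i) * g (u i)| <= e.
Proof.
move=> T0 cg dF e e0; set a := e / (2 * (T + 1)).
have a0 : 0 < a by apply: divr_gt0 => //; lra.
have ae : 2 * a * (T + 1) = e by rewrite /a; field; lra.
have [d1 d10 H1] := dF _ a0; have [d2 d20 H2] := cg _ a0.
exists (Num.min d1 d2); first by rewrite lt_min d10.
move=> t n s u t0 tT s0 sn su.
have mono i : (i <= n)%N -> 0 <= s i.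
  elim: i => [|i ih] h; first by rewrite s0.
  by have [/andP[h1 h2] _] := su i h; have := ih (ltnW h); lra.
have mono' i : (i <= n)%N -> s (n - i)%N <= t.
  elim: i => [|i ih] h; first by rewrite subn0 sn.
  have hi : (n - i.+1 < n)%N by rewrite ltn_subrL /= (leq_trans _ h).
  have [/andP[h1 h2] _] := su _ hi; have := ih (ltnW h).
  by rewrite -(subnSK h); lra.
have key i : (i <= n)%N ->
  `|F (s i) - F 0 - \sum_(j < i) (s j.+1 - s j) * g (u j)| <= 2 * a * s i.
  elim: i => [|i ih] h; first by rewrite big_ord0 s0 subrr subr0 normr0 mulr0.
  have := ih (ltnW h); rewrite big_ord_recr /=.
  have [/andP[h1 h2]] := su i h; rewrite lt_min => /andP[h3 h4].
  have si0 := mono _ (ltnW h).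
  have siT : s i.+1 <= t by have := mono' (n - i.+1)%N (leq_subr _ _); rewrite subKn.
  have /= i1 := H1 (s i) (s i.+1) si0 (le_trans h1 h2) (le_trans siT tT) (ltW h3).
  have i2 := H2 (s i) (u i) si0 h1.
  have {}i2 : `|g (u i) - g (s i)| <= a by apply: i2; lra.
  set S := \sum_(_ < i) _.
  have -> : F (s i.+1) - F 0 - (S + (s i.+1 - s i) * g (u i)) =
     (F (s i) - F 0 - S) + ((F (s i.+1) - F (s i) - (s i.+1 - s i) * g (s i))
      - (s i.+1 - s i) * (g (u i) - g (s i))) by ring.
  move=> ih'; apply: le_trans (ler_normD _ _) _.
  apply: le_trans (lerD ih' (ler_normB _ _)) _.
  rewrite [X in _ + (_ + X)]normrM (ger0_norm (_ : 0 <= s i.+1 - s i)); last by lra.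
  have : (s i.+1 - s i) * `|g (u i) - g (s i)| <= (s i.+1 - s i) * a by apply: ler_wpM2l; lra.
  lra.
rewrite -sn; apply: le_trans (key n (leqnn _)) _; rewrite sn; nra.
Qed.

(** Variation of constants for [f' = - r f + g]. *)
Definition linear_ode (r f0 : R) (g : R -> R) (t : R) : R :=
  expR (- r * t) * (f0 + primitive (fun s => expR (r * s) * g s) t).

Lemma linear_ode0 (r f0 : R) g : linear_ode r f0 g 0 = f0.
Proof. by rewrite /linear_ode primitive0 mulr0 expR0 mul1r addr0. Qed.

Lemma uderiv_linear_ode T (r f0 : R) g : ucont T g ->
  uderiv T (linear_ode r f0 g) (fun t => - r * linear_ode r f0 g t + g t).
Proof.
move=> cg.
have cg' : ucont T (fun s => expR (r * s) * g s) by apply: ucontM => //; exact: ucont_expR.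
have d1 := uderiv_expR T (- r).
have d2 := uderivD (uderiv_cst T f0) (uderiv_primitive cg').
apply: eq_uderiv (uderivM _ _ d1 d2) => //.
- move=> t _ _; rewrite /linear_ode add0r mulrA; congr (_ + _).
    by rewrite mulrA.
  by rewrite -expRD mulNr addNr expR0 mul1r.
- by apply: ucontZ; exact: ucont_expR.
- by apply: ucontD => //; exact: ucont_cst.
Qed.

(** [exp (- c t) f] has derivative at most [b exp (- c t) <= b]. *)
Lemma gronwall T f g (c b : R) t : 0 <= b -> 0 <= c -> uderiv T f g -> ucont T g ->
  (forall s, 0 <= s -> s <= T -> g s <= c * f s + b) -> 0 <= t -> t <= T ->
  f t <= expR (c * t) * (f 0 + b * t).
Proof.
move=> b0 c0 df cg h t0 tT.
have ce : ucont T (fun t : R => - c * expR (- c * t)) by apply: ucontZ; exact: ucont_expR.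
have dd := uderivM ce cg (uderiv_expR T (- c)) df.
have : expR (- c * t) * f t - expR (- c * 0) * f 0 <= b * (t - 0).
  apply: (uderiv_incr dd) => // u u0 ut.
  have := h u u0 (le_trans ut tT); have := expR_gt0 (- c * u).
  have : expR (- c * u) <= 1 by rewrite -expR0 ler_expR; nra.
  nra.
rewrite mulr0 expR0 mul1r subr0.
have E : expR (c * t) * expR (- c * t) = 1 by rewrite -expRD mulNr subrr expR0.
have := expR_gt0 (c * t); set x := expR (c * t) in E *; set y := expR (- c * t) in E *.
move=> x0 h2; have : x * (y * f t) <= x * (f 0 + b * t) by apply: ler_wpM2l; lra.
by rewrite mulrA E mul1r.
Qed.

(** Gronwall for the square of the difference, with rate [2 |r|] as the sign of [r] is arbitrary. *)
Lemma linear_ode_unique T (r : R) f1 f2 g t : ucont T f1 -> ucont T f2 ->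
  uderiv T f1 (fun t => - r * f1 t + g t) -> uderiv T f2 (fun t => - r * f2 t + g t) ->
  f1 0 = f2 0 -> 0 <= t -> t <= T -> f1 t = f2 t.
Proof.
move=> c1 c2 d1 d2 e0 t0 tT.
have := uderivB d1 d2; set f := fun t => f1 t - f2 t => d.
have cf : ucont T f by apply: ucontB.
have {}d : uderiv T f (fun t => - r * f t).
  by apply: eq_uderiv d => // s _ _; rewrite /f; ring.
have cd : ucont T (fun t => - r * f t) by apply: ucontZ.
have := uderivM cd cd d d; set F := fun t => f t * f t => dF.
have f00 : f 0 = 0 by rewrite /f e0 subrr.
have r0 := normr_ge0 r.
have b2 : 0 <= 2 * `|r| by lra.
have := gronwall (lexx 0) b2 dF _ _ t0 tT.
rewrite /F f00 mul0r add0r mul0r mulr0 => h.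
have : f t * f t <= 0.
  apply: h; first by apply: ucontD; apply: ucontM.
  move=> s _ _; have := ler_norm (- r); rewrite normrN => r1.
  have : 0 <= f s * f s by rewrite -expr2 sqr_ge0.
  nra.
move=> ff; have : f t ^+ 2 = 0 by apply: le_anti; rewrite sqr_ge0 expr2 ff.
by move=> /eqP; rewrite sqrf_eq0 subr_eq0 => /eqP.
Qed.

Lemma primitive_ge0 T g t : ucont T g -> 0 <= t -> t <= T ->
  (forall s, 0 <= s -> s <= T -> 0 <= g s) -> 0 <= primitive g t.
Proof.
move=> cg t0 tT g0; have := uderiv_decr (M := 0) (uderiv_primitive cg) (lexx 0) t0 tT.
rewrite primitive0 mul0r subr0; apply => u u0 ut; apply: g0 => //.
exact: le_trans tT.
Qed.

(** Uniqueness identifies [f] with the variation of constants formula, where positivity is visible.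
    This comparison principle yields the bounds and the monotonicity of [picard]. *)
Lemma linear_ode_ge0 T (r : R) f g t : ucont T f -> ucont T g ->
  uderiv T f (fun t => - r * f t + g t) -> (forall s, 0 <= s -> s <= T -> 0 <= g s) ->
  0 <= f 0 -> 0 <= t -> t <= T -> 0 <= f t.
Proof.
move=> cf cg df g0 f0 t0 tT.
have dl := uderiv_linear_ode r (f 0) cg.
have cl : ucont T (linear_ode r (f 0) g).
  apply: ucontM; first exact: ucont_expR.
  apply: ucontD; first exact: ucont_cst.
  have ce : ucont T (fun s => expR (r * s) * g s) by apply: ucontM => //; exact: ucont_expR.
  exact: uderiv_ucont ce (uderiv_primitive ce).
rewrite (linear_ode_unique cf cl df dl _ t0 tT) ?linear_ode0 // /linear_ode.
rewrite mulr_ge0 ?expR_ge0 // addr_ge0 //; apply: (primitive_ge0 _ t0 tT).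
  by apply: ucontM => //; exact: ucont_expR.
by move=> s s0 sT; rewrite mulr_ge0 ?expR_ge0 // g0.
Qed.

Lemma ucont_linear_ode T (r f0 : R) g : ucont T g -> ucont T (linear_ode r f0 g).
Proof.
move=> cg; apply: ucontM; first exact: ucont_expR.
apply: ucontD; first exact: ucont_cst.
have ce : ucont T (fun s => expR (r * s) * g s) by apply: ucontM => //; exact: ucont_expR.
exact: uderiv_ucont ce (uderiv_primitive ce).
Qed.

Lemma ler_inv_nat_from (x y K : R) n0 : 0 <= K ->
  (forall n, (n0 < n)%N -> x <= y + K / n%:R) -> x <= y.
Proof.
move=> K0 h; apply: (@ler_eps _ _ 1) => // e e0.
have [n nK] := exists_nat_gt (K / e).
have nn : (n0 < (maxn n0 n).+1)%N by rewrite ltnS leq_maxl.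
apply: le_trans (h _ nn) _; rewrite lerD2l mulr1 ler_pdivrMr ?ltr0n //.
rewrite mulrC -ler_pdivrMr // (le_trans (ltW nK)) // ler_nat ltnS leq_maxr //.
Qed.

(** Applied to [2 / J] and to [e J], both at most 2. The induction uses [1 + z + th z <= 4 z] for
    [z = 4 ^ k]. *)
Lemma one_plus_pow (th : R) k : 0 <= th -> th <= 2 -> (1 + th) ^+ k <= 1 + th * 4 ^+ k.
Proof.
move=> t0 t2; elim: k => [|k ih]; first by rewrite !expr0; lra.
rewrite exprSr; apply: le_trans (ler_wpM2r _ ih) _; first by lra.
rewrite exprS; have : 1 <= (4 : R) ^+ k by apply: exprn_ege1; lra.
set z := 4 ^+ k => z1.
have h1 : 0 <= th * (z - 1) by apply: mulr_ge0 => //; lra.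
have h2 : 0 <= th * z * (2 - th) by rewrite !mulr_ge0 //; lra.
lra.
Qed.

Lemma ucont_finite (I : eqType) (r : seq I) T (F : I -> R -> R) e :
  (forall i, ucont T (F i)) -> 0 < e -> exists2 dd, 0 < dd & forall i, i \in r ->
    forall s t, 0 <= s -> s <= t -> t <= T -> t - s <= dd -> `|F i t - F i s| <= e.
Proof.
move=> cF e0; elim: r => [|i r [dd dd0 D]]; first by exists 1.
have [d2 d20 D2] := cF i e e0.
exists (Num.min dd d2); first by rewrite lt_min dd0.
move=> j; rewrite inE => /orP[/eqP ->|jr] s t s0 st tT; rewrite le_min => /andP[h1 h2].
  exact: D2.
exact: D.
Qed.

Lemma cvg_norm_le (v : nat -> R) (l B : R) : v @ \oo --> l -> (forall n, `|v n| <= B) -> `|l| <= B.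
Proof.
move=> /cvgrPdist_le h vB; apply: (@ler_eps _ _ 1) => // e e0.
have [N _ hN] := h e e0; have := hN N (leqnn N); have := vB N.
have := ler_normD (l - v N) (v N); rewrite subrK; lra.
Qed.

Lemma cvg_sumr (I : Type) (r : seq I) (F : nat -> I -> R) (l : I -> R) :
  (forall i, F N i @[N --> \oo] --> l i) -> \sum_(i <- r) F N i @[N --> \oo] --> \sum_(i <- r) l i.
Proof.
move=> h; elim: r => [|i r ih].
  by rewrite big_nil; under eq_fun => N do rewrite big_nil; exact: cvg_cst.
by rewrite big_cons; under eq_fun => N do rewrite big_cons; apply: cvgD.
Qed.

End Calculus.

(** * Sums over the lattice *)

Section SeqSums.
Context {R : realType}.

Lemma uniq_sum_le (I : eqType) (s s' : seq I) (F : I -> R) : uniq s -> uniq s' ->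
  {subset s <= s'} -> (forall i, i \in s' -> i \notin s -> 0 <= F i) ->
  \sum_(i <- s) F i <= \sum_(i <- s') F i.
Proof.
move=> us us' ss F0.
rewrite [leRHS](bigID (mem s)) /= -[X in _ <= X + _]big_filter.
have /(perm_big _) -> : perm_eq [seq i <- s' | i \in s] s.
  apply: uniq_perm => //; first exact: filter_uniq.
  by move=> i; rewrite mem_filter; case: (boolP (i \in s)) => //= /ss ->.
rewrite lerDl big_seq_cond; apply: sumr_ge0 => i /andP[]; exact: F0.
Qed.

Lemma uniq_sum_eq (I : eqType) (s s' : seq I) (F : I -> R) : uniq s -> uniq s' ->
  {subset s <= s'} -> (forall i, i \in s' -> i \notin s -> F i = 0) ->
  \sum_(i <- s) F i = \sum_(i <- s') F i.
Proof.
move=> us us' ss F0.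
rewrite [RHS](bigID (mem s)) /= -[X in _ = X + _]big_filter.
have /(perm_big _) -> : perm_eq [seq i <- s' | i \in s] s.
  apply: uniq_perm => //; first exact: filter_uniq.
  by move=> i; rewrite mem_filter; case: (boolP (i \in s)) => //= /ss ->.
by rewrite [X in _ + X]big_seq_cond [X in _ + X]big1 ?addr0 // => i /andP[]; exact: F0.
Qed.

Lemma sum_term_le (I : eqType) (s : seq I) (F : I -> R) i :
  (forall j, 0 <= F j) -> i \in s -> F i <= \sum_(j <- s) F j.
Proof.
move=> F0 /perm_to_rem /(perm_big _) ->.
by rewrite big_cons lerDl sumr_ge0.
Qed.

(** Telescoping, by [1 / (1 + m^2) <= 2 / m - 2 / (m + 1)]; the term at zero is one. *)
Lemma sum_inv_sqr (m : nat) : \sum_(k < m) (1 + (k%:R : R) ^+ 2)^-1 <= 3.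
Proof.
case: m => [|m]; first by rewrite big_ord0.
suff : \sum_(k < m.+1) (1 + (k%:R : R) ^+ 2)^-1 <= 3 - 2 / m.+1%:R.
  move=> /le_trans -> //; rewrite gerBl divr_ge0 //.
elim: m => [|m ih].
  by rewrite big_ord1 expr0n /= addr0 !invr1; lra.
rewrite big_ord_recr /=; apply: le_trans (lerD ih (lexx _)) _.
rewrite -[m.+2%:R]natr1; set x : R := m.+1%:R.
have x1 : 1 <= x by rewrite ler1n.
have -> : 3 - 2 / (x + 1) = 3 - 2 / x + 2 / (x * (x + 1)) by field; rewrite !gt_eqF //; lra.
rewrite lerD2l -[leLHS]mul1r ler_pdivrMr; last by nra.
by rewrite mulrAC ler_pdivlMr; nra.
Qed.

End SeqSums.

(** * The weight [<x>] on the lattice *)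

Section Lattice.
Context {R : realType} {d : nat}.
Implicit Types x y : lattice d.
Local Notation J := (japanese R).

Lemma jap_sqr x : J x ^+ 2 = 1 + \sum_(i < d) (x ord0 i)%:~R ^+ 2.
Proof. by rewrite sqr_sqrtr // addr_ge0 // sumr_ge0 // => i _; rewrite sqr_ge0. Qed.

Lemma jap_ge1 x : 1 <= J x.
Proof.
rewrite -(@ler_pXn2r _ 2) ?nnegrE ?sqrtr_ge0 ?ler01 // expr1n jap_sqr lerDl.
by apply: sumr_ge0 => i _; rewrite sqr_ge0.
Qed.

Lemma jap_gt0 x : 0 < J x. Proof. exact: lt_le_trans ltr01 (jap_ge1 x). Qed.

Lemma jap_ge0 x : 0 <= J x. Proof. exact: ltW (jap_gt0 x). Qed.

Lemma jap_coord x i : 1 + (x ord0 i)%:~R ^+ 2 <= J x ^+ 2.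
Proof.
rewrite jap_sqr lerD2l (bigD1 i) //= lerDl.
by apply: sumr_ge0 => j _; rewrite sqr_ge0.
Qed.

Lemma jap_coord_le x i : `|(x ord0 i)%:~R| <= J x.
Proof.
rewrite -(@ler_pXn2r _ 2) ?nnegrE ?jap_ge0 ?normr_ge0 // -normrX ger0_norm ?sqr_ge0 //.
by have := jap_coord x i; lra.
Qed.

Lemma neighbours_sym x y : neighbours x y = neighbours y x.
Proof. by rewrite /neighbours; congr (_ == _); apply: eq_bigr => i _; rewrite distrC. Qed.

(** Coordinatewise [b^2 <= a^2 + |b - a| (1 + 2 J x)], since each [|b - a|] is at most one; over the
    coordinates these differences sum to one. *)
Lemma neighbours_jap x y : neighbours x y -> J y <= J x + 1.
Proof.
rewrite /neighbours => /eqP /(congr1 (fun z : int => z%:~R : R)).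
rewrite rmorph_sum /= => E.
have j0 := jap_ge0 x.
rewrite -(@ler_pXn2r _ 2) ?nnegrE ?jap_ge0 ?addr_ge0 // sqrrD1 !jap_sqr.
suff : \sum_(i < d) ((y ord0 i)%:~R : R) ^+ 2 <=
       \sum_(i < d) ((x ord0 i)%:~R ^+ 2 + `|x ord0 i - y ord0 i|%:~R * (1 + 2 * J x)).
  by rewrite big_split /= -mulr_suml E mul1r; lra.
apply: ler_sum => i _.
have e1 : `|x ord0 i - y ord0 i|%:~R <= 1 :> R.
  rewrite -[leRHS]E (bigD1 i) //= lerDl; apply: sumr_ge0 => j _.
  by rewrite ler0z.
move: e1; rewrite intr_norm rmorphB /=.
have := jap_coord_le x i; set a : R := (x _ _)%:~R; set b : R := (y _ _)%:~R.
move=> h1 h2; have -> : b ^+ 2 = a ^+ 2 + (b - a) * (b + a) by ring.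
rewrite lerD2l distrC; apply: le_trans (ler_norm _) _; rewrite normrM ler_wpM2l //.
have -> : b + a = (b - a) + 2 * a by ring.
apply: le_trans (ler_normD _ _) _; rewrite normrM (ger0_norm (_ : 0 <= 2)) //.
by rewrite distrC; lra.
Qed.

Lemma neighbours_jap2 x y : neighbours x y -> J y <= 2 * J x.
Proof. by move=> /neighbours_jap; have := jap_ge1 x; lra. Qed.

Lemma jap_exp_nbr x y (r : nat) : neighbours x y -> J y ^+ r <= 2 ^+ r * J x ^+ r.
Proof.
move=> /neighbours_jap2 h; rewrite -exprMn lerXn2r // ?nnegrE ?jap_ge0 //.
by rewrite mulr_ge0 ?jap_ge0.
Qed.

Lemma jap_expV_nbr x y (r : nat) : neighbours x y -> J y ^- r <= 2 ^+ r * J x ^- r.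
Proof.
rewrite neighbours_sym => /(jap_exp_nbr r) h.
have p0 := exprn_gt0 r (jap_gt0 x); have p1 := exprn_gt0 r (jap_gt0 y).
by rewrite ler_pdivlMr // mulrC ler_pdivrMr.
Qed.

(** Coordinates are coded by absolute value and sign, so that a cube is the image of a finite type.
    Zero has two codes, which does no harm to finiteness or to upper bounds. *)
Definition lattice_point (n : nat) (f : {ffun 'I_d -> 'I_n.+1 * bool}) : lattice d :=
  \row_i (if (f i).2 then (f i).1%:Z else - (f i).1%:Z).

Lemma lattice_point_surj (n : nat) x : J x <= n%:R -> exists f, lattice_point (n := n) f = x.
Proof.
move=> xn; exists [ffun i => (inord `|x ord0 i|%N, 0 <= x ord0 i)].
apply/rowP => i; rewrite mxE ffunE /= inordK; last first.
  rewrite ltnS -(ler_nat R); apply: le_trans xn.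
  by have := jap_coord_le x i; rewrite -intr_norm -abszE.
case: (lerP 0 (x ord0 i)) => h; first by rewrite gez0_abs.
by rewrite ltz0_abs // opprK.
Qed.

Lemma finite_jap_ball (n : nat) : finite_set [set x : lattice d | J x <= n%:R].
Proof.
apply: (@sub_finite_set _ _ (lattice_point (n := n) @` setT)).
  by move=> x /= /lattice_point_surj[f <-]; exists f.
exact/finite_image/finite_finset.
Qed.

Lemma finite_neighbours x : finite_set [set y | neighbours x y].
Proof.
have [n xn] := exists_nat_gt (J x + 1).
apply: sub_finite_set (finite_jap_ball n.+1) => y /= /neighbours_jap h.
by apply: le_trans h (ltW _).
Qed.

(** Bounds [J ^- (2 d)] by a product of one-dimensional weights, so that the lattice sum
    factorises. *)
Lemma jap_prod x : \prod_(i < d) (1 + (x ord0 i)%:~R ^+ 2) <= J x ^+ (2 * d).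
Proof.
rewrite exprM -[X in _ <= _ ^+ X]card_ord -prodr_const.
by apply: ler_prod => i _; rewrite jap_coord andbT addr_ge0 // sqr_ge0.
Qed.

Lemma sum_jap (s : seq (lattice d)) : uniq s -> \sum_(x <- s) J x ^- (2 * d) <= 6 ^+ d.
Proof.
move=> us.
have [n sn] : exists n : nat, forall x, x \in s -> J x <= n%:R.
  elim: s {us} => [|x s [n ih]]; first by exists 0%N.
  have [m xm] := exists_nat_gt (J x).
  exists (maxn n m.+1) => y; rewrite inE => /orP[/eqP ->|/ih h].
    by apply: le_trans (ltW xm) _; rewrite ler_nat leq_maxr.
  by apply: le_trans h _; rewrite ler_nat leq_maxl.
pose g x : R := \prod_(i < d) (1 + (x ord0 i)%:~R ^+ 2)^-1.
have g0 x : 0 <= g x by apply: prodr_ge0 => i _; rewrite invr_ge0 addr_ge0 // sqr_ge0.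
apply: (@le_trans _ _ (\sum_(x <- s) g x)).
  apply: ler_sum => x _; rewrite /g prodfV lef_pV2 ?posrE ?exprn_gt0 ?jap_gt0 ?jap_prod //.
  by apply: prodr_gt0 => i _; rewrite ltr_pwDl // sqr_ge0.
(* [psi] picks a code for each point. It is injective on [s], so the sum over [s] is part of the sum
   over all codes, which distributes over the coordinates. *)
pose psi x := odflt [ffun=> (ord0, true)] [pick f | lattice_point (n := n) f == x].
have psiK x : x \in s -> lattice_point (psi x) = x.
  move=> xs; rewrite /psi; case: pickP => [f /eqP //|].
  by have [f fx] := lattice_point_surj (sn _ xs) => /(_ f); rewrite fx eqxx.
have -> : \sum_(x <- s) g x = \sum_(f <- map psi s) g (lattice_point f).
  by rewrite big_map big_seq [RHS]big_seq; apply: eq_bigr => x /psiK ->.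
apply: (@le_trans _ _ (\sum_(f <- enum {ffun 'I_d -> 'I_n.+1 * bool}) g (lattice_point f))).
  apply: uniq_sum_le => //.
  - rewrite map_inj_in_uniq // => x y xs ys E.
    by rewrite -(psiK x xs) -(psiK y ys) E.
  - exact: enum_uniq.
  - by move=> f _; rewrite mem_enum.
rewrite big_enum /= /g.
under eq_bigr => f _ do under eq_bigr => i _ do rewrite mxE.
under eq_bigr => f _.
  under eq_bigr => i _.
    have -> : (1 + (if (f i).2 then (f i).1%:Z else - (f i).1%:Z)%:~R ^+ 2)^-1 =
      (1 + ((f i).1%:R : R) ^+ 2)^-1.
      by case: (f i).2 => //; rewrite mulrNz sqrrN.
    over.
  over.
rewrite -(bigA_distr_bigA (fun (_ : 'I_d) (p : 'I_n.+1 * bool) => (1 + (p.1%:R : R) ^+ 2)^-1)) /=.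
rewrite -[X in _ <= _ ^+ X]card_ord -prodr_const; apply: ler_prod => i _.
apply/andP; split; first by apply: sumr_ge0 => p _; rewrite invr_ge0 addr_ge0 // sqr_ge0.
rewrite -(pair_big xpredT xpredT (fun (k : 'I_n.+1) (_ : bool) => (1 + (k%:R : R) ^+ 2)^-1)) /=.
under eq_bigr => k _ do rewrite big_bool /=.
(* Both signs together give twice the bound 3, whence the base 6. *)
rewrite big_split /=; have := sum_inv_sqr (R := R) n.+1; lra.
Qed.

End Lattice.

(** * Absolutely convergent sums over the cluster *)

Section Cluster.
Context {R : realType} {d : nat} (C : set (lattice d)).
Local Notation J x := (japanese R (val x)).
Local Notation q := (2 * d).+1.

Lemma finite_set_val (A : set (lattice d)) : finite_set A -> finite_set [set x : C | A (val x)].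
Proof. by apply: finite_preimage => x y _ _; exact: val_inj. Qed.

Definition box (n : nat) : {fset C} := fset_set [set x : C | J x <= n%:R].

Lemma in_box n x : (x \in box n) = (J x <= n%:R).
Proof.
rewrite in_fset_set; last exact/(finite_set_val (A := [set x | japanese R x <= n%:R]))/finite_jap_ball.
by apply/idP/idP; rewrite inE.
Qed.

Lemma box_sub m n : (m <= n)%N -> {subset box m <= box n}.
Proof. by move=> mn x; rewrite !in_box => /le_trans; apply; rewrite ler_nat. Qed.

Lemma in_box_ex x : exists n, x \in box n.+1.
Proof. by have [n xn] := exists_nat_gt (J x); exists n; rewrite in_box ltW. Qed.

Lemma subset_box (s : seq C) : exists n, {subset s <= box n.+1}.
Proof.
elim: s => [|x s [n ih]]; first by exists 0%N.
have [m xm] := in_box_ex x; exists (maxn m n) => y; rewrite inE => /orP[/eqP ->|/ih].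
  by apply: box_sub xm; rewrite ltnS leq_maxl.
by apply: box_sub; rewrite ltnS leq_maxr.
Qed.

Lemma sum_jap_val (s : seq C) : uniq s -> \sum_(x <- s) J x ^- (2 * d) <= 6 ^+ d.
Proof.
move=> us; rewrite -(big_map val xpredT (fun x : lattice d => japanese R x ^- (2 * d))).
by apply: sum_jap; rewrite map_inj_uniq //; exact: val_inj.
Qed.

Lemma jap_expV_ge0 (x : C) r : 0 <= J x ^- r.
Proof. by rewrite invr_ge0 exprn_ge0 // jap_ge0. Qed.

Lemma jap_exp_gt0 (x : C) r : 0 < J x ^+ r.
Proof. by rewrite exprn_gt0 // jap_gt0. Qed.

Lemma jap_expV_le (x : C) r r' : (r <= r')%N -> J x ^- r' <= J x ^- r.
Proof.
by move=> rr; rewrite lef_pV2 ?posrE ?jap_exp_gt0 // ler_weXn2l // jap_ge1.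
Qed.

Lemma sum_jap_le (s : seq C) : uniq s -> \sum_(x <- s) J x ^- q <= 6 ^+ d.
Proof.
move=> us; apply: le_trans (sum_jap_val us).
by apply: ler_sum => x _; exact: jap_expV_le.
Qed.

(** The reason for [q = 2 d + 1]: [2 d] powers make the sum converge and the last one supplies
    [1 / n]. *)
Lemma sum_jap_tail (s : seq C) n : uniq s -> (0 < n)%N ->
  (forall x, x \in s -> n%:R <= J x) -> \sum_(x <- s) J x ^- q <= 6 ^+ d / n%:R.
Proof.
move=> us n0 sn; have n0' : 0 < n%:R :> R by rewrite ltr0n.
apply: (@le_trans _ _ (\sum_(x <- s) J x ^- (2 * d) / n%:R)).
  rewrite big_seq [leRHS]big_seq; apply: ler_sum => x /sn xn.
  rewrite exprSr invfM ler_wpM2l ?jap_expV_ge0 // lef_pV2 ?posrE ?jap_gt0 //.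
by rewrite -mulr_suml ler_wpM2r ?sum_jap_val // invr_ge0.
Qed.

Lemma esum_box (g : C -> R) K n : 0 <= K -> (forall x, 0 <= g x) ->
  (forall x, g x <= K * J x ^- q) -> (0 < n)%N ->
  (\esum_(x in [set: C]) (g x)%:E < +oo)%E /\
  \sum_(x <- box n) g x <= fine (\esum_(x in [set: C]) (g x)%:E)%E <=
  \sum_(x <- box n) g x + K * (6 ^+ d / n%:R).
Proof.
move=> K0 g0 gK n0.
have fsE (F : {fset C}) : (\sum_(x \in [set` F]) (g x)%:E)%E = (\sum_(x <- F) g x)%:E.
  by rewrite fsumEFin // fsbig_finite // set_fsetK.
have key (F : {fset C}) : \sum_(x <- F) g x <= \sum_(x <- box n) g x + K * (6 ^+ d / n%:R).
  rewrite (bigID (fun x => x \in box n)) /=; apply: lerD.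
    rewrite -big_filter; apply: uniq_sum_le => //; [exact/filter_uniq/fset_uniq|exact: fset_uniq|].
    by move=> x; rewrite mem_filter => /andP[].
  rewrite -big_filter.
  apply: (@le_trans _ _ (\sum_(x <- [seq x <- F | x \notin box n]) K * J x ^- q)).
    by apply: ler_sum => x _; exact: gK.
  rewrite -mulr_sumr; apply: ler_wpM2l => //; apply: sum_jap_tail => //.
    exact/filter_uniq/fset_uniq.
  by move=> x; rewrite mem_filter in_box -ltNge => /andP[/ltW].
have lo : ((\sum_(x <- box n) g x)%:E <= \esum_(x in [set: C]) (g x)%:E)%E.
  by apply: esum_ge; exists [set` box n]; rewrite ?fsE //.
have hi : (\esum_(x in [set: C]) (g x)%:E <= (\sum_(x <- box n) g x + K * (6 ^+ d / n%:R))%:E)%E.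
  apply: ge_ereal_sup => _ [A [fA _] <-].
  rewrite -(fset_setK fA) fsE lee_fin; exact: key.
split; first by apply: le_lt_trans hi _; rewrite ltry.
by rewrite -!lee_fin fineK ?lo ?hi // fin_numElt (lt_le_trans _ lo) ?(le_lt_trans hi) ?ltry ?ltNyr.
Qed.

Lemma csum_box (f : C -> R) K n : 0 <= K -> (forall x, `|f x| <= K * J x ^- q) -> (0 < n)%N ->
  `|csum f - \sum_(x <- box n) f x| <= K * (6 ^+ d / n%:R).
Proof.
move=> K0 fK n0.
have h1 : forall x, Num.max (f x) 0 <= K * J x ^- q.
  by move=> x; rewrite ge_max (le_trans (ler_norm _) (fK x)) mulr_ge0 // jap_expV_ge0.
have h2 : forall x, Num.max (- f x) 0 <= K * J x ^- q.
  by move=> x; rewrite ge_max mulr_ge0 ?jap_expV_ge0 // (le_trans (ler_norm _)) // normrN fK.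
have g1 x : 0 <= Num.max (f x) 0 by rewrite le_max lexx orbT.
have g2 x : 0 <= Num.max (- f x) 0 by rewrite le_max lexx orbT.
have [_ /andP[a1 a2]] := esum_box K0 g1 h1 n0.
have [_ /andP[b1 b2]] := esum_box K0 g2 h2 n0.
have E : \sum_(x <- box n) f x =
    \sum_(x <- box n) Num.max (f x) 0 - \sum_(x <- box n) Num.max (- f x) 0.
  rewrite -sumrB; apply: eq_bigr => x _.
  by case: (leP (f x) 0) => h; case: (leP (- f x) 0) => h'; lra.
rewrite /csum E ler_norml; apply/andP; split; lra.
Qed.

Lemma ler_inv_nat (x y K : R) : 0 <= K -> (forall n, (0 < n)%N -> x <= y + K / n%:R) -> x <= y.
Proof.
move=> K0 h; apply: (@ler_eps _ _ _ 1) => // e e0.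
have [n nK] := exists_nat_gt (K / e).
apply: le_trans (h n.+1 isT) _; rewrite lerD2l mulr1 ler_pdivrMr ?ltr0n //.
by rewrite mulrC -ler_pdivrMr // ltW.
Qed.

(** The algebra of [csum] is obtained through this criterion from finite sums over boxes, instead of
    through positive and negative parts. *)
Lemma csum_unique (f : C -> R) c K K' : 0 <= K -> (forall x, `|f x| <= K * J x ^- q) ->
  0 <= K' -> (forall n, (0 < n)%N -> `|c - \sum_(x <- box n) f x| <= K' / n%:R) -> csum f = c.
Proof.
move=> K0 fK K'0 h; apply/eqP; rewrite -subr_eq0 -normr_le0.
have S0 : 0 <= (6 : R) ^+ d by [].
apply: (@ler_inv_nat _ _ (K * 6 ^+ d + K')); first by rewrite addr_ge0 ?mulr_ge0.
move=> n n0; rewrite add0r mulrDl.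
have := csum_box K0 fK n0; have := h n n0.
set b := \sum_(_ <- _) _.
have := ler_distD b (csum f) c; rewrite (distrC b c) -mulrA; lra.
Qed.

Lemma csum_le (f : C -> R) K : 0 <= K -> (forall x, `|f x| <= K * J x ^- q) ->
  `|csum f| <= 2 * 6 ^+ d * K.
Proof.
move=> K0 fK; have := csum_box K0 fK (ltn0Sn 0); rewrite divr1.
have : `|\sum_(x <- box 1) f x| <= 6 ^+ d * K.
  apply: le_trans (ler_norm_sum _ _ _) _.
  apply: (@le_trans _ _ (\sum_(x <- box 1) K * J x ^- q)); first exact: ler_sum.
  rewrite -mulr_sumr mulrC; apply: ler_wpM2r => //; apply: sum_jap_le; exact: fset_uniq.
set b := \sum_(_ <- _) _; have := ler_normD (csum f - b) b; rewrite subrK; lra.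
Qed.

Lemma csumD (f g : C -> R) K K' : 0 <= K -> 0 <= K' -> (forall x, `|f x| <= K * J x ^- q) ->
  (forall x, `|g x| <= K' * J x ^- q) -> csum (fun x => f x + g x) = csum f + csum g.
Proof.
move=> K0 K'0 fK gK; have S0 : 0 <= (6 : R) ^+ d by [].
apply: (@csum_unique _ _ (K + K') (K * 6 ^+ d + K' * 6 ^+ d)); rewrite ?addr_ge0 ?mulr_ge0 //.
  by move=> x; apply: le_trans (ler_normD _ _) _; rewrite mulrDl lerD.
move=> n n0; rewrite big_split /=.
have := csum_box K0 fK n0; have := csum_box K'0 gK n0.
set a := \sum_(_ <- _) _; set b := \sum_(_ <- _) _ => h1 h2.
have -> : csum f + csum g - (b + a) = (csum f - b) + (csum g - a) by ring.
by apply: le_trans (ler_normD _ _) _; rewrite mulrDl -!mulrA; lra.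
Qed.

Lemma csumZ (c : R) (f : C -> R) K : 0 <= K -> (forall x, `|f x| <= K * J x ^- q) ->
  csum (fun x => c * f x) = c * csum f.
Proof.
move=> K0 fK; have S0 : 0 <= (6 : R) ^+ d by [].
apply: (@csum_unique _ _ (`|c| * K) (`|c| * K * 6 ^+ d)); rewrite ?mulr_ge0 //.
  by move=> x; rewrite normrM -mulrA ler_wpM2l.
move=> n n0; rewrite -mulr_sumr -mulrBr normrM -!mulrA ler_wpM2l //.
exact: csum_box.
Qed.

Lemma csum_term_eq0 (f : C -> R) : (forall x, f x = 0) -> csum f = 0.
Proof.
move=> f0; apply: (@csum_unique _ _ 0 0) => //.
  by move=> x; rewrite f0 normr0 mul0r.
by move=> n n0; rewrite big1 ?subrr ?normr0 ?mul0r.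
Qed.

Lemma csum_sum (I : Type) (r : seq I) (F : I -> C -> R) (K : I -> R) :
  (forall i, 0 <= K i) -> (forall i x, `|F i x| <= K i * J x ^- q) ->
  csum (fun x => \sum_(i <- r) F i x) = \sum_(i <- r) csum (F i).
Proof.
move=> K0 FK; elim: r => [|i r ih].
  by rewrite big_nil; apply: csum_term_eq0 => x; rewrite big_nil.
rewrite big_cons -ih -(@csumD _ _ (K i) (\sum_(j <- r) K j)) //.
- by congr csum; apply/funext => x; rewrite big_cons.
- exact: sumr_ge0.
- move=> x; apply: le_trans (ler_norm_sum _ _ _) _.
  by rewrite mulr_suml; apply: ler_sum.
Qed.

Lemma csum_delta (f : C -> R) x0 : csum (fun x => (x == x0)%:R * f x) = f x0.
Proof.
have K0 : 0 <= `|f x0| * J x0 ^+ q by rewrite mulr_ge0 // ltW // jap_exp_gt0.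
have b0 : forall x, `|(x == x0)%:R * f x| <= `|f x0| * J x0 ^+ q * J x ^- q.
  move=> x; case: eqP => [->|_]; last by rewrite mul0r normr0 mulr_ge0 // jap_expV_ge0.
  by rewrite mul1r -mulrA divff ?mulr1 // gt_eqF // jap_exp_gt0.
(* A box that misses [x0] has [n < J x0], and then the error [|f x0|] is at most
   [|f x0| J x0 / n]. *)
apply: (@csum_unique _ _ _ (`|f x0| * J x0) K0 b0); first by rewrite mulr_ge0 // jap_ge0.
move=> n n0; have [xn|xn] := boolP (x0 \in box n).
  rewrite (big_fsetD1 x0) //= eqxx mul1r big1_seq; last first.
    by move=> x; rewrite in_fsetD1 => /andP[_ /andP[/negbTE -> _]]; rewrite mul0r.
  by rewrite addr0 subrr normr0 mulr_ge0 ?invr_ge0 // mulr_ge0 // jap_ge0.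
rewrite big1_seq ?subr0; last first.
  by move=> x /= xb; case: eqP => [xx|]; rewrite ?mul0r //; rewrite xx (negbTE xn) in xb.
rewrite ler_pdivlMr ?ltr0n // ler_wpM2l //.
by move: xn; rewrite in_box -ltNge => /ltW.
Qed.

Lemma summable_jap (f : C -> R) K : 0 <= K -> (forall x, `|f x| <= K * J x ^- q) ->
  summable [set: C] (fun x => (f x)%:E).
Proof.
by move=> K0 fK; rewrite /summable; have [] := esum_box K0 (fun x => normr_ge0 (f x)) fK (ltn0Sn 0).
Qed.

End Cluster.

(** * The Laplacian and the energy estimate *)

Section Laplacian.
Context {R : realType} {d : nat} (omega : lattice d -> lattice d -> R) (C : set (lattice d)) (A : R).

Definition quadratic_rates := [/\ conductances omega, 0 <= A &
  forall x : lattice d, total_rate omega x <= A * japanese R x ^+ 2].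

Context (hw : quadratic_rates).
Implicit Types (x y : C) (u f g : C -> R).
Local Notation J x := (japanese R (val x)).
Local Notation w x y := (omega (val x) (val y)).
Local Notation L := (laplacian omega).
Local Notation q := (2 * d).+1.
Local Notation bx := (@box R d C).

Let A0 : 0 <= A. Proof. by case: hw. Qed.
Let w0 x y : 0 <= w x y. Proof. by case: hw => -[]. Qed.
Let wC x y : w x y = w y x. Proof. by case: hw => -[]. Qed.
Let wN x y : ~~ neighbours (val x) (val y) -> w x y = 0.
Proof. by case: hw => -[_ _ h] _ _; exact: h. Qed.

Definition nbr x : {fset C} := fset_set [set y : C | neighbours (val x) (val y)].

Lemma finite_nbr x : finite_set [set y : C | neighbours (val x) (val y)].
Proof.
have := @finite_set_val _ C _ (finite_neighbours (R := R) (val x)).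
by congr finite_set; apply/seteqP; split.
Qed.

Lemma in_nbr x y : (y \in nbr x) = neighbours (val x) (val y).
Proof.
rewrite in_fset_set; last exact: finite_nbr.
by apply/idP/idP; rewrite inE.
Qed.

Lemma laplacian_nbr u x : L u x = \sum_(y <- nbr x) w x y * (u x - u y).
Proof. by rewrite /laplacian fsbig_finite //; exact: finite_nbr. Qed.

(** Counts only neighbours inside [C]. It is at most [total_rate] for any [C]; equality requires
    that no edge leaves [C], which is proved later for the component. *)
Definition crate x : R := \sum_(y <- nbr x) w x y.

Lemma laplacian_crate u x : L u x = crate x * u x - \sum_(y <- nbr x) w x y * u y.
Proof.
rewrite laplacian_nbr /crate mulr_suml -sumrB.
by apply: eq_bigr => y _; rewrite mulrBr.
Qed.

Lemma crate_ge0 x : 0 <= crate x. Proof. by apply: sumr_ge0 => y _. Qed.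

Lemma crate_le x : crate x <= A * J x ^+ 2.
Proof.
case: hw => -[h1 h2 h3] _ /(_ (val x)); apply: le_trans.
rewrite /total_rate fsbig_finite; last exact: (finite_neighbours (R := R)).
rewrite /crate -(big_map val xpredT (omega (val x))).
apply: uniq_sum_le => //.
- by rewrite map_inj_uniq ?fset_uniq //; exact: val_inj.
- exact: fset_uniq.
- move=> y' /mapP[y]; rewrite in_nbr => xy ->.
  rewrite in_fset_set; last exact: (finite_neighbours (R := R)).
  by rewrite inE.
Qed.

Lemma rate_seq_le x (s : seq C) : uniq s -> \sum_(y <- s) w x y <= A * J x ^+ 2.
Proof.
move=> us; apply: le_trans (crate_le x).
rewrite (bigID (fun y => y \in nbr x)) /= [X in _ + X]big1 ?addr0; last first.
  by move=> y; rewrite in_nbr => /wN.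
rewrite -big_filter; apply: uniq_sum_le => //.
- exact: filter_uniq.
- exact: fset_uniq.
- by move=> y; rewrite mem_filter => /andP[].
- by move=> y _ _; exact: w0.
Qed.

Lemma laplacian_seq u x (s : seq C) : uniq s -> {subset nbr x <= s} ->
  L u x = \sum_(y <- s) w x y * (u x - u y).
Proof.
move=> us ss; rewrite laplacian_nbr; apply: (uniq_sum_eq (fset_uniq _) us ss).
by move=> y _; rewrite in_nbr => /wN ->; rewrite mul0r.
Qed.

Lemma nbr_box x n : x \in bx n -> {subset nbr x <= bx n.+1}.
Proof.
rewrite in_box => xn y; rewrite in_nbr in_box => /neighbours_jap -/(_ R) h.
by rewrite -natr1; lra.
Qed.

Lemma laplacian_le u g (c : R) x : 0 <= c ->
  (forall x y, neighbours (val x) (val y) -> g y <= c * g x) ->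
  (forall x, `|u x| <= g x) -> `|L u x| <= A * J x ^+ 2 * ((1 + c) * g x).
Proof.
move=> c0 gc ug; rewrite laplacian_nbr; apply: le_trans (ler_norm_sum _ _ _) _.
apply: (@le_trans _ _ (\sum_(y <- nbr x) w x y * ((1 + c) * g x))).
  rewrite big_seq [leRHS]big_seq; apply: ler_sum => y; rewrite in_nbr => xy.
  rewrite normrM ger0_norm // ler_wpM2l //; apply: le_trans (ler_normB _ _) _.
  by rewrite mulrDl mul1r lerD // (le_trans (ug y)) // gc.
have g0 : 0 <= g x by apply: le_trans (ug x).
by rewrite -mulr_suml ler_wpM2r ?crate_le // mulr_ge0 // addr_ge0.
Qed.

(** The weight changes by at most a factor 2 between neighbours, and the rate brings two powers of
    [J]: this is the loss from [N] to [N + 2]. *)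
Lemma laplacian_poly u K M : (forall x, `|u x| <= K * J x ^+ M) ->
  forall x, `|L u x| <= A * (1 + 2 ^+ M) * K * J x ^+ (M + 2).
Proof.
move=> uK x.
have h : forall x y, neighbours (val x) (val y) -> K * J y ^+ M <= 2 ^+ M * (K * J x ^+ M).
  move=> x' y xy; rewrite mulrCA ler_wpM2l ?jap_exp_nbr //.
  by rewrite -(pmulr_lge0 _ (jap_exp_gt0 x' M)) (le_trans _ (uK x')).
apply: le_trans (laplacian_le x _ h uK) _; first exact: exprn_ge0.
by rewrite exprD le_eqVlt; apply/orP; left; apply/eqP; ring.
Qed.

Lemma laplacianD u v x : L (fun x => u x + v x) x = L u x + L v x.
Proof. by rewrite !laplacian_nbr -big_split; apply: eq_bigr => y _; rewrite /=; ring. Qed.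

Lemma laplacianZ (c : R) u x : L (fun x => c * u x) x = c * L u x.
Proof. by rewrite !laplacian_nbr mulr_sumr; apply: eq_bigr => y _; ring. Qed.

Lemma laplacianB u v x : L (fun x => u x - v x) x = L u x - L v x.
Proof. by rewrite !laplacian_nbr -sumrB; apply: eq_bigr => y _; ring. Qed.

Lemma ucont_laplacian T (u : R -> C -> R) x : (forall x, ucont T (u^~ x)) ->
  ucont T (fun t => L (u t) x).
Proof.
move=> cu; apply: eq_ucont (_ : ucont T (fun t => \sum_(y <- nbr x) w x y * (u t x - u t y))).
  by move=> t _ _; rewrite laplacian_nbr.
by apply: ucont_sum => y; apply: ucontZ; apply: ucontB.
Qed.

Lemma uderiv_laplacian T (u u' : R -> C -> R) x : (forall x, uderiv T (u^~ x) (u'^~ x)) ->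
  uderiv T (fun t => L (u t) x) (fun t => L (u' t) x).
Proof.
move=> du; apply: eq_uderiv (_ : uderiv T (fun t => \sum_(y <- nbr x) w x y * (u t x - u t y))
  (fun t => \sum_(y <- nbr x) w x y * (u' t x - u' t y))).
- by move=> t _ _; rewrite laplacian_nbr.
- by move=> t _ _; rewrite laplacian_nbr.
- by apply: uderiv_sum => y; apply: uderivZ; apply: uderivB.
Qed.

(** An edge leaving the box has [n < J y <= 2 J x], so each term may be multiplied by [2 J x / n].
    Of the [q + 3] powers one pays for this factor, two for the rates, and [q] for the sum over
    [x]. *)
Lemma shell_sum (F : C -> C -> R) B n : 0 <= B -> (0 < n)%N ->
  (forall x y, neighbours (val x) (val y) -> `|F x y| <= B * J x ^- (q + 3)) ->
  `|\sum_(x <- bx n) \sum_(y <- bx n.+1 | y \notin bx n) w x y * F x y|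
    <= 2 * A * B * 6 ^+ d / n%:R.
Proof.
move=> B0 n0 FB; have n0' : 0 < n%:R :> R by rewrite ltr0n.
apply: le_trans (ler_norm_sum _ _ _) _.
apply: (@le_trans _ _ (\sum_(x <- bx n) 2 * A * B / n%:R * J x ^- q)); last first.
  have -> : 2 * A * B * 6 ^+ d / n%:R = 2 * A * B / n%:R * 6 ^+ d by ring.
  rewrite -mulr_sumr; apply: ler_wpM2l; last exact/sum_jap_le/fset_uniq.
  by rewrite !mulr_ge0 // invr_ge0 ltW.
apply: ler_sum => x _; apply: le_trans (ler_norm_sum _ _ _) _.
apply: (@le_trans _ _ (\sum_(y <- bx n.+1 | y \notin bx n) w x y * (B * J x ^- (q + 3) * (2 * J x / n%:R)))).
  apply: ler_sum => y yn; rewrite normrM ger0_norm //.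
  have [xy|/wN ->] := boolP (neighbours (val x) (val y)); last by rewrite !mul0r.
  rewrite ler_wpM2l //; apply: le_trans (FB x y xy) _.
  rewrite ler_peMr //; first by rewrite mulr_ge0 // jap_expV_ge0.
  rewrite ler_pdivlMr // mul1r; apply: le_trans (neighbours_jap2 xy).
  by move: yn; rewrite in_box -ltNge => /ltW.
rewrite -mulr_suml -big_filter.
have us : uniq [seq y <- bx n.+1 | y \notin bx n] by exact/filter_uniq/fset_uniq.
have j0 := jap_gt0 (R := R) (val x).
apply: le_trans (ler_wpM2r _ (rate_seq_le x us)) _.
  by rewrite !mulr_ge0 ?jap_expV_ge0 ?invr_ge0 // ltW.
rewrite (exprD _ q 3) le_eqVlt; apply/orP; left; apply/eqP; have jq := jap_exp_gt0 (R := R) x q.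
by field; rewrite !gt_eqF.
Qed.

(** Over pairs inside the box the summand is antisymmetric, so their double sum is its own negative;
    only the edges leaving the box remain. *)
Lemma green f g n : \sum_(x <- bx n) (f x * L g x - g x * L f x) =
  \sum_(x <- bx n) \sum_(y <- bx n.+1 | y \notin bx n) w x y * (g x * f y - f x * g y).
Proof.
have E x : x \in bx n -> f x * L g x - g x * L f x =
    \sum_(y <- bx n) w x y * (g x * f y - f x * g y) +
    \sum_(y <- bx n.+1 | y \notin bx n) w x y * (g x * f y - f x * g y).
  move=> xn; rewrite !(laplacian_seq _ (fset_uniq (bx n.+1)) (nbr_box xn)).
  rewrite !mulr_sumr -sumrB (bigID (fun y => y \in bx n)) /=; congr (_ + _).
    rewrite -big_filter (perm_big (bx n)).
      by apply: eq_bigr => y _; ring.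
    apply: uniq_perm; [exact/filter_uniq/fset_uniq|exact: fset_uniq|].
    move=> y; rewrite mem_filter; case: (boolP (y \in bx n)) => //= yn.
    by apply: box_sub yn; exact: leqnSn.
  by apply: eq_bigr => y _; ring.
rewrite big_seq (eq_bigr _ E) -big_seq big_split /= -[RHS]add0r; congr (_ + _).
set S := \sum_(x <- _) _.
have : S = - S.
  rewrite /S {1}exchange_big /= -sumrN; apply: eq_bigr => x _; rewrite -sumrN.
  by apply: eq_bigr => y _; rewrite wC; ring.
by move=> h; lra.
Qed.

Lemma green_le f g K1 K2 M n : (0 < n)%N -> (forall x, `|f x| <= K1 * J x ^+ M) ->
  (forall x, `|g x| <= K2 * J x ^- (M + (q + 3))) -> 0 <= K1 -> 0 <= K2 ->
  `|\sum_(x <- bx n) (f x * L g x - g x * L f x)| <=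
   2 * A * (K1 * K2 * (2 ^+ M + 2 ^+ (M + (q + 3)))) * 6 ^+ d / n%:R.
Proof.
move=> n0 fK gK K10 K20; rewrite green; apply: shell_sum => //.
  by rewrite !mulr_ge0 // addr_ge0 // exprn_ge0.
move=> x y xy; apply: le_trans (ler_normB _ _) _; rewrite !normrM.
have h1 : `|f y| <= K1 * (2 ^+ M * J x ^+ M).
  by apply: le_trans (fK y) _; rewrite ler_wpM2l // jap_exp_nbr.
have h2 : `|g y| <= K2 * (2 ^+ (M + (q + 3)) * J x ^- (M + (q + 3))).
  by apply: le_trans (gK y) _; rewrite ler_wpM2l // jap_expV_nbr.
apply: le_trans (lerD (ler_pM _ _ (gK x) h1) (ler_pM _ _ (fK x) h2)) _ => //.
have j1 := jap_exp_gt0 (R := R) x M; have j2 := jap_exp_gt0 (R := R) x (q + 3).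
rewrite (exprD (J x) M) le_eqVlt; apply/orP; left; apply/eqP.
by field; rewrite !gt_eqF.
Qed.

End Laplacian.

(** * The weighted energy estimate *)

Section Energy.
Context {R : realType} {d : nat} (omega : lattice d -> lattice d -> R) (C : set (lattice d)) (A : R).
Context (hw : quadratic_rates omega A).
Implicit Types (x y : C) (u f g : C -> R).
Local Notation J x := (japanese R (val x)).
Local Notation w x y := (omega (val x) (val y)).
Local Notation L := (laplacian omega).
Local Notation q := (2 * d).+1.
Local Notation bx := (@box R d C).

Let A0 : 0 <= A. Proof. by case: hw. Qed.
Let w0 x y : 0 <= w x y. Proof. by case: hw => -[]. Qed.
Let wC x y : w x y = w y x. Proof. by case: hw => -[]. Qed.
Let wN x y : ~~ neighbours (val x) (val y) -> w x y = 0.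
Proof. by case: hw => -[_ _ h] _ _; exact: h. Qed.
Let J0 x : 0 < J x. Proof. exact: jap_gt0. Qed.
Let J1 x : 1 <= J x. Proof. exact: jap_ge1. Qed.
Let X0 : 0 <= (6 : R) ^+ d. Proof. by []. Qed.

(* Neighbouring values differ by a factor [1 + O(1 / J)], which the rates [O(J^2)] turn into a bounded
   error in the energy estimate. *)
Definition moderate (k : nat) (a : C -> R) := forall x y, neighbours (val x) (val y) ->
  a y <= (1 + 2 / J x) ^+ k * a x /\ a x <= (1 + 2 / J x) ^+ k * a y.

Let th0 x : 0 <= 2 / J x. Proof. by rewrite divr_ge0 // ltW. Qed.
Let th2 x : 2 / J x <= 2. Proof. by rewrite ler_pdivrMr // ler_peMr. Qed.

(** The exponent 1 does not depend on [e]; this keeps the energy constant the same for all damped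
    weights. *)
Lemma moderate_affine (e : R) : 0 <= e -> moderate 1 (fun x => 1 + e * J x).
Proof.
move=> e0 x y xy; rewrite expr1.
have h1 := neighbours_jap (R := R) xy.
have h2 : J x <= J y + 1 by apply: neighbours_jap; rewrite neighbours_sym.
have := J0 x; have := J1 y; have := th0 x.
have E : 2 / J x * J x = 2 by rewrite divfK // gt_eqF.
move: E; set th := 2 / J x => E t0 y1 x0.
have h3 : 1 <= th * J y by have := ler_wpM2l t0 h2; have : J x <= 2 * J y; [lra|]; nra.
split; nra.
Qed.

Lemma moderate_jap : moderate 1 (fun x => J x).
Proof.
move=> x y xy; rewrite expr1.
have h1 := neighbours_jap (R := R) xy.
have h2 : J x <= J y + 1 by apply: neighbours_jap; rewrite neighbours_sym.
have := J0 x; have := J1 y; have := th0 x.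
have E : 2 / J x * J x = 2 by rewrite divfK // gt_eqF.
move: E; set th := 2 / J x => E t0 y1 x0.
have h3 : 1 <= th * J y by have : J x <= 2 * J y; [lra|]; nra.
split; nra.
Qed.

Lemma moderateM k l a b : (forall x, 0 <= a x) -> (forall x, 0 <= b x) ->
  moderate k a -> moderate l b -> moderate (k + l) (fun x => a x * b x).
Proof.
move=> a0 b0 ma mb x y xy.
have [h1 h2] := ma x y xy; have [h3 h4] := mb x y xy.
by rewrite exprD mulrACA; split; [rewrite ler_pM|rewrite mulrACA ler_pM].
Qed.

Lemma moderateV k a : (forall x, 0 < a x) -> moderate k a -> moderate k (fun x => (a x)^-1).
Proof.
move=> a0 ma x y xy; have [h1 h2] := ma x y xy.
by split; rewrite ler_pdivlMr // mulrC ler_pdivrMr.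
Qed.

Lemma moderateX k a n : (forall x, 0 <= a x) -> moderate k a -> moderate (n * k) (fun x => a x ^+ n).
Proof.
move=> a0 ma; elim: n => [|n ih] x y xy; first by rewrite !expr0 mul1r.
have [h1 h2] := ma x y xy; have [h3 h4] := ih x y xy.
have p : 0 <= (1 + 2 / J x) ^+ k by rewrite exprn_ge0 // addr_ge0.
have p' : 0 <= (1 + 2 / J x) ^+ (n * k) by rewrite exprn_ge0 // addr_ge0.
by rewrite mulSn exprD !exprS mulrACA; split; [|rewrite mulrACA]; rewrite ler_pM // exprn_ge0.
Qed.

(** The left side equals [u v (a - b)^2 - (a u - b v)^2], where [(a - b)^2 <= (s - 1)^2 a b] and
    [a u b v <= (a^2 u^2 + b^2 v^2) / 2]. The error is quadratic in [s - 1], which is just what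
    quadratic rates tolerate. *)
Lemma weighted_product (a b u v s : R) : 0 <= a -> 0 <= b -> b <= s * a -> a <= s * b -> 1 <= s ->
  - ((a ^+ 2 * u - b ^+ 2 * v) * (u - v)) <= (s - 1) ^+ 2 * (a ^+ 2 * u ^+ 2 + b ^+ 2 * v ^+ 2) / 2.
Proof.
move=> a0 b0 ba ab s1.
have dab : (a - b) ^+ 2 <= (s - 1) ^+ 2 * (a * b).
  have [h|/ltW h] := leP a b.
    have : b - a <= (s - 1) * a by lra.
    have : 0 <= b - a by lra.
    move=> h1 h2; have : (b - a) * (b - a) <= (s - 1) * a * ((s - 1) * a) by apply: ler_pM.
    have : (s - 1) * a * ((s - 1) * a) <= (s - 1) * a * ((s - 1) * b).
      by apply: ler_wpM2l; [nra|apply: ler_wpM2l; lra].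
    by rewrite !expr2; lra.
  have : a - b <= (s - 1) * b by lra.
  have : 0 <= a - b by lra.
  move=> h1 h2; have : (a - b) * (a - b) <= (s - 1) * b * ((s - 1) * b) by apply: ler_pM.
  have : (s - 1) * b * ((s - 1) * b) <= (s - 1) * b * ((s - 1) * a).
    by apply: ler_wpM2l; [nra|apply: ler_wpM2l; lra].
  by rewrite !expr2; lra.
have -> : - ((a ^+ 2 * u - b ^+ 2 * v) * (u - v)) = u * v * (a - b) ^+ 2 - (a * u - b * v) ^+ 2 by ring.
have sq1 := sqr_ge0 (a * u - b * v); have sq2 := sqr_ge0 (a - b).
have rhs0 : 0 <= (s - 1) ^+ 2 * (a ^+ 2 * u ^+ 2 + b ^+ 2 * v ^+ 2).
  by rewrite mulr_ge0 ?sqr_ge0 // addr_ge0 // mulr_ge0 ?sqr_ge0.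
have [uv|uv] := leP (u * v) 0; first by have : u * v * (a - b) ^+ 2 <= 0; [rewrite mulr_le0_ge0|lra].
have h1 := ler_wpM2l (ltW uv) dab.
have h2 : u * v * ((s - 1) ^+ 2 * (a * b)) <= (s - 1) ^+ 2 * (a ^+ 2 * u ^+ 2 + b ^+ 2 * v ^+ 2) / 2.
  have -> : u * v * ((s - 1) ^+ 2 * (a * b)) = (s - 1) ^+ 2 * ((a * u) * (b * v)) by ring.
  rewrite -[leRHS]mulrA ler_wpM2l ?sqr_ge0 //.
  by have := sqr_ge0 (a * u - b * v); rewrite !expr2; lra.
lra.
Qed.

(** Symmetrised over pairs in the box, the form is bounded edge by edge with [weighted_product]; the
    squared relative oscillation [O(1 / J^2)] of the weight cancels the rates [O(J^2)]. The edges
    leaving the box are left to [shell_sum]. *)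
Lemma energy_dissipation k a f K M D n : moderate k a -> (forall x, 0 <= a x) -> 0 <= K -> 0 <= D ->
  (forall x, `|f x| <= K * J x ^+ M) -> (forall x, a x ^+ 2 <= D * J x ^- (2 * M + (q + 3))) ->
  (0 < n)%N ->
  - (2 * \sum_(x <- bx n) a x ^+ 2 * f x * L f x) <=
    16 * 16 ^+ k * A * (\sum_(x <- bx n) a x ^+ 2 * f x ^+ 2) +
    4 * A * (D * K ^+ 2 * (1 + 2 ^+ M)) * 6 ^+ d / n%:R.
Proof.
move=> ma a0 K0 D0 fK aD n0.
(* [(2 / J * 4 ^ k)^2 = c1 / J^2]. Replacing [J x] by a neighbouring [J y] costs a factor 4, halved
   by [weighted_product], and the two orientations of an edge double it: in all
   [4 c1 = 16 * 16 ^ k]. *)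
pose c1 : R := 4 * 16 ^+ k.
pose e x := a x ^+ 2 * f x ^+ 2.
have e0 x : 0 <= e x by rewrite mulr_ge0 ?sqr_ge0.
have E x : x \in bx n -> a x ^+ 2 * f x * L f x =
    \sum_(y <- bx n) w x y * (a x ^+ 2 * f x * (f x - f y)) +
    \sum_(y <- bx n.+1 | y \notin bx n) w x y * (a x ^+ 2 * f x * (f x - f y)).
  move=> xn; rewrite (laplacian_seq hw _ (fset_uniq (bx n.+1)) (nbr_box xn)).
  rewrite mulr_sumr (bigID (fun y => y \in bx n)) /=; congr (_ + _).
    rewrite -big_filter (perm_big (bx n)).
      by apply: eq_bigr => y _; ring.
    apply: uniq_perm; [exact/filter_uniq/fset_uniq|exact: fset_uniq|].
    move=> y; rewrite mem_filter; case: (boolP (y \in bx n)) => //= yn.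
    by apply: box_sub yn; exact: leqnSn.
  by apply: eq_bigr => y _; ring.
rewrite big_seq (eq_bigr _ E) -big_seq big_split /=.
set I1 := \sum_(x <- _) _; set I2 := \sum_(x <- _) _.
have hI2 : `|I2| <= 2 * A * (D * K ^+ 2 * (1 + 2 ^+ M)) * 6 ^+ d / n%:R.
  apply: (shell_sum hw) => //.
    by rewrite !mulr_ge0 ?sqr_ge0 // addr_ge0 // exprn_ge0.
  move=> x y xy; rewrite normrM [X in X * _]normrM (ger0_norm (sqr_ge0 _)).
  have h1 : `|f x - f y| <= K * J x ^+ M * (1 + 2 ^+ M).
    apply: le_trans (ler_normB _ _) _; rewrite mulrDr mulr1; apply: lerD => //.
    apply: le_trans (fK y) _; rewrite -mulrA ler_wpM2l // mulrC; exact: jap_exp_nbr.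
  apply: le_trans (ler_pM _ _ (ler_pM _ _ (aD x) (fK x)) h1) _; rewrite ?mulr_ge0 ?sqr_ge0 //.
  have j1 := jap_exp_gt0 (R := R) x M; have j2 := jap_exp_gt0 (R := R) x (q + 3).
  rewrite (exprD (J x)) mul2n -addnn exprD le_eqVlt; apply/orP; left; apply/eqP.
  by field; rewrite !gt_eqF.
have hI1 : - (2 * I1) <= 16 * 16 ^+ k * A * \sum_(x <- bx n) e x.
  have -> : - (2 * I1) = \sum_(x <- bx n) \sum_(y <- bx n)
      w x y * - ((a x ^+ 2 * f x - a y ^+ 2 * f y) * (f x - f y)).
    have -> : - (2 * I1) = - I1 - I1 by ring.
    have E1 : I1 = \sum_(x <- bx n) \sum_(y <- bx n) w y x * (a y ^+ 2 * f y * (f y - f x)).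
      by rewrite /I1 exchange_big.
    rewrite {2}E1 /I1 -!sumrN -big_split /=; apply: eq_bigr => x _.
    rewrite -!sumrN -big_split /=; apply: eq_bigr => y _.
    by rewrite (wC y x); ring.
  apply: (@le_trans _ _ (\sum_(x <- bx n) \sum_(y <- bx n)
      w x y * (2 * c1 * (e x / J x ^+ 2 + e y / J y ^+ 2)))).
    apply: ler_sum => x _; apply: ler_sum => y _.
    have [xy|/wN ->] := boolP (neighbours (val x) (val y)); last by rewrite !mul0r.
    rewrite ler_wpM2l //.
    have [h1 h2] := ma x y xy.
    have s1 : 1 <= (1 + 2 / J x) ^+ k by apply: exprn_ege1; rewrite lerDl.
    apply: le_trans (weighted_product (f x) (f y) (a0 x) (a0 y) h1 h2 s1) _.
    have s2 := one_plus_pow k (th0 x) (th2 x).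
    have s3 : ((1 + 2 / J x) ^+ k - 1) ^+ 2 <= c1 / J x ^+ 2.
      have h : (1 + 2 / J x) ^+ k - 1 <= 2 / J x * 4 ^+ k by lra.
      have h' : 0 <= (1 + 2 / J x) ^+ k - 1 by lra.
      have := ler_pM h' h' h h; rewrite -expr2 => /le_trans; apply.
      rewrite /c1 le_eqVlt; apply/orP; left; apply/eqP.
      have -> : (16 : R) = 4 * 4 by lra.
      by rewrite exprMn; field; rewrite gt_eqF.
    have s4 : (J x ^+ 2)^-1 <= 4 / J y ^+ 2.
      rewrite ler_pdivlMr ?exprn_gt0 // mulrC ler_pdivrMr ?exprn_gt0 //.
      by have := jap_exp_nbr (R := R) 2 xy; rewrite [2 ^+ 2]expr2; lra.
    rewrite -/(e x) -/(e y); have ex := e0 x; have ey := e0 y.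
    have c10 : 0 <= c1 by rewrite /c1 mulr_ge0 // exprn_ge0.
    apply: le_trans (ler_wpM2r _ (ler_wpM2r _ s3)) _; [by []|by rewrite addr_ge0|].
    have i1 : 0 <= e x / J x ^+ 2 by rewrite divr_ge0 // exprn_ge0 // ltW.
    have i2 : e y * (J x ^+ 2)^-1 <= e y * (4 / J y ^+ 2) by rewrite ler_wpM2l.
    have -> : c1 / J x ^+ 2 * (e x + e y) / 2 = c1 * ((e x / J x ^+ 2 + e y * (J x ^+ 2)^-1) / 2) by ring.
    rewrite -[2 * c1 * _]mulrA (mulrCA 2) ler_wpM2l //; lra.
  have -> : \sum_(x <- bx n) \sum_(y <- bx n) w x y * (2 * c1 * (e x / J x ^+ 2 + e y / J y ^+ 2)) =
      4 * c1 * \sum_(x <- bx n) (\sum_(y <- bx n) w x y) * (e x / J x ^+ 2).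
    have E1 : \sum_(x <- bx n) (\sum_(y <- bx n) w x y) * (e x / J x ^+ 2) =
        \sum_(x <- bx n) \sum_(y <- bx n) w x y * (e y / J y ^+ 2).
      rewrite exchange_big /=; apply: eq_bigr => x _; rewrite mulr_suml.
      by apply: eq_bigr => y _; rewrite wC.
    set S1 := \sum_(x <- bx n) (_ * _) in E1 *.
    have -> : 4 * c1 * S1 = \sum_(x <- bx n) (2 * c1 * ((\sum_(y <- bx n) w x y) * (e x / J x ^+ 2))
       + 2 * c1 * \sum_(y <- bx n) w x y * (e y / J y ^+ 2)).
      by rewrite big_split /= -!mulr_sumr -E1 -/S1; ring.
    apply: eq_bigr => x _; rewrite mulr_suml !mulr_sumr -big_split /=.
    by apply: eq_bigr => y _; ring.
  have -> : 16 * 16 ^+ k * A * \sum_(x <- bx n) e x = 4 * c1 * \sum_(x <- bx n) A * e x.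
    by rewrite -mulr_sumr /c1; ring.
  rewrite ler_wpM2l //; first by rewrite /c1 !mulr_ge0 // exprn_ge0.
  apply: ler_sum => x _.
  have i1 : 0 <= e x / J x ^+ 2 by rewrite divr_ge0 // exprn_ge0 // ltW.
  apply: le_trans (ler_wpM2r i1 (rate_seq_le hw x (fset_uniq (bx n)))) _.
  by rewrite -mulrA (mulrC (J x ^+ 2)) divfK // expf_neq0 // gt_eqF.
have := ler_norm (- I2); rewrite normrN => nI2.
rewrite -/e in hI1 *.
lra.
Qed.

(** Gronwall on a larger box [m], whose boundary error [B / m] disappears as [m] grows with [n]
    fixed. *)
Lemma energy_estimate T (u : R -> C -> R) k a K M D V n t : moderate k a -> (forall x, 0 <= a x) ->
  0 <= K -> 0 <= D ->
  (forall x, ucont T (u^~ x)) -> (forall x, uderiv T (u^~ x) (fun t => - L (u t) x)) ->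
  (forall t x, 0 <= t -> t <= T -> `|u t x| <= K * J x ^+ M) ->
  (forall x, a x ^+ 2 <= D * J x ^- (2 * M + (q + 3))) ->
  (forall n, \sum_(x <- bx n) a x ^+ 2 * u 0 x ^+ 2 <= V) -> 0 <= t -> t <= T ->
  \sum_(x <- bx n) a x ^+ 2 * u t x ^+ 2 <= expR (16 * 16 ^+ k * A * t) * V.
Proof.
move=> ma a0 K0 D0 cu du uK aD hV t0 tT.
set c := 16 * 16 ^+ k * A; set B := 4 * A * (D * K ^+ 2 * (1 + 2 ^+ M)) * 6 ^+ d.
have c0 : 0 <= c by rewrite /c !mulr_ge0 // exprn_ge0.
have B0 : 0 <= B by rewrite /B !mulr_ge0 ?sqr_ge0 // addr_ge0 // exprn_ge0.
apply: (@ler_inv_nat_from _ _ _ (expR (c * t) * (B * t)) n).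
  by rewrite !mulr_ge0 // expR_ge0.
move=> m nm; have m0 : (0 < m)%N by apply: leq_trans nm.
apply: (@le_trans _ _ (\sum_(x <- bx m) a x ^+ 2 * u t x ^+ 2)).
  apply: uniq_sum_le; [exact: fset_uniq|exact: fset_uniq| |].
    by apply: box_sub; exact: ltnW.
  by move=> x _ _; rewrite mulr_ge0 ?sqr_ge0.
pose E t := \sum_(x <- bx m) a x ^+ 2 * u t x ^+ 2.
have cL x : ucont T (fun t => - L (u t) x) by apply: ucontN; exact: ucont_laplacian.
have dE : uderiv T E (fun t => - (2 * \sum_(x <- bx m) a x ^+ 2 * u t x * L (u t) x)).
  apply: eq_uderiv (_ : uderiv T (fun t => \sum_(x <- bx m) a x ^+ 2 * (u t x * u t x))
    (fun t => \sum_(x <- bx m) a x ^+ 2 * (- L (u t) x * u t x + u t x * - L (u t) x))).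
  - by move=> s _ _; apply: eq_bigr => x _; rewrite expr2.
  - by move=> s _ _; rewrite mulr_sumr -sumrN; apply: eq_bigr => x _; ring.
  - by apply: uderiv_sum => x; apply: uderivZ; exact: uderivM.
have cE : ucont T (fun t => - (2 * \sum_(x <- bx m) a x ^+ 2 * u t x * L (u t) x)).
  apply: ucontN; apply: ucontZ; apply: ucont_sum => x; apply: ucontM; last exact: ucont_laplacian.
  by apply: ucontZ.
have Bm : 0 <= B / m%:R by rewrite divr_ge0.
have := gronwall Bm c0 dE cE _ t0 tT.
have -> : (forall s, 0 <= s -> s <= T -> - (2 * \sum_(x <- bx m) a x ^+ 2 * u s x * L (u s) x) <=
    c * E s + B / m%:R) = True.
  apply: propext; split => // _ s s0 sT.
  by apply: energy_dissipation ma a0 K0 D0 _ aD m0 => x; exact: uK.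
move=> /(_ I) /le_trans; apply.
have -> : expR (c * t) * V + expR (c * t) * (B * t) / m%:R = expR (c * t) * (V + B / m%:R * t) by ring.
by rewrite ler_wpM2l ?expR_ge0 // lerD2r hV.
Qed.

(** The weight [J ^- (M + q + 3)] decays fast enough for the energy estimate, and the initial energy
    is zero. *)
Lemma heat_unique T (u : R -> C -> R) K M t x : 0 <= K ->
  (forall x, ucont T (u^~ x)) -> (forall x, uderiv T (u^~ x) (fun t => - L (u t) x)) ->
  (forall t x, 0 <= t -> t <= T -> `|u t x| <= K * J x ^+ M) ->
  (forall x, u 0 x = 0) -> 0 <= t -> t <= T -> u t x = 0.
Proof.
move=> K0 cu du uK u0 t0 tT.
pose m := (M + (q + 3))%N; pose a x := (J x ^+ m)^-1.
have jx y r : 0 < J y ^+ r by exact: jap_exp_gt0.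
have a0 y : 0 <= a y by rewrite invr_ge0 ltW.
have ma : moderate (m * 1) a.
  apply: moderateV => [y|]; first exact: jx.
  by apply: moderateX => [y|]; [exact: ltW|exact: moderate_jap].
have aD y : a y ^+ 2 <= 1 * J y ^- (2 * M + (q + 3)).
  rewrite mul1r /a exprVn -exprM; apply: jap_expV_le; rewrite /m; lia.
have hV n : \sum_(x <- bx n) a x ^+ 2 * u 0 x ^+ 2 <= 0.
  by rewrite big1 // => y _; rewrite u0 expr0n mulr0.
have [n xn] := in_box_ex (R := R) x.
have := energy_estimate n.+1 ma a0 K0 ler01 cu du uK aD hV t0 tT; rewrite mulr0 => h.
have : a x ^+ 2 * u t x ^+ 2 <= 0.
  apply: le_trans h; apply: (@sum_term_le _ _ _ (fun x => a x ^+ 2 * u t x ^+ 2)) xn => y.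
  by rewrite mulr_ge0 ?sqr_ge0.
rewrite pmulr_rle0; last by rewrite exprn_gt0 // invr_gt0.
move=> h'; have : u t x ^+ 2 = 0 by apply: le_anti; rewrite h' sqr_ge0.
by move/eqP; rewrite sqrf_eq0 => /eqP.
Qed.

End Energy.

(** * The heat kernel *)

Section HeatKernel.
Context {R : realType} {d : nat} (omega : lattice d -> lattice d -> R) (C : set (lattice d)) (A : R).
Context (hw : quadratic_rates omega A).
Implicit Types (x y z : C) (u f g : C -> R).
Local Notation J x := (japanese R (val x)).
Local Notation w x y := (omega (val x) (val y)).
Local Notation L := (laplacian omega).
Local Notation q := (2 * d).+1.
Local Notation bx := (@box R d C).
Local Notation nbr := (@nbr d C).
Local Notation crate := (@crate R d omega C).

Let A0 : 0 <= A. Proof. by case: hw. Qed.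
Let w0 x y : 0 <= w x y. Proof. by case: hw => -[]. Qed.
Let wC x y : w x y = w y x. Proof. by case: hw => -[]. Qed.
Let J0 x : 0 < J x. Proof. exact: jap_gt0. Qed.
Let J1 x : 1 <= J x. Proof. exact: jap_ge1. Qed.

(* [picard x N t y] is the probability of being at [y] at time [t] after fewer than [N] jumps. *)
Fixpoint picard (x : C) (N : nat) (t : R) (y : C) : R :=
  if N is N'.+1 then
    linear_ode (crate y) (x == y)%:R (fun s => \sum_(z <- nbr y) w y z * picard x N' s z) t
  else 0.

Definition heat (x : C) (t : R) (y : C) : R := sup (range (fun N => picard x N t y)).

Lemma ucont_picard T x N y : ucont T ((picard x N)^~ y).
Proof.
elim: N y => [|N ih] y; first exact: ucont_cst.
by apply: ucont_linear_ode; apply: ucont_sum => z; exact: ucontZ.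
Qed.

Lemma ucont_picard_src T x N y : ucont T (fun s => \sum_(z <- nbr y) w y z * picard x N s z).
Proof. by apply: ucont_sum => z; apply: ucontZ; exact: ucont_picard. Qed.

Lemma uderiv_picard T x N y : uderiv T ((picard x N.+1)^~ y)
  (fun t => - crate y * picard x N.+1 t y + \sum_(z <- nbr y) w y z * picard x N t z).
Proof. exact: uderiv_linear_ode (ucont_picard_src T x N y). Qed.

Lemma picard0 x N y : picard x N.+1 0 y = (x == y)%:R.
Proof. by rewrite /= linear_ode0. Qed.

Lemma picard_ge0 x N t y : 0 <= t -> 0 <= picard x N t y.
Proof.
move=> t0; elim: N y t t0 => [|N ih] y t t0 //.
apply: (linear_ode_ge0 (ucont_picard t x N.+1 y) (ucont_picard_src t x N y) (uderiv_picard t x N y)) => //.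
  by move=> s s0 _; apply: sumr_ge0 => z _; rewrite mulr_ge0 // ih.
by rewrite picard0.
Qed.

(** Comparison for [1 - picard]: the constant one solves the same equation with source [crate y],
    which dominates the source of [picard] by induction. *)
Lemma picard_le1 x N t y : 0 <= t -> picard x N t y <= 1.
Proof.
elim: N y t => [|N ih] y t t0; first exact: ler01.
rewrite -subr_ge0.
pose g s := crate y - \sum_(z <- nbr y) w y z * picard x N s z.
have cg : ucont t g by apply: ucontB; [exact: ucont_cst|exact: ucont_picard_src].
have cf : ucont t (fun s => 1 - picard x N.+1 s y).
  by apply: ucontB; [exact: ucont_cst|exact: ucont_picard].
apply: (linear_ode_ge0 (r := crate y) cf cg) => //.
- have := uderivB (uderiv_cst t 1) (uderiv_picard t x N y).
  by apply: eq_uderiv => // s _ _; rewrite /g; ring.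
- move=> s s0 _; rewrite /g subr_ge0 /crate; apply: ler_sum => z _.
  by rewrite ler_piMr // ih.
- by rewrite picard0; case: (x == y); rewrite ?subrr ?subr0.
Qed.

Lemma picard_incr x N t y : 0 <= t -> picard x N t y <= picard x N.+1 t y.
Proof.
elim: N y t => [|N ih] y t t0; first exact: picard_ge0.
rewrite -subr_ge0.
pose g s := \sum_(z <- nbr y) w y z * (picard x N.+1 s z - picard x N s z).
have gE s : g s = \sum_(z <- nbr y) w y z * picard x N.+1 s z - \sum_(z <- nbr y) w y z * picard x N s z.
  by rewrite /g -sumrB; apply: eq_bigr => z _; rewrite mulrBr.
have cg : ucont t g.
  apply: ucont_sum => z; apply: ucontZ; apply: ucontB; exact: ucont_picard.
have cf : ucont t (fun s => picard x N.+2 s y - picard x N.+1 s y).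
  by apply: ucontB; exact: ucont_picard.
apply: (linear_ode_ge0 (r := crate y) cf cg) => //.
- have := uderivB (uderiv_picard t x N.+1 y) (uderiv_picard t x N y).
  by apply: eq_uderiv => // s _ _; rewrite gE; ring.
- by move=> s s0 _; apply: sumr_ge0 => z _; rewrite mulr_ge0 // subr_ge0 ih.
- by rewrite !picard0 subrr.
Qed.

Lemma picard_cvg x t y : 0 <= t -> picard x N t y @[N --> \oo] --> heat x t y.
Proof.
move=> t0; apply: nondecreasing_cvgn.
  by apply/nondecreasing_seqP => N; exact: picard_incr.
by exists 1 => _ [N _ <-]; exact: picard_le1.
Qed.

Lemma picard_le_heat x N t y : 0 <= t -> picard x N t y <= heat x t y.
Proof.
move=> t0; apply: ub_le_sup; last by exists N.
by exists 1 => _ [N' _ <-]; exact: picard_le1.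
Qed.

Lemma heat_ge0 x t y : 0 <= t -> 0 <= heat x t y.
Proof. exact: (@picard_le_heat x 0). Qed.

Lemma heat_le x t y (B : R) : (forall N, picard x N t y <= B) -> heat x t y <= B.
Proof.
by move=> h; apply: ge_sup => [|_ [N _ <-]]; [exists 0; exists 0%N|exact: h].
Qed.

Lemma heat_le1 x t y : 0 <= t -> heat x t y <= 1.
Proof. by move=> t0; apply: heat_le => N; exact: picard_le1. Qed.

Lemma heat0 x y : heat x 0 y = (x == y)%:R.
Proof.
apply: le_anti; apply/andP; split.
  by apply: heat_le => -[|N]; rewrite ?picard0.
by rewrite -(picard0 x 0); exact: picard_le_heat.
Qed.

(** Dominates the second time derivative at [y] of every iterate. It involves neither [x] nor [N],
    so the Taylor bound survives the limit in [N]. *)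
Definition rate2 y : R := 2 * (crate y ^+ 2 + \sum_(z <- nbr y) w y z * crate z).

Lemma picard_src_le x N s y : 0 <= s -> 0 <= \sum_(z <- nbr y) w y z * picard x N s z <= crate y.
Proof.
move=> s0; apply/andP; split.
  by apply: sumr_ge0 => z _; rewrite mulr_ge0 // picard_ge0.
by rewrite /crate; apply: ler_sum => z _; rewrite ler_piMr // picard_le1.
Qed.

Lemma picard_lip x N s t y : 0 <= s -> s <= t -> `|picard x N t y - picard x N s y| <= crate y * (t - s).
Proof.
move=> s0 st; case: N => [|N].
  by rewrite /= subrr normr0 mulr_ge0 ?(crate_ge0 hw) ?subr_ge0.
apply: (uderiv_lip (uderiv_picard t x N y)) => // u su _.
have u0 : 0 <= u by lra.
have /andP[h1 h2] := picard_src_le x N y u0.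
have h3 := picard_ge0 x N.+1 y u0; have h4 := picard_le1 x N.+1 y u0.
have c0 := crate_ge0 hw y.
have h5 : crate y * picard x N.+1 u y <= crate y by rewrite ler_piMr.
have h6 : 0 <= crate y * picard x N.+1 u y by rewrite mulr_ge0.
by rewrite ler_norml; apply/andP; split; lra.
Qed.

Lemma picard_quad x N s t y : 0 <= s -> s <= t ->
  `|picard x N.+1 t y - picard x N.+1 s y -
    (t - s) * (- crate y * picard x N.+1 s y + \sum_(z <- nbr y) w y z * picard x N s z)|
  <= rate2 y * (t - s) ^+ 2.
Proof.
move=> s0 st; rewrite expr2 [leRHS]mulrA.
apply: (uderiv_taylor (uderiv_picard t x N y)) => // u su ut.
have -> : - crate y * picard x N.+1 u y + \sum_(z <- nbr y) w y z * picard x N u z -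
  (- crate y * picard x N.+1 s y + \sum_(z <- nbr y) w y z * picard x N s z) =
  - (crate y * (picard x N.+1 u y - picard x N.+1 s y)) +
  \sum_(z <- nbr y) w y z * (picard x N u z - picard x N s z).
  rewrite -[X in _ = _ + X](_ : \sum_(z <- nbr y) w y z * picard x N u z -
    \sum_(z <- nbr y) w y z * picard x N s z = _); first by ring.
  by rewrite -sumrB; apply: eq_bigr => z _; rewrite mulrBr.
have c0 := crate_ge0 hw y.
have ts : 0 <= t - s by lra.
apply: le_trans (ler_normD _ _) _; rewrite normrN normrM (ger0_norm c0).
apply: (@le_trans _ _ (crate y ^+ 2 * (t - s) + (\sum_(z <- nbr y) w y z * crate z) * (t - s))).
  apply: lerD.
    rewrite expr2 -mulrA ler_wpM2l //; apply: le_trans (picard_lip x N.+1 y s0 su) _.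
    by rewrite ler_wpM2l //; lra.
  apply: le_trans (ler_norm_sum _ _ _) _; rewrite mulr_suml; apply: ler_sum => z _.
  rewrite normrM ger0_norm // -mulrA ler_wpM2l //; apply: le_trans (picard_lip x N z s0 su) _.
  by rewrite ler_wpM2l ?(crate_ge0 hw) //; lra.
rewrite -mulrDl ler_wpM2r // /rate2.
set a := _ + _; have : 0 <= a; last by lra.
by rewrite addr_ge0 ?sqr_ge0 // sumr_ge0 // => z _; rewrite mulr_ge0 // (crate_ge0 hw).
Qed.

Lemma heat_quad x s t y : 0 <= s -> s <= t ->
  `|heat x t y - heat x s y - (t - s) * - L (heat x s) y| <= rate2 y * (t - s) ^+ 2.
Proof.
move=> s0 st; have t0 : 0 <= t by lra.
pose v N := picard x N.+1 t y - picard x N.+1 s y -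
    (t - s) * (- crate y * picard x N.+1 s y + \sum_(z <- nbr y) w y z * picard x N s z).
have vl : v N @[N --> \oo] --> heat x t y - heat x s y - (t - s) * - L (heat x s) y.
  have pc r z : 0 <= r -> picard x N.+1 r z @[N --> \oo] --> heat x r z.
    by move=> r0; have := @picard_cvg x r z r0; rewrite -(cvg_shiftS (fun N => picard x N r z)).
  apply: cvgB; first by apply: cvgB; exact: pc.
  apply: cvgM; first exact: cvg_cst.
  rewrite laplacian_crate opprB addrC; apply: cvgD.
    by rewrite -mulNr; apply: cvgM; [exact: cvg_cst|exact: pc].
  apply: (@cvg_sumr _ _ (nbr y) (fun N z => w y z * picard x N s z)) => z.
  by apply: cvgM; [exact: cvg_cst|exact: picard_cvg].
by apply: (cvg_norm_le vl) => N; exact: picard_quad.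
Qed.

Lemma heat_lip x s t y : 0 <= s -> s <= t -> `|heat x t y - heat x s y| <= crate y * (t - s).
Proof.
move=> s0 st; have t0 : 0 <= t by lra.
apply: (@cvg_norm_le _ (fun N => picard x N t y - picard x N s y)).
  by apply: cvgB; exact: picard_cvg.
by move=> N; exact: picard_lip.
Qed.

Lemma ucont_heat T x y : ucont T ((heat x)^~ y).
Proof. by apply: ucont_lip => s t s0 st _; exact: heat_lip. Qed.

Lemma uderiv_heat T x y : uderiv T ((heat x)^~ y) (fun t => - L (heat x t) y).
Proof. by apply: (@uderiv_quad _ _ _ _ (rate2 y)) => s t s0 st _; exact: heat_quad. Qed.

Lemma heat_delta_sum n (x : C) (F : C -> R) :
  \sum_(z <- bx n) F z * (x == z)%:R = (x \in bx n)%:R * F x.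
Proof.
have [xn|xn] := boolP (x \in bx n).
  rewrite (big_fsetD1 x) //= eqxx mulr1 big1_seq ?addr0 ?mul1r // => z /=.
  by rewrite in_fsetD1 eq_sym => /andP[/negbTE -> _]; rewrite mulr0.
rewrite mul0r big1_seq // => z /= zn; case: eqP => [xz|]; rewrite ?mulr0 //.
by rewrite xz zn in xn.
Qed.

(* The factor [(1 + e J)^-m] makes the weight decay, so that the energy estimate applies to the
   merely bounded function [heat x t]; then [e] tends to 0. *)
Lemma heat_decay r : exists2 c, 0 <= c & forall x t y, 0 <= t ->
  heat x t y <= expR (c * t) * J x ^+ r * J y ^- r.
Proof.
pose m := (r + (q + 3))%N.
pose k := (r * 1 + m * 1)%N.
pose c := 16 * 16 ^+ k * A.
have c0 : 0 <= c by rewrite /c !mulr_ge0 // exprn_ge0.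
exists c => // x t y t0.
have jx (z : C) s : 0 < J z ^+ s by exact: jap_exp_gt0.
suff key : J y ^+ (2 * r) * heat x t y ^+ 2 <= expR (c * t) * J x ^+ (2 * r).
  rewrite ler_pdivlMr // -(@ler_pXn2r _ 2) // ?nnegrE; first last.
  - by rewrite !mulr_ge0 ?expR_ge0 // ltW.
  - by rewrite mulr_ge0 ?heat_ge0 // ltW.
  rewrite !exprMn -!exprM mulrC [(r * 2)%N]mulnC; apply: le_trans key _.
  apply: ler_wpM2r; first exact: ltW.
  rewrite expr2 ler_peMr ?expR_ge0 // -expR0 ler_expR mulr_ge0 //.
apply: (@ler_eps _ _ _ (expR (c * t) * J x ^+ (2 * r) * 4 ^+ (m * 2))).
  by rewrite !mulr_ge0 ?expR_ge0 ?exprn_ge0 // ltW.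
(* Both bounds on [e J y] serve the last step: [e J y <= 2] gives
   [(1 + e J y)^(2 m) <= 1 + e J y 4^(2 m)], and [e J y <= e0] makes the excess small. *)
move=> e0 e00; pose e := Num.min (e0 / J y) (2 / J y).
have e_gt0 : 0 < e by rewrite lt_min !divr_gt0.
have e1 : e * J y <= e0 by rewrite -ler_pdivlMr // ge_min lexx.
have e2 : e * J y <= 2 by rewrite -ler_pdivlMr // ge_min lexx orbT.
pose b z : R := 1 + e * J z.
have b1 z : 1 <= b z by rewrite lerDl mulr_ge0 // ltW.
have b0 z : 0 < b z by apply: lt_le_trans (b1 z).
have bX z s : 0 < b z ^+ s by rewrite exprn_gt0.
pose a z := J z ^+ r * (b z ^+ m)^-1.
have a_gt0 z : 0 < a z by rewrite mulr_gt0 ?invr_gt0.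
have ma : moderate k a.
  apply: moderateM => [z|z||]; [exact: ltW|by rewrite invr_ge0 ltW| |].
    by apply: moderateX => [z|]; [exact: ltW|exact: moderate_jap].
  apply: moderateV => //; apply: moderateX => [z|]; first exact: ltW.
  by apply: moderate_affine; exact: ltW.
(* [D] blows up as [e] tends to 0, but it enters only the boundary error and is absent from the
   conclusion of [energy_estimate]. *)
pose D := ((e ^+ m)^-1) ^+ 2.
have aD z : a z ^+ 2 <= D * J z ^- (2 * 0 + (q + 3)).
  have h : a z <= (e ^+ m)^-1 * (J z ^+ (q + 3))^-1.
    have em : 0 < e ^+ m by rewrite exprn_gt0.
    rewrite -invfM ler_pdivrMr // mulrC ler_pdivlMr ?mulr_gt0 // mulrCA -exprD -/m -exprMn.
    rewrite lerXn2r ?nnegrE ?mulr_ge0 ?(ltW e_gt0) ?(ltW (J0 _)) ?(ltW (b0 _)) //.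
    by rewrite /b lerDr.
  apply: (@le_trans _ _ (((e ^+ m)^-1 * (J z ^+ (q + 3))^-1) ^+ 2)).
    by rewrite lerXn2r // ?nnegrE ?(ltW (a_gt0 _)) // mulr_ge0 // invr_ge0 ltW // exprn_gt0.
  rewrite exprMn ler_wpM2l ?sqr_ge0 // exprVn -exprM; apply: jap_expV_le; lia.
have D0 : 0 <= D by rewrite sqr_ge0.
have cu z : ucont t ((heat x)^~ z) by exact: ucont_heat.
have du z : uderiv t ((heat x)^~ z) (fun s => - L (heat x s) z) by exact: uderiv_heat.
have uK s z : 0 <= s -> s <= t -> `|heat x s z| <= 1 * J z ^+ 0.
  by move=> s0 _; rewrite mul1r expr0 ger0_norm ?heat_le1 ?heat_ge0.
have hV n : \sum_(z <- bx n) a z ^+ 2 * heat x 0 z ^+ 2 <= J x ^+ (2 * r).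
  have -> : \sum_(z <- bx n) a z ^+ 2 * heat x 0 z ^+ 2 = \sum_(z <- bx n) a z ^+ 2 * (x == z)%:R.
    by apply: eq_bigr => z _; rewrite heat0; case: (x == z); rewrite ?expr1n ?expr0n.
  rewrite heat_delta_sum; apply: (@le_trans _ _ (a x ^+ 2)).
    by rewrite ler_piMl ?sqr_ge0 //; case: (_ \in _).
  rewrite mulnC exprM lerXn2r ?nnegrE ?(ltW (a_gt0 _)) ?(ltW (jx _ _)) //.
  by rewrite /a ler_pdivrMr // ler_peMr ?(ltW (jx _ _)) // exprn_ege1.
have [n yn] := in_box_ex (R := R) y.
have := energy_estimate hw n.+1 ma (fun z => ltW (a_gt0 z)) ler01 D0 cu du uK aD hV t0 (lexx t).
rewrite -/c => h.
have {}h : a y ^+ 2 * heat x t y ^+ 2 <= expR (c * t) * J x ^+ (2 * r).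
  apply: le_trans h; apply: (@sum_term_le _ _ _ (fun x => a x ^+ 2 * _ x ^+ 2)) yn => z.
  by rewrite mulr_ge0 ?sqr_ge0.
have E : J y ^+ (2 * r) * heat x t y ^+ 2 = a y ^+ 2 * heat x t y ^+ 2 * b y ^+ (m * 2).
  have Ey : J y ^+ r = a y * b y ^+ m by rewrite /a divfK // gt_eqF.
  by rewrite (mulnC 2) exprM Ey exprMn -exprM; ring.
rewrite E; have p := one_plus_pow (m * 2) (ltW (mulr_gt0 e_gt0 (J0 y))) e2.
have a2 : 0 <= a y ^+ 2 by exact: sqr_ge0.
have h2 : 0 <= heat x t y ^+ 2 by exact: sqr_ge0.
apply: le_trans (ler_pM (mulr_ge0 a2 h2) (ltW (bX _ _)) h p) _.
rewrite mulrDr mulr1 lerD2l mulrCA; apply: ler_pM => //.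
- by rewrite mulr_ge0 // ltW.
- by rewrite !mulr_ge0 ?expR_ge0 ?exprn_ge0 // ltW.
Qed.

Lemma heat_decay_le r : exists2 c, 0 <= c & forall T x t y, 0 <= t -> t <= T ->
  `|heat x t y| <= expR (c * T) * J x ^+ r * J y ^- r.
Proof.
have [c c0 h] := heat_decay r; exists c => // T x t y t0 tT.
rewrite ger0_norm ?heat_ge0 //; apply: le_trans (h x t y t0) _.
rewrite -!mulrA ler_wpM2r //; last by rewrite ler_expR ler_wpM2l.
by rewrite mulr_ge0 ?jap_expV_ge0 // ltW // jap_exp_gt0.
Qed.

(** The box sum of [heat x s z * heat y (t - s) z] interpolates between [heat y t x] at [s = 0] and
    [heat x t y] at [s = t]; by Green's identity its derivative in [s] is a boundary term
    [O(1 / n)]. *)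
Lemma heat_sym x y t : 0 <= t -> heat x t y = heat y t x.
Proof.
move=> t0; have [c c0 hc] := heat_decay_le (q + 3).
have [n0 hn0] := subset_box (R := R) [:: x; y].
pose K := expR (c * t) * J y ^+ (q + 3).
pose B := 2 * A * (1 * K * (2 ^+ 0 + 2 ^+ (0 + (q + 3)))) * 6 ^+ d.
have K0 : 0 <= K by rewrite mulr_ge0 ?expR_ge0 // ltW // jap_exp_gt0.
have B0 : 0 <= B by rewrite /B !mulr_ge0 ?expR_ge0 ?exprn_ge0 ?jap_ge0 // addr_ge0 // exprn_ge0.
apply/eqP; rewrite -subr_eq0 -normr_le0.
apply: (@ler_inv_nat_from _ _ _ (B * t) n0); first exact: mulr_ge0.
move=> n nn; rewrite add0r; have n_gt0 : (0 < n)%N by apply: leq_trans nn.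
pose F s := \sum_(z <- bx n) heat x s z * heat y (t - s) z.
have dF : uderiv t F (fun s => \sum_(z <- bx n) (- L (heat x s) z * heat y (t - s) z +
    heat x s z * - - L (heat y (t - s)) z)).
  apply: uderiv_sum => z; apply: uderivM.
  - by apply: ucontN; apply: ucont_laplacian => v; exact: ucont_heat.
  - apply: ucontN; apply: (@ucont_rev _ t (fun s => - L (heat y s) z)).
    by apply: ucontN; apply: ucont_laplacian => v; exact: ucont_heat.
  - exact: uderiv_heat.
  - apply: (@uderiv_rev _ t (fun s => heat y s z) (fun s => - L (heat y s) z)).
      by apply: ucontN; apply: ucont_laplacian => v; exact: ucont_heat.
    exact: uderiv_heat.
have := uderiv_lip (M := B / n%:R) dF (lexx 0) t0 (lexx t).
have -> : F t = heat x t y.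
  rewrite /F subrr; under eq_bigr => z _ do rewrite heat0.
  by rewrite heat_delta_sum (box_sub nn) ?mul1r // hn0 // !inE eqxx orbT.
have -> : F 0 = heat y t x.
  rewrite /F subr0; under eq_bigr => z _ do rewrite heat0 mulrC.
  by rewrite heat_delta_sum (box_sub nn) ?mul1r // hn0 // !inE eqxx.
rewrite subr0 [B * t / _]mulrAC; apply => u u0 ut.
have -> : \sum_(z <- bx n) (- L (heat x u) z * heat y (t - u) z + heat x u z * - - L (heat y (t - u)) z)
  = \sum_(z <- bx n) (heat x u z * L (heat y (t - u)) z - heat y (t - u) z * L (heat x u) z).
  by apply: eq_bigr => z _; ring.
apply: (green_le hw) => //.
  by move=> z; rewrite mul1r expr0 ger0_norm ?heat_le1 ?heat_ge0.
by move=> z; rewrite add0n; apply: hc; lra.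
Qed.

Lemma laplacian_cst (c : R) x : L (fun=> c) x = 0.
Proof. by rewrite laplacian_nbr big1 // => y _; rewrite subrr mulr0. Qed.

(** Green's identity against the constant one, whose Laplacian vanishes: the mass in the box changes
    at rate [O(1 / n)], and it starts at one once the box contains [x]. *)
Lemma heat_mass_box x t : 0 <= t -> exists B n0, 0 <= B /\ forall n, (n0 < n)%N ->
  `|1 - \sum_(y <- bx n) heat x t y| <= B / n%:R.
Proof.
move=> t0; have [c c0 hc] := heat_decay_le (q + 3).
have [n0 hn0] := subset_box (R := R) [:: x].
pose K := expR (c * t) * J x ^+ (q + 3).
pose B := 2 * A * (1 * K * (2 ^+ 0 + 2 ^+ (0 + (q + 3)))) * 6 ^+ d.
have K0 : 0 <= K by rewrite mulr_ge0 ?expR_ge0 // ltW // jap_exp_gt0.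
have B0 : 0 <= B by rewrite /B !mulr_ge0 ?expR_ge0 ?exprn_ge0 ?jap_ge0 // addr_ge0 // exprn_ge0.
exists (B * t), n0; split; first exact: mulr_ge0.
move=> n nn; have n_gt0 : (0 < n)%N by apply: leq_trans nn.
have dF : uderiv t (fun s => \sum_(z <- bx n) heat x s z) (fun s => \sum_(z <- bx n) - L (heat x s) z).
  by apply: uderiv_sum => z; exact: uderiv_heat.
have := uderiv_lip (M := B / n%:R) dF (lexx 0) t0 (lexx t).
have -> : \sum_(z <- bx n) heat x 0 z = 1.
  under eq_bigr => z _ do rewrite heat0 -[_%:R]mul1r.
  by rewrite (heat_delta_sum _ _ (fun=> 1)) (box_sub nn) ?mul1r // hn0 // !inE eqxx.
rewrite subr0 [B * t / _]mulrAC distrC; apply => u u0 ut.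
have -> : \sum_(z <- bx n) - L (heat x u) z =
    - \sum_(z <- bx n) ((fun=> 1) z * L (heat x u) z - heat x u z * L (fun=> 1) z).
  by rewrite -sumrN; apply: eq_bigr => z _; rewrite laplacian_cst; ring.
rewrite normrN; apply: (green_le hw) => //.
  by move=> z; rewrite mul1r expr0 normr1.
by move=> z; rewrite add0n; apply: hc.
Qed.

End HeatKernel.

(** * The semigroup and the Duhamel integral *)

Section Duhamel.
Context {R : realType} {d : nat} (omega : lattice d -> lattice d -> R) (C : set (lattice d)) (A : R).
Context (hw : quadratic_rates omega A).
Implicit Types (x y z : C) (f g : C -> R).
Local Notation J x := (japanese R (val x)).
Local Notation w x y := (omega (val x) (val y)).
Local Notation L := (laplacian omega).
Local Notation q := (2 * d).+1.
Local Notation bx := (@box R d C).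
Local Notation heat := (@heat R d omega C).
Local Notation S6 := (2 * 6 ^+ d : R).

Let A0 : 0 <= A. Proof. by case: hw. Qed.
Let J0 x : 0 < J x. Proof. exact: jap_gt0. Qed.

(** Dominated convergence in finite form: under a common summable bound, smallness on one finite box
    suffices, with [n] and [h] the same for all such [f]. *)
Lemma csum_small (K e : R) : 0 <= K -> 0 < e -> exists n h, [/\ (0 < n)%N, 0 < h &
  forall f, (forall y, `|f y| <= K * J y ^- q) -> (forall y, y \in bx n -> `|f y| <= h) -> `|csum f| <= e].
Proof.
move=> K0 e0; have [n hn] := exists_nat_gt (2 * (K * 6 ^+ d) / e).
have sz0 : (0 : R) < (size (bx n.+1)).+1%:R by rewrite ltr0n.
exists n.+1, (e / 2 / (size (bx n.+1)).+1%:R); split => //; first by rewrite !divr_gt0.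
move=> f fK fh; have := csum_box K0 fK (ltn0Sn n).
have h1 : K * (6 ^+ d / n.+1%:R) <= e / 2.
  rewrite mulrA ler_pdivrMr; last by rewrite ltr0n.
    by move: hn; rewrite ltr_pdivrMr // => /ltW; lra.
have h2 : `|\sum_(x <- bx n.+1) f x| <= e / 2.
  apply: le_trans (ler_norm_sum _ _ _) _.
  apply: (@le_trans _ _ (\sum_(x <- bx n.+1) e / 2 / (size (bx n.+1)).+1%:R)).
    by rewrite big_seq [leRHS]big_seq; apply: ler_sum.
  rewrite big_const_seq count_predT iter_addr_0 -[leLHS]mulr_natr -[leLHS]mulrA ler_piMr //; first by lra.
  by rewrite mulrC ler_pdivrMr // mul1r ler_nat leqnSn.
set c := \sum_(_ <- _) _ in h2 * => h3; have {}h3 := le_trans h3 h1.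
have := ler_normD (csum f - c) c; rewrite subrK; lra.
Qed.

(** Chosen once from the existence statement, so that later constants can be written as functions of
    [r] and [T]. *)
Definition decay_const r : R := s2val (cid2 (@heat_decay_le R d omega C A hw r)).

Definition decay_fac r T : R := expR (decay_const r * T).

Lemma heat_decayP r T x t y : 0 <= t -> t <= T ->
  `|heat x t y| <= decay_fac r T * J x ^+ r * J y ^- r.
Proof. by rewrite /decay_fac /decay_const; case: cid2 => c /= c0 h t0 tT; exact: h. Qed.

Lemma decay_fac_gt0 r T : 0 < decay_fac r T. Proof. exact: expR_gt0. Qed.

Definition Psem t f x := csum (fun y => heat x t y * f y).

Definition poly_bound (K : R) M f := forall y, `|f y| <= K * J y ^+ M.

Lemma kernel_mul_le (k f : C -> R) B K M : 0 <= B -> 0 <= K -> poly_bound K M f ->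
  (forall y, `|k y| <= B * J y ^- (M + q)) -> forall y, `|k y * f y| <= B * K * J y ^- q.
Proof.
move=> B0 K0 fK kB y; rewrite normrM; apply: le_trans (ler_pM _ _ (kB y) (fK y)) _ => //.
have j1 := jap_exp_gt0 (R := R) y M; have j2 := jap_exp_gt0 (R := R) y q.
by rewrite exprD le_eqVlt; apply/orP; left; apply/eqP; field; rewrite !gt_eqF.
Qed.

Lemma heat_mul_le T t f K M x : 0 <= t -> t <= T -> 0 <= K -> poly_bound K M f ->
  forall y, `|heat x t y * f y| <= decay_fac (M + q) T * J x ^+ (M + q) * K * J y ^- q.
Proof.
move=> t0 tT K0 fK; apply: kernel_mul_le fK _ => // [|y]; last exact: heat_decayP.
by rewrite mulr_ge0 ?ltW ?jap_exp_gt0 ?decay_fac_gt0.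
Qed.

Lemma fac_ge0 r T x K : 0 <= K -> 0 <= decay_fac r T * J x ^+ r * K.
Proof. by move=> K0; rewrite !mulr_ge0 ?expR_ge0 ?exprn_ge0 ?jap_ge0. Qed.

Lemma Psem_le T t f K M : 0 <= t -> t <= T -> 0 <= K -> poly_bound K M f ->
  poly_bound (S6 * (decay_fac (M + q) T * K)) (M + q) (Psem t f).
Proof.
move=> t0 tT K0 fK x; apply: le_trans (csum_le (fac_ge0 _ _ x K0) (heat_mul_le x t0 tT K0 fK)) _.
by rewrite le_eqVlt; apply/orP; left; apply/eqP; ring.
Qed.

Lemma Psem0 f x : Psem 0 f x = f x.
Proof.
rewrite /Psem -(csum_delta f x); congr csum; apply/funext => y.
by rewrite (heat0 hw) eq_sym.
Qed.

Lemma PsemB T t f g K M x : 0 <= t -> t <= T -> 0 <= K -> poly_bound K M f -> poly_bound K M g ->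
  Psem t (fun y => f y - g y) x = Psem t f x - Psem t g x.
Proof.
move=> t0 tT K0 fK gK; have F0 := fac_ge0 (M + q) T x K0.
have gK' : poly_bound K M (fun y => -1 * g y) by move=> y; rewrite mulN1r normrN.
rewrite -[in RHS]mulN1r -[in RHS](csumZ _ F0 (heat_mul_le x t0 tT K0 gK)).
rewrite -(csumD F0 F0 (heat_mul_le x t0 tT K0 fK)).
  by congr csum; apply/funext => y; ring.
by move=> y; rewrite mulN1r normrN; exact: heat_mul_le.
Qed.

(** Symmetry trades decay in one variable for growth in the other, to which [laplacian_poly]
    applies; the decay in [y] is carried along in its constant. *)
Lemma laplacian_heat_le r T t x y : 0 <= t -> t <= T ->
  `|L (heat y t) x| <= A * (1 + 2 ^+ r) * decay_fac r T * J x ^+ (r + 2) * J y ^- r.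
Proof.
move=> t0 tT; have h z : `|heat y t z| <= decay_fac r T * J y ^- r * J z ^+ r.
  by rewrite (heat_sym hw) // mulrAC; exact: heat_decayP.
apply: le_trans (laplacian_poly hw h x) _.
by rewrite le_eqVlt; apply/orP; left; apply/eqP; ring.
Qed.

Lemma laplacian_Psem T t f K M x : 0 <= t -> t <= T -> 0 <= K -> poly_bound K M f ->
  L (Psem t f) x = csum (fun y => L (heat y t) x * f y).
Proof.
move=> t0 tT K0 fK; rewrite laplacian_nbr.
have F0 z := fac_ge0 (M + q) T z K0.
have hm z := heat_mul_le z t0 tT K0 fK.
have E : (fun y => L (heat y t) x * f y) =
   fun y => \sum_(z <- nbr x) (w x z * (heat x t y * f y + -1 * (heat z t y * f y))).
  apply/funext => y; rewrite laplacian_nbr mulr_suml; apply: eq_bigr => z _.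
  by rewrite !(heat_sym hw y) //; ring.
have w0 z : 0 <= w x z by case: hw => -[].
have hm' z y : `|heat x t y * f y + -1 * (heat z t y * f y)| <=
   (decay_fac (M + q) T * J x ^+ (M + q) * K + decay_fac (M + q) T * J z ^+ (M + q) * K) * J y ^- q.
  apply: le_trans (ler_normD _ _) _; rewrite mulN1r normrN mulrDl lerD //; exact: hm.
rewrite E (@csum_sum _ _ _ _ (nbr x)
  (fun z y => w x z * (heat x t y * f y + -1 * (heat z t y * f y))) (fun z => w x z *
  (decay_fac (M + q) T * J x ^+ (M + q) * K + decay_fac (M + q) T * J z ^+ (M + q) * K))); first last.
- by move=> z y; rewrite normrM ger0_norm // -mulrA ler_wpM2l.
- by move=> z; rewrite mulr_ge0 // addr_ge0.
apply: eq_bigr => z _.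
rewrite (csumZ _ (addr_ge0 (F0 x) (F0 z)) (hm' z)); congr (_ * _).
rewrite (csumD (F0 x) (F0 z) (hm x)) ?(csumZ _ (F0 z) (hm z)) ?mulN1r //.
by move=> y; rewrite mulN1r normrN; exact: hm.
Qed.

(** Symmetry turns the forward equation into the backward one, with the Laplacian in the starting
    point. *)
Lemma uderiv_heat_fst T x y : uderiv T ((heat x)^~ y) (fun t => - L (heat y t) x).
Proof.
apply: eq_uderiv (uderiv_heat hw T y x) => // t t0 _; exact: (heat_sym hw).
Qed.

Definition lip_fac r T : R := A * (1 + 2 ^+ r) * decay_fac r T.

Lemma lip_fac_ge0 r T : 0 <= lip_fac r T.
Proof. by rewrite /lip_fac !mulr_ge0 ?expR_ge0 // addr_ge0 // exprn_ge0. Qed.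

Lemma heat_lip_decay r T s t x y : 0 <= s -> s <= t -> t <= T ->
  `|heat x t y - heat x s y| <= A * (1 + 2 ^+ r) * decay_fac r T * J x ^+ (r + 2) * J y ^- r * (t - s).
Proof.
move=> s0 st tT; apply: (uderiv_lip (uderiv_heat_fst T x y)) => // u su ut.
by rewrite normrN; apply: laplacian_heat_le; lra.
Qed.

Definition quad_fac r T : R := A * (1 + 2 ^+ (r + 2)) * (A * (1 + 2 ^+ r) * decay_fac r T).

Lemma quad_fac_ge0 r T : 0 <= quad_fac r T.
Proof. by rewrite /quad_fac !mulr_ge0 ?expR_ge0 // addr_ge0 // exprn_ge0. Qed.

(** Two Laplacians cost [J x ^ 4], while the decay in [y] is kept, so the remainder can be summed
    against a function of polynomial growth. *)
Lemma heat_quad_decay r T s t x y : 0 <= s -> s <= t -> t <= T ->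
  `|heat x t y - heat x s y + (t - s) * L (heat y s) x| <=
  quad_fac r T * J x ^+ (r + 4) * (t - s) ^+ 2 * J y ^- r.
Proof.
move=> s0 st tT.
have -> : heat x t y - heat x s y + (t - s) * L (heat y s) x =
  heat x t y - heat x s y - (t - s) * (fun t => - L (heat y t) x) s by rewrite /=; ring.
have -> : quad_fac r T * J x ^+ (r + 4) * (t - s) ^+ 2 * J y ^- r =
  quad_fac r T * J x ^+ (r + 4) * (t - s) * J y ^- r * (t - s) by ring.
apply: (uderiv_taylor (uderiv_heat_fst T x y)) => // u su ut.
rewrite [X in `|X|](_ : _ = - (L (heat y u) x - L (heat y s) x)); last by ring.
rewrite normrN -laplacianB.
have h z : `|heat y u z - heat y s z| <=
    A * (1 + 2 ^+ r) * decay_fac r T * J y ^- r * (t - s) * J z ^+ (r + 2).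
  rewrite !(heat_sym hw y) //; last by lra.
  apply: le_trans (heat_lip_decay r (T := T) _ _ s0 su _) _; first by lra.
  rewrite [leRHS](_ : _ = A * (1 + 2 ^+ r) * decay_fac r T * J z ^+ (r + 2) * J y ^- r * (t - s)); last by ring.
  apply: ler_wpM2l; last by rewrite lerD2r.
  by rewrite -/(lip_fac r T) mulr_ge0 ?jap_expV_ge0 // mulr_ge0 ?lip_fac_ge0 // ltW // jap_exp_gt0.
apply: le_trans (laplacian_poly hw h x) _.
by rewrite -addnA /quad_fac le_eqVlt; apply/orP; left; apply/eqP; ring.
Qed.

Ltac nneg := repeat first [ done | by rewrite subr_ge0 | exact: quad_fac_ge0 | exact: lip_fac_ge0
  | exact: expR_ge0 | exact: jap_ge0 | exact: jap_expV_ge0 | exact: sqr_ge0 | apply: exprn_ge0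
  | apply: addr_ge0 | apply: mulr_ge0 ].

Lemma Psem_quad T s t f K M x : 0 <= s -> s <= t -> t <= T -> 0 <= K -> poly_bound K M f ->
  `|Psem t f x - Psem s f x + (t - s) * L (Psem s f) x| <=
  S6 * (quad_fac (M + q) T * J x ^+ (M + q + 4) * K) * (t - s) ^+ 2.
Proof.
move=> s0 st tT K0 fK; have t0 : 0 <= t by lra.
have sT : s <= T by lra.
have F0 := fac_ge0 (M + q) T x K0.
pose G0 := A * (1 + 2 ^+ (M + q)) * decay_fac (M + q) T * J x ^+ (M + q + 2).
have G00 : 0 <= G0 by rewrite /G0 !mulr_ge0 ?expR_ge0 ?exprn_ge0 ?jap_ge0 // addr_ge0 // exprn_ge0.
have G1 y : `|L (heat y s) x * f y| <= G0 * K * J y ^- q.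
  by apply: (kernel_mul_le (k := fun y => L (heat y s) x) G00 K0 fK) => z; exact: laplacian_heat_le.
have G2 y : `|(t - s) * (L (heat y s) x * f y)| <= (t - s) * (G0 * K) * J y ^- q.
  by rewrite normrM ger0_norm ?subr_ge0 // -mulrA ler_wpM2l ?subr_ge0.
have G3 y : `|-1 * (heat x s y * f y)| <= decay_fac (M + q) T * J x ^+ (M + q) * K * J y ^- q.
  by rewrite mulN1r normrN; exact: heat_mul_le.
have G20 : 0 <= (t - s) * (G0 * K) by rewrite mulr_ge0 ?subr_ge0 // mulr_ge0.
rewrite (laplacian_Psem x s0 sT K0 fK) -(csumZ _ (mulr_ge0 G00 K0) G1).
rewrite -[X in _ + X + _]mulN1r /Psem -(csumZ _ F0 (heat_mul_le x s0 sT K0 fK)).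
rewrite -(csumD F0 F0 (heat_mul_le x t0 tT K0 fK) G3).
rewrite -(csumD (addr_ge0 F0 F0) G20 _ G2); last first.
  move=> y; apply: le_trans (ler_normD _ _) _; rewrite mulrDl lerD //; exact: heat_mul_le.
rewrite [leRHS](_ : _ = S6 * (quad_fac (M + q) T * J x ^+ (M + q + 4) * (t - s) ^+ 2 * K)); last by ring.
apply: csum_le.
  by nneg.
move=> y; rewrite [X in `|X|](_ : _ = (heat x t y - heat x s y + (t - s) * L (heat y s) x) * f y); last by ring.
apply: (kernel_mul_le (k := fun y => heat x t y - heat x s y + (t - s) * L (heat y s) x) _ K0 fK).
  by nneg.
by move=> z; exact: heat_quad_decay.
Qed.

Lemma Psem_lip T s t f K M x : 0 <= s -> s <= t -> t <= T -> 0 <= K -> poly_bound K M f ->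
  `|Psem t f x - Psem s f x| <= S6 * (lip_fac (M + q) T * J x ^+ (M + q + 2) * K) * (t - s).
Proof.
move=> s0 st tT K0 fK; have t0 : 0 <= t by lra.
have sT : s <= T by lra.
have F0 := fac_ge0 (M + q) T x K0.
have G3 y : `|-1 * (heat x s y * f y)| <= decay_fac (M + q) T * J x ^+ (M + q) * K * J y ^- q.
  by rewrite mulN1r normrN; exact: heat_mul_le.
rewrite -[X in _ + X]mulN1r /Psem -(csumZ _ F0 (heat_mul_le x s0 sT K0 fK)).
rewrite -(csumD F0 F0 (heat_mul_le x t0 tT K0 fK) G3).
have H0 : 0 <= lip_fac (M + q) T * J x ^+ (M + q + 2) * (t - s).
  by nneg.
rewrite [leRHS](_ : _ = S6 * (lip_fac (M + q) T * J x ^+ (M + q + 2) * (t - s) * K)); last by ring.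
apply: csum_le; first exact: mulr_ge0.
move=> y; rewrite [X in `|X|](_ : _ = (heat x t y - heat x s y) * f y); last by ring.
apply: (kernel_mul_le (k := fun y => heat x t y - heat x s y) H0 K0 fK) => z.
apply: le_trans (heat_lip_decay (M + q) _ _ s0 st tT) _.
by rewrite /lip_fac le_eqVlt; apply/orP; left; apply/eqP; ring.
Qed.

Lemma uderiv_Psem T f K M x : 0 <= K -> poly_bound K M f ->
  uderiv T (fun t => Psem t f x) (fun t => - L (Psem t f) x).
Proof.
move=> K0 fK.
apply: (@uderiv_quad _ _ _ _ (S6 * (quad_fac (M + q) T * J x ^+ (M + q + 4) * K))) => s t s0 st tT.
by rewrite mulrN opprK; exact: Psem_quad.
Qed.

Lemma ucont_Psem T f K M x : 0 <= K -> poly_bound K M f -> ucont T (fun t => Psem t f x).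
Proof. by move=> K0 fK; apply: ucont_lip => s t s0 st tT; exact: (Psem_lip x s0 st tT K0 fK). Qed.

End Duhamel.

Ltac nneg := repeat first [ done | by rewrite subr_ge0 | exact: quad_fac_ge0 | exact: lip_fac_ge0
  | exact: expR_ge0 | exact: jap_ge0 | exact: jap_expV_ge0 | exact: sqr_ge0 | apply: exprn_ge0
  | apply: addr_ge0 | apply: mulr_ge0 ].

(** * The Duhamel integral of a continuous path *)

Section Duhamel2.
Context {R : realType} {d : nat} (omega : lattice d -> lattice d -> R) (C : set (lattice d)) (A : R).
Context (hw : quadratic_rates omega A).
Implicit Types (x y z : C) (f g : C -> R).
Local Notation J x := (japanese R (val x)).
Local Notation L := (laplacian omega).
Local Notation q := (2 * d).+1.
Local Notation bx := (@box R d C).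
Local Notation heat := (@heat R d omega C).
Local Notation Psem := (@Psem R d omega C).
Local Notation decay_fac := (@decay_fac R d omega C A hw).
Local Notation quad_fac := (@quad_fac R d omega C A hw).
Local Notation lip_fac := (@lip_fac R d omega C A hw).
Local Notation S6 := (2 * 6 ^+ d : R).

Definition duhamel (b : R -> C -> R) t x := primitive (fun s => Psem (t - s) (b s) x) t.

(* The contribution of site [y] to the noise part at [(t, x)]: the integral of [heat x (t - s) y]
   against [db_s(y)], integrated by parts. *)
Definition site_noise (b : R -> C -> R) t x y :=
  (x == y)%:R * b t y - primitive (fun s => L (heat y (t - s)) x * b s y) t.

Context (T : R) (b : R -> C -> R) (K : R) (M : nat).
Context (K0 : 0 <= K) (cb : forall x, ucont T (b^~ x)).
Context (bK : forall t, 0 <= t -> t <= T -> poly_bound K M (b t)).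

(** Uniform in [r] because [heat <= 1]: on a finite box the increments of [b] are small, and outside
    it the common polynomial bound is summable against the kernel. *)
Lemma Psem_small x (e : R) : 0 < e -> exists2 h, 0 < h & forall r s t, 0 <= r -> r <= T ->
  0 <= s -> s <= t -> t <= T -> t - s <= h -> `|Psem r (b t) x - Psem r (b s) x| <= e.
Proof.
move=> e0; set K' := decay_fac (M + q) T * J x ^+ (M + q) * (2 * K).
have K20 : 0 <= 2 * K by rewrite mulr_ge0.
have K'0 : 0 <= K' by exact: fac_ge0.
have [n [h [n0 h0 H]]] := csum_small C K'0 e0.
have [dd dd0 D] := ucont_finite (bx n) cb h0.
exists dd => // r s t r0 rT s0 st tT ts.
have t0 : 0 <= t by lra.
have sT : s <= T by lra.
rewrite -(PsemB hw x r0 rT K0 (bK t0 tT) (bK s0 sT)); apply: H => y.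
  apply: (heat_mul_le hw (f := fun y => b t y - b s y) x r0 rT K20) => z.
  apply: le_trans (ler_normB _ _) _; have := bK t0 tT z; have := bK s0 sT z; lra.
move=> yn; rewrite normrM -[leRHS]mul1r ler_pM // ?D // ger0_norm ?(heat_ge0 hw) //.
exact: heat_le1 hw _ _ _ r0.
Qed.

Lemma ucont_duhamel_integrand S t x : 0 <= t -> t <= T -> S <= t ->
  ucont S (fun s => Psem (t - s) (b s) x).
Proof.
move=> t0 tT St e e0; have e20 : 0 < e / 2 by lra.
have [h h0 H] := Psem_small x e20.
set Q := S6 * (lip_fac (M + q) T * J x ^+ (M + q + 2) * K).
have Q0 : 0 <= Q by rewrite /Q; nneg.
exists (Num.min h (e / 2 / (Q + 1))); first by rewrite lt_min h0 divr_gt0 //; lra.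
move=> s s' s0 ss' s'S; rewrite le_min => /andP[h1 h2].
have i1 := H (t - s') s s' _ _ s0 ss' _ h1.
have s'T : s' <= T by lra.
have sT : s <= T by lra.
have i2 := Psem_lip hw x (s := t - s') (t := t - s) (T := T) _ _ _ K0 (bK s0 sT).
have {}i1 : `|Psem (t - s') (b s') x - Psem (t - s') (b s) x| <= e / 2 by apply: i1; lra.
have {}i2 : `|Psem (t - s) (b s) x - Psem (t - s') (b s) x| <= Q * (s' - s).
  have E : t - s - (t - s') = s' - s by ring.
  by rewrite -[X in _ * X]E; apply: i2; lra.
have i3 : Q * (s' - s) <= e / 2.
  move: h2; rewrite ler_pdivlMr; last by lra.
  have : 0 <= s' - s by lra.
  nra.
rewrite distrC in i2.
have := ler_normD (Psem (t - s') (b s') x - Psem (t - s') (b s) x)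
  (Psem (t - s') (b s) x - Psem (t - s) (b s) x).
rewrite subrKA; lra.
Qed.

Lemma duhamel0 x : duhamel b 0 x = 0.
Proof. exact: primitive0. Qed.

Lemma primitive_le (S t B : R) (g : R -> R) : ucont S g -> 0 <= t -> t <= S ->
  (forall s, 0 <= s -> s <= t -> `|g s| <= B) -> `|primitive g t| <= B * t.
Proof.
move=> cg t0 tS gB; have := uderiv_lip (uderiv_primitive cg) (lexx 0) t0 tS gB.
by rewrite primitive0 !subr0.
Qed.

Definition duh_fac : R := S6 * (decay_fac (M + q) T * K).

Lemma duhamel_le t x : 0 <= t -> t <= T -> `|duhamel b t x| <= duh_fac * T * J x ^+ (M + q).
Proof.
move=> t0 tT.
have F0 : 0 <= duh_fac * J x ^+ (M + q).
  by rewrite /duh_fac; nneg.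
apply: le_trans (primitive_le (ucont_duhamel_integrand x t0 tT (lexx t)) t0 (lexx t) _) _.
  move=> s s0 st; apply: (Psem_le hw (T := T) _ _ K0 (bK _ _)); lra.
have D0 : 0 <= duh_fac by rewrite /duh_fac; nneg.
by rewrite mulrAC ler_wpM2r ?ler_wpM2l ?exprn_ge0 ?jap_ge0.
Qed.

Lemma laplacian_duhamel t x : 0 <= t -> t <= T ->
  L (duhamel b t) x = primitive (fun s => L (Psem (t - s) (b s)) x) t.
Proof.
move=> t0 tT.
have ci y := ucont_duhamel_integrand y t0 tT (lexx t).
have cL : ucont t (fun s => L (Psem (t - s) (b s)) x) by apply: ucont_laplacian => y; exact: ci.
(* The outer time [t] is frozen in the integrand and only the upper limit varies, so both sides have
   the same derivative and vanish at 0. *)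
pose F s := L (fun y => primitive (fun s => Psem (t - s) (b s) y) s) x.
have dF : uderiv t F (fun s => L (Psem (t - s) (b s)) x).
  by apply: uderiv_laplacian => y; exact: uderiv_primitive.
apply: (uderiv_eq dF (uderiv_primitive cL) _ t0 (lexx t)).
rewrite primitive0 /F -[RHS](laplacian_cst omega 0 x); congr (L _ x).
by apply/funext => y; rewrite primitive0.
Qed.

Lemma uderiv_duhamel x : 0 <= T -> uderiv T ((duhamel b)^~ x) (fun t => b t x - L (duhamel b t) x).
Proof.
move=> T0 e e0.
set Q := S6 * (lip_fac (M + q) T * J x ^+ (M + q + 2) * K).
have Q0 : 0 <= Q by rewrite /Q; nneg.
set Q' := S6 * (quad_fac (M + q) T * J x ^+ (M + q + 4) * K).
have Q'0 : 0 <= Q' by rewrite /Q'; nneg.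
have e30 : 0 < e / 3 by lra.
have [h h0 H] := cb x e30.
pose N := Q + Q' * T + 1.
have QT : 0 <= Q' * T by rewrite mulr_ge0.
have N0 : 0 < N by rewrite /N; lra.
exists (Num.min h (e / 3 / N)); first by rewrite lt_min h0 divr_gt0.
move=> s t s0 st tT; rewrite le_min ler_pdivlMr // => /andP[h1 h2].
have sT : s <= T by lra.
have t0 : 0 <= t by lra.
rewrite laplacian_duhamel // /duhamel.
set g2 := fun r => Psem (t - r) (b r) x; set g1 := fun r => Psem (s - r) (b r) x.
set g3 := fun r => L (Psem (s - r) (b r)) x.
have c2 : ucont t g2 by exact: ucont_duhamel_integrand.
have c1 : ucont s g1 by exact: ucont_duhamel_integrand.
have c3 : ucont s g3 by apply: ucont_laplacian => y; exact: ucont_duhamel_integrand.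
have d2 := uderiv_primitive c2; have d1 := uderiv_primitive c1; have d3 := uderiv_primitive c3.
(* The new part of the integral: for [u] in [[s, t]] the integrand is close to [b s x], by
   continuity of [b] and of the semigroup at time 0. *)
have p1 : `|primitive g2 t - primitive g2 s - (t - s) * b s x| <= (Q * (t - s) + e / 3) * (t - s).
  have := uderiv_lip (M := Q * (t - s) + e / 3) (uderivB d2 (uderivZ (b s x) (uderiv_id t))) s0 st (lexx t).
  rewrite [X in `|X|](_ : _ = primitive g2 t - primitive g2 s - (t - s) * b s x); last by rewrite /=; ring.
  apply => u su ut; rewrite mulr1.
  have u0 : 0 <= u by lra.
  have uT : u <= T by lra.
  have tu0 : 0 <= t - u by lra.
  have tuT : t - u <= T by lra.
  have := Psem_lip hw x (lexx 0) tu0 tuT K0 (bK u0 uT).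
  rewrite (Psem0 hw) subr0 -/Q => i1.
  have us : u - s <= h by lra.
  have i2 := H s u s0 su uT us.
  have : Q * (t - u) <= Q * (t - s) by rewrite ler_wpM2l //; lra.
  have := ler_normD (g2 u - b u x) (b u x - b s x); rewrite subrKA; lra.
(* The old part: the semigroup has run for [t - s] longer, which contributes [- (t - s) L] to first
   order. *)
have p2 : `|primitive g2 s - primitive g1 s + (t - s) * primitive g3 s| <= Q' * (t - s) ^+ 2 * s.
  have := uderiv_lip (M := Q' * (t - s) ^+ 2)
    (uderivD (uderivB (uderiv_le st d2) d1) (uderivZ (t - s) d3)) (lexx 0) s0 (lexx s).
  rewrite !primitive0 !(subr0, mulr0, addr0); apply => u u0 us.
  have a1 : 0 <= s - u by lra.
  have a2 : s - u <= t - u by lra.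
  have a3 : t - u <= T by lra.
  have uT : u <= T by lra.
  have := Psem_quad hw x a1 a2 a3 K0 (bK u0 uT).
  by rewrite (_ : t - u - (s - u) = t - s); last by ring.
have E (a1 a2 a3 a4 k c : R) : a1 - a3 - k * (c - a4) = (a1 - a2 - k * c) + (a2 - a3 + k * a4) by ring.
rewrite (E _ (primitive g2 s)).
apply: le_trans (ler_normD _ _) _; apply: le_trans (lerD p1 p2) _.
have ts : 0 <= t - s by lra.
have i1 : Q' * (t - s) ^+ 2 * s <= Q' * T * (t - s) * (t - s).
  have -> : Q' * (t - s) ^+ 2 * s = Q' * s * (t - s) * (t - s) by ring.
  by rewrite !ler_wpM2r // ler_wpM2l.
have i2 : (t - s) * N * (t - s) <= e / 3 * (t - s) by rewrite ler_wpM2r.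
have i3 : 0 <= (t - s) * (t - s) by rewrite mulr_ge0.
have i4 : 0 <= e * (t - s) by rewrite mulr_ge0 // ltW.
move: i2; rewrite /N => i2; lra.
Qed.

Lemma ucont_duhamel x : 0 <= T -> ucont T ((duhamel b)^~ x).
Proof.
move=> T0; pose B := K * J x ^+ M + A * (1 + 2 ^+ (M + q)) * (duh_fac * T) * J x ^+ (M + q + 2).
apply: (@ucont_lip _ _ _ B) => s t s0 st tT.
apply: (uderiv_lip (uderiv_duhamel x T0) s0 st tT) => u su ut.
have u0 : 0 <= u by lra.
have uT : u <= T by lra.
apply: le_trans (ler_normB _ _) _; apply: lerD; first exact: bK.
by apply: (laplacian_poly hw) => y; exact: duhamel_le.
Qed.

(** At each [s], the terms [L (heat y (t - s)) x * b s y] sum over [y] to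
    [L (Psem (t - s) (b s)) x], with a box tail uniform in [s]; integration in [s] gives the
    Laplacian of the Duhamel integral. *)
Lemma site_noise_sum t x n : 0 <= t -> t <= T -> x \in bx n -> (0 < n)%N ->
  `|b t x - L (duhamel b t) x - \sum_(y <- bx n) site_noise b t x y| <=
  lip_fac (M + q) T * J x ^+ (M + q + 2) * K * (6 ^+ d / n%:R) * T.
Proof.
move=> t0 tT xn n0.
set B := lip_fac (M + q) T * J x ^+ (M + q + 2) * K.
have B0 : 0 <= B by rewrite /B; nneg.
have B10 : 0 <= lip_fac (M + q) T * J x ^+ (M + q + 2).
  by nneg.
pose g y s := L (heat y (t - s)) x * b s y.
have cg y : ucont t (g y).
  apply: ucontM; last exact: ucont_le (cb y).
  have cr := @ucont_rev _ t (fun s => L (heat y s) x); apply: cr.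
  by apply: ucont_laplacian => z; exact: (ucont_heat hw).
have cs : ucont t (fun s => \sum_(y <- bx n) g y s) by apply: ucont_sum.
have -> : \sum_(y <- bx n) site_noise b t x y =
    b t x - primitive (fun s => \sum_(y <- bx n) g y s) t.
  rewrite /site_noise sumrB; congr (_ - _).
    under eq_bigr => y _ do rewrite mulrC.
    by rewrite heat_delta_sum xn mul1r.
  have d1 := uderiv_primitive cs.
  have d2 := @uderiv_sum _ t _ (bx n) (fun y => primitive (g y)) g (fun y => uderiv_primitive (cg y)).
  apply: (uderiv_eq d2 d1 _ t0 (lexx t)).
  by rewrite primitive0 big1 // => y _; rewrite primitive0.
rewrite laplacian_duhamel //.
set G := fun s => L (Psem (t - s) (b s)) x.
have cG : ucont t G by apply: ucont_laplacian => y; exact: ucont_duhamel_integrand.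
have -> : b t x - primitive G t - (b t x - primitive (fun s => \sum_(y <- bx n) g y s) t) =
  primitive (fun s => \sum_(y <- bx n) g y s) t - primitive G t by ring.
have Bn : 0 <= B * (6 ^+ d / n%:R) by rewrite mulr_ge0 // divr_ge0 // exprn_ge0.
have := uderiv_lip (M := B * (6 ^+ d / n%:R))
  (uderivB (uderiv_primitive cs) (uderiv_primitive cG)) (lexx 0) t0 (lexx t).
rewrite !primitive0 subrr !subr0 => h; apply: le_trans (h _) _; last by rewrite ler_wpM2l.
move=> s s0 st; have ts0 : 0 <= t - s by lra.
have tsT : t - s <= T by lra.
have sT : s <= T by lra.
rewrite distrC /G (laplacian_Psem hw x ts0 tsT K0 (bK s0 sT)).
apply: csum_box => // y.
apply: (kernel_mul_le (k := fun y => L (heat y (t - s)) x) B10 K0 (bK s0 sT)) => z.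
exact: laplacian_heat_le.
Qed.

(* Riemann sums over a finite box: a version of [duhamel] that depends on finitely many values of [b]. *)
Definition duhamel_approx (b : R -> C -> R) n t x : R :=
  \sum_(i < n) (t / n%:R) * \sum_(y <- bx n) heat x (t - i%:R * (t / n%:R)) y * b (i%:R * (t / n%:R)) y.

Lemma duhamel_approx_cvg t x : 0 <= t -> t <= T ->
  duhamel_approx b n t x @[n --> \oo] --> duhamel b t x.
Proof.
move=> t0 tT; apply/cvgrPdist_le => e e0.
set B := decay_fac (M + q) T * J x ^+ (M + q) * K.
have B0 : 0 <= B by exact: fac_ge0.
have cg := ucont_duhamel_integrand x t0 tT (lexx t).
have e20 : 0 < e / 2 by lra.
have [dd dd0 D] := riemann_sum t0 cg (uderiv_primitive cg) e20.
have [n1 hn1] := exists_nat_gt (t / dd).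
have [n2 hn2] := exists_nat_gt (B * 6 ^+ d * t / (e / 2)).
near=> n.
have n_gt : (maxn n1 n2 < n)%N by near: n; exact: nbhs_infty_gt.
have n0 : (0 < n)%N by apply: leq_trans n_gt.
have n0' : 0 < n%:R :> R by rewrite ltr0n.
have tn0 : 0 <= t / n%:R by rewrite divr_ge0.
have tnt : n%:R * (t / n%:R) = t by rewrite mulrC divfK // gt_eqF.
pose s (i : nat) := i%:R * (t / n%:R).
have si i : s i.+1 - s i = t / n%:R by rewrite /s -natr1; ring.
have sle i : (i < n)%N -> 0 <= s i /\ s i <= t.
  move=> h; rewrite /s mulr_ge0 //; split => //.
  by rewrite -[leRHS]tnt ler_wpM2r // ler_nat ltnW.
have h1 : `|primitive (fun s => Psem (t - s) (b s) x) t -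
    \sum_(i < n) (t / n%:R) * Psem (t - s i) (b (s i)) x| <= e / 2.
  have := D t n s s t0 (lexx t).
  rewrite primitive0 subr0 => h.
  have -> : \sum_(i < n) (t / n%:R) * Psem (t - s i) (b (s i)) x =
      \sum_(i < n) (s i.+1 - s i) * Psem (t - s i) (b (s i)) x.
    by apply: eq_bigr => i _; rewrite si.
  apply: h => [||i ilt]; [by rewrite /s mul0r|exact: tnt|rewrite si lexx /=; split].
    by rewrite -subr_ge0 si.
  rewrite ltr_pdivrMr // mulrC -ltr_pdivrMr //; apply: lt_le_trans hn1 _.
  by rewrite ler_nat (leq_ltn_trans (leq_maxl n1 n2)).
have h2 : `|\sum_(i < n) (t / n%:R) * Psem (t - s i) (b (s i)) x - duhamel_approx b n t x| <= e / 2.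
  rewrite /duhamel_approx -sumrB; apply: le_trans (ler_norm_sum _ _ _) _.
  apply: (@le_trans _ _ (\sum_(i < n) (t / n%:R) * (B * (6 ^+ d / n%:R)))).
    apply: ler_sum => i _; rewrite -mulrBr normrM ger0_norm // ler_wpM2l //.
    have [i0 it] := sle i (ltn_ord i).
    apply: csum_box => // y; apply: (heat_mul_le hw (T := T)) => //; try lra.
    by apply: bK; lra.
  rewrite sumr_const card_ord -[leLHS]mulr_natl [leLHS]mulrA tnt.
  have : B * 6 ^+ d * t / (e / 2) <= n%:R.
    by apply: le_trans (ltW hn2) _; rewrite ler_nat (leq_ltn_trans (leq_maxr n1 n2)).
  rewrite ler_pdivrMr // => h.
  rewrite [leLHS](_ : _ = B * 6 ^+ d * t / n%:R); last by ring.
  by rewrite ler_pdivrMr // [leRHS]mulrC.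
rewrite /duhamel; set a := primitive _ _ in h1 *.
set c := \sum_(i < n) _ in h1 h2; have := ler_normD (a - c) (c - duhamel_approx b n t x).
rewrite subrKA; lra.
Unshelve. all: by end_near. Qed.

End Duhamel2.

(** * The random walk *)

Section RealProbability.
Context {R : realType} {dT : measure_display} {T : measurableType dT} (P : probability T R).
Implicit Types (A B E : set T).

Definition pr A : R := fine (P A).

Lemma prE A : measurable A -> P A = (pr A)%:E.
Proof. by move=> mA; rewrite /pr fineK // fin_num_measure. Qed.

Lemma pr_ge0 A : 0 <= pr A.
Proof. exact/fine_ge0/measure_ge0. Qed.

Lemma pr_le A B : measurable A -> measurable B -> A `<=` B -> pr A <= pr B.
Proof. by move=> mA mB AB; rewrite -lee_fin -!prE //; apply: le_measure => //; rewrite inE. Qed.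

Lemma prT : pr setT = 1. Proof. by rewrite /pr probability_setT. Qed.

Lemma pr0 : pr set0 = 0. Proof. by rewrite /pr measure0. Qed.

Lemma pr_le1 A : measurable A -> pr A <= 1.
Proof. by move=> mA; rewrite -prT; apply: pr_le. Qed.

Lemma prDI A B : measurable A -> measurable B -> pr A = pr (A `\` B) + pr (A `&` B).
Proof.
move=> mA mB; apply: EFin_inj; rewrite EFinD -!prE //.
- exact: measureDI.
- exact: measurableI.
- exact: measurableD.
Qed.

Lemma prU A B : measurable A -> measurable B -> A `&` B = set0 -> pr (A `|` B) = pr A + pr B.
Proof.
move=> mA mB AB; apply: EFin_inj; rewrite EFinD -!prE //; last exact: measurableU.
exact: measureU.
Qed.

Lemma pr_eq_diff0 A B : measurable A -> measurable B -> A `<=` B -> pr (B `\` A) = 0 -> pr A = pr B.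
Proof.
move=> mA mB AB h; rewrite (prDI mB mA) h add0r; congr pr.
by apply/seteqP; split => [w Aw|w []//]; split => //; exact: AB.
Qed.

Lemma pr_null A B : measurable A -> measurable B -> A `<=` B -> pr B = 0 -> pr A = 0.
Proof.
by move=> mA mB AB B0; apply: le_anti; rewrite pr_ge0 andbT -B0 pr_le.
Qed.

Lemma pr_cvg (F : nat -> set T) : (forall n, measurable (F n)) ->
  (forall n, F n `<=` F n.+1) -> pr (F n) @[n --> \oo] --> pr (\bigcup_n F n).
Proof.
move=> mF Fn; have mU : measurable (\bigcup_n F n) by exact: bigcup_measurable.
have := nondecreasing_cvg_mu (mu := P) mF mU.
have -> : {homo F : n m / (n <= m)%N >-> (n <= m)%O} = True.
  apply: propext; split => // _ n m nm; apply/subsetPset.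
  elim: m nm => [|m ih]; first by rewrite leqn0 => /eqP ->.
  rewrite leq_eqVlt => /predU1P[-> //|/ih h]; exact: subset_trans (Fn m).
move=> /(_ I) h; apply: fine_cvg; rewrite -prE //.
Qed.

Section Fiber.
Context {I : countType} (f : T -> I).
Context (mf : forall i, measurable (f @^-1` [set i])).

Lemma measurable_preim (D : set I) : measurable (f @^-1` D).
Proof.
pose F (k : nat) := if @choice.unpickle I k is Some i then
  if pselect (D i) then f @^-1` [set i] else set0 else set0.
have -> : f @^-1` D = \bigcup_k F k.
  apply/seteqP; split => [w /= Dw|w [k _]].
    by exists (choice.pickle (f w)) => //=; rewrite /F choice.pickleK; case: pselect.
  by rewrite /F; case: choice.unpickle => //= i; case: pselect => //= Di ->.
apply: bigcup_measurable => k _; rewrite /F; case: choice.unpickle => [i|]; last exact: measurable0.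
by case: pselect => Di; [exact: mf|exact: measurable0].
Qed.

(** Countable additivity over the values of [f], exhausted in the order of their codes. *)
Lemma pr_fiber A1 A2 (c : R) : 0 <= c -> measurable A1 -> measurable A2 ->
  (forall i, pr (A1 `&` f @^-1` [set i]) = c * pr (A2 `&` f @^-1` [set i])) -> pr A1 = c * pr A2.
Proof.
move=> c0 m1 m2 h.
pose F A n := A `&` f @^-1` [set i | (choice.pickle i < n)%N].
have mF A : measurable A -> forall n, measurable (F A n).
  by move=> mA n; apply: measurableI => //; exact: measurable_preim.
have FU A : \bigcup_n F A n = A.
  apply/seteqP; split => [w [n _ []]//|w Aw].
  by exists (choice.pickle (f w)).+1 => //; split => //=; exact: ltnSn.
have FS A n : F A n `<=` F A n.+1.
  by move=> w [Aw /= h']; split => //=; exact: ltnW.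
have E n : pr (F A1 n) = c * pr (F A2 n).
  elim: n => [|n ih].
    have F0 A : F A 0%N = set0 by apply/seteqP; split => // w [].
    by rewrite !F0 pr0 mulr0.
  have dec A : measurable A -> pr (F A n.+1) = pr (F A n) +
      (if @pickle_inv I n is Some i then pr (A `&` f @^-1` [set i]) else 0).
    move=> mA.
    case Ei : (@pickle_inv I n) => [i|].
      have ni : choice.pickle i = n by have := @pickle_invK I n; rewrite /oapp Ei.
      rewrite -prU //; [|exact: mF|by apply: measurableI|].
        congr pr; apply/seteqP; split => [w [Aw /=]|w [[Aw /= wn]|[Aw /= fi]]].
        - rewrite ltnS leq_eqVlt => /predU1P[wn|wn]; [right|by left].
          by split => //=; apply: (pcan_inj choice.pickleK); rewrite wn ni.
        - by split => //=; exact: ltnW.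
        - by split => //=; rewrite fi ni.
      apply/seteqP; split => // w [[_ /= wn] [_ /= fi]].
      by rewrite fi ni ltnn in wn.
    rewrite addr0; congr pr; apply/seteqP; split => [w [Aw /=]|w [Aw /= wn]].
      rewrite ltnS leq_eqVlt => /predU1P[wn|wn]; last by split.
      by have := @pickleK_inv I (f w); rewrite wn Ei.
    by split => //=; exact: ltnW.
  rewrite !dec // ih mulrDr; congr (_ + _).
  by case: pickle_inv => [i|]; rewrite ?h ?mulr0.
have c1 := pr_cvg (mF _ m1) (FS A1); have c2 := pr_cvg (mF _ m2) (FS A2).
rewrite FU in c1; rewrite FU in c2.
have c2' : c * pr (F A2 n) @[n --> \oo] --> c * pr A2 by apply: cvgM => //; exact: cvg_cst.
move: c1; rewrite (_ : (fun n => pr (F A1 n)) = (fun n => c * pr (F A2 n))); last by apply/funext.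
move=> c1; exact: (cvg_unique _ c1 c2').
Qed.

Lemma pr_seq_fiber A (s : seq I) : measurable A -> uniq s ->
  \sum_(i <- s) pr (A `&` f @^-1` [set i]) = pr (A `&` f @^-1` [set i | i \in s]).
Proof.
move=> mA; elim: s => [|i s ih] /=.
  by rewrite big_nil -pr0 => _; congr pr; apply/seteqP; split => // w [].
move=> /andP[ins us]; rewrite big_cons ih // -prU.
- congr pr; apply/seteqP; split => [w [[Aw /= ->]|[Aw /= h]]|w [Aw /=]].
  + by split => //=; rewrite mem_head.
  + by split => //=; rewrite inE h orbT.
  + by rewrite inE => /predU1P[h|h]; [left|right].
- by apply: measurableI => //; exact: mf.
- by apply: measurableI => //; exact: measurable_preim.
- by apply/seteqP; split => // w [[_ /= fi] [_ /=]]; rewrite fi (negbTE ins).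
Qed.

End Fiber.

(** The pi-lambda theorem for two proportional measures; it extends the independence of the next
    holding time and site from cylinder events to sigma-algebras. *)
Lemma pr_lambda (G : set (set T)) A1 A2 (c : R) : setI_closed G ->
  (forall E, G E -> measurable E) -> measurable A1 -> measurable A2 ->
  pr A1 = c * pr A2 -> (forall E, G E -> pr (E `&` A1) = c * pr (E `&` A2)) ->
  forall E, <<s G >> E -> pr (E `&` A1) = c * pr (E `&` A2).
Proof.
move=> GI Gm m1 m2 h hG E sE.
pose H := [set E | measurable E /\ pr (E `&` A1) = c * pr (E `&` A2)].
suff : H E by case.
have LH : lambda_system setT H.
  split => //.
  - by split; rewrite ?setTI.
  - move=> X Y YX [mX hX] [mY hY]; split; first exact: measurableD.
    have key B : measurable B -> pr ((X `\` Y) `&` B) = pr (X `&` B) - pr (Y `&` B).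
      move=> mB; rewrite (prDI (measurableI _ _ mX mB) mY).
      have -> : X `&` B `&` Y = Y `&` B.
        by apply/seteqP; split => [w [[Xw Bw] Yw]|w [Yw Bw]]; split => //; split => //; exact: YX.
      rewrite addrK; congr pr; apply/seteqP; split => [w [[Xw nY] Bw]|w [[Xw Bw] nY]]; split => //.
    by rewrite !key // hX hY mulrBr.
  - move=> F ndF HF; split.
      by apply: bigcup_measurable => n _; have [] := HF n.
    have key B : measurable B -> pr (F n `&` B) @[n --> \oo] --> pr (\bigcup_n F n `&` B).
      move=> mB; rewrite setI_bigcupl; apply: pr_cvg => n.
        by apply: measurableI => //; have [] := HF n.
      by apply: setSI; have /subsetPset := ndF _ _ (leqnSn n).
    have c2 : c * pr (F n `&` A2) @[n --> \oo] --> c * pr (\bigcup_n F n `&` A2).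
      by apply: cvgM; [exact: cvg_cst|exact: key].
    have c1 := key _ m1; move: c1.
    rewrite (_ : (fun n => pr (F n `&` A1)) = (fun n => c * pr (F n `&` A2))).
      by move=> c1; exact: (cvg_unique _ c1 c2).
    by apply/funext => n; have [] := HF n.
apply: (lambda_system_subset GI LH) sE => // X GX.
by split; [exact: Gm|exact: hG].
Qed.

End RealProbability.

(** * Sites and holding times of the walk *)

Section Walk.
Context {R : realType} {d : nat} (omega : lattice d -> lattice d -> R) (C : set (lattice d)) (A : R).
Context (hw : quadratic_rates omega A) (hC : unique_infinite_component omega C).
Implicit Types (x y : C) (z : nat -> C).
Local Notation w x y := (omega (val x) (val y)).
Local Notation crate := (@crate R d omega C).
Local Notation nbr := (@nbr d C).

Let w0 x y : 0 <= w x y. Proof. by case: hw => -[]. Qed.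
Let wC x y : w x y = w y x. Proof. by case: hw => -[]. Qed.
Let wN x y : ~~ neighbours (val x) (val y) -> w x y = 0.
Proof. by case: hw => -[_ _ h] _ _; exact: h. Qed.

Lemma component_closed (u v : lattice d) : C u -> 0 < omega u v -> C v.
Proof.
case: hC => -[a ->] _ _ /= -[p pa pu] uv.
by exists (rcons p v); rewrite ?last_rcons // rcons_path pa pu.
Qed.

Lemma total_rate_crate x : total_rate omega (val x) = crate x.
Proof.
rewrite /total_rate fsbig_finite; last exact: (finite_neighbours (R := R)).
rewrite /crate -(big_map val xpredT (omega (val x))); symmetry.
apply: uniq_sum_eq.
- by rewrite map_inj_uniq ?fset_uniq //; exact: val_inj.
- exact: fset_uniq.
- move=> y' /mapP[y]; rewrite (in_nbr (R := R)) => xy ->.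
  rewrite in_fset_set; last exact: (finite_neighbours (R := R)).
  by rewrite inE.
- move=> v; rewrite in_fset_set; last exact: (finite_neighbours (R := R)).
  rewrite inE /= => xv vn; case: hw => -[h0 _ _] _ _; apply/eqP; rewrite eq_le h0 andbT leNgt.
  apply/negP => xv0; move/negP: vn; apply; have Cv := component_closed (set_valP x) xv0.
  by apply/mapP; exists (SigSub (mem_set Cv)); rewrite ?(in_nbr (R := R)).
Qed.

(** A point without edges would be a component by itself, hence a finite one. *)
Lemma crate_gt0 x : 0 < crate x.
Proof.
have : exists y : lattice d, omega (val x) y != 0.
  apply/not_existsP => h.
  have h' v : omega (val x) v = 0 by apply/eqP; apply/negPn/negP; exact: h.
  have Csub : C `<=` [set val x].
    case: (hC) => -[a Ca] _ _ v Cv.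
    have CE u : C u -> connected_by omega a u by rewrite Ca.
    have xa : val x = a.
      have := CE _ (set_valP x) => -[p]; elim/last_ind: p => [|p u _] /=; first by move=> _ ->.
      rewrite rcons_path last_rcons => /andP[_ h1] ux.
      have : omega (last a p) u = 0 by case: (hw) => -[_ wS _] _ _; rewrite wS ux h'.
      by move=> h2; rewrite h2 ltxx in h1.
    have [[|u p]] := CE _ Cv => /=; first by move=> _ <-; rewrite xa.
    by move=> /andP[]; rewrite -xa h' ltxx.
  by case: (hC) => _ inf _; apply: inf; apply: sub_finite_set Csub _; exact: finite_set1.
move=> [v xv]; case: (hw) => -[h0 _ hN] _ _.
have xv0 : 0 < omega (val x) v by rewrite lt_neqAle eq_sym xv h0.
have Cv := component_closed (set_valP x) xv0.
apply: lt_le_trans xv0 _; rewrite /crate.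
apply: (@sum_term_le _ _ (nbr x) (fun y => w x y) (SigSub (mem_set Cv))) => //.
by rewrite (in_nbr (R := R)); apply/negPn/negP => h; rewrite hN ?eqxx in xv.
Qed.

Context (X : vsrw omega C) (x0 : C).
Local Notation P := (law X x0).
Local Notation T := (vsrw_space X).
Local Notation pr := (@pr R _ T P).

Definition path_ev (z : nat -> C) (n : nat) : set T := [set om | forall i, (i <= n)%N -> site i om = z i].
Definition hold_ev (s : nat -> R) (m : nat) : set T := [set om | forall i, (i < m)%N -> s i < holding i om].
Definition path_wt (z : nat -> C) (n : nat) : R :=
  (z 0%N == x0)%:R * \prod_(i < n) (w (z i) (z i.+1) / crate (z i)).

Let mhold (i : nat) (a : R) : measurable [set om : T | a < holding i om].
Proof.
have := @measurable_holding _ _ _ _ X i measurableT `]a, +oo[%classic (measurable_itv _).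
rewrite setTI; congr measurable; apply/seteqP; split => om /=; rewrite in_itv /= andbT //.
Qed.

Lemma measurable_path_ev z n : measurable (path_ev z n).
Proof.
have -> : path_ev z n = \bigcap_(i in [set i | (i <= n)%N]) (site i @^-1` [set z i]).
  by apply/seteqP; split.
by apply: bigcap_measurableType => i _; exact: measurable_site.
Qed.

Lemma measurable_hold_ev s m : measurable (hold_ev s m).
Proof.
have -> : hold_ev s m = \bigcap_(i in [set i | (i < m)%N]) [set om | s i < holding i om].
  by apply/seteqP; split.
by apply: bigcap_measurableType => i _; exact: mhold.
Qed.

Lemma vsrw_law z n s : (forall i, 0 <= s i) -> pr (path_ev z n `&` hold_ev s n.+1) =
  path_wt z n * \prod_(i < n.+1) expR (- crate (z i) * s i).
Proof.
move=> s0; have := @vsrw_lawE _ _ _ _ X x0 n z s s0.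
rewrite (_ : [set om | _] = path_ev z n `&` hold_ev s n.+1); last first.
  apply/seteqP; split => [om h|om [h1 h2] i ilt]; last by split; [exact: h1|exact: h2].
  by split => i ilt; have [] := h i ilt.
rewrite /pr => -> /=; rewrite /path_wt; congr (_ * _ * _); apply: eq_bigr => i _.
  by rewrite total_rate_crate.
by rewrite total_rate_crate.
Qed.

Lemma path_wt_le z n : path_wt z n <= pr (path_ev z n).
Proof.
have := @vsrw_law z n (fun=> 0) (fun=> lexx 0).
rewrite [X in _ * X]big1 ?mulr1; last by move=> i _; rewrite mulr0 expR0.
move=> <-; apply: pr_le; [|exact: measurable_path_ev|by move=> om []].
by apply: measurableI; [exact: measurable_path_ev|exact: measurable_hold_ev].
Qed.

Definition upd {I : Type} (z : nat -> I) (n : nat) (y : I) : nat -> I :=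
  fun i => if i == n then y else z i.

Lemma path_ev_upd z n y : path_ev (upd z n.+1 y) n.+1 = path_ev z n `&` site n.+1 @^-1` [set y].
Proof.
apply/seteqP; split => [om h|om [h1 h2] i ilt].
  split => [i ilt|]; first by rewrite h ?leqW // /upd ltn_eqF.
  by rewrite /= h // /upd eqxx.
by rewrite /upd; case: eqP => [->//|/eqP ne]; apply: h1; rewrite -ltnS ltn_neqAle ne.
Qed.

Lemma path_wt_upd z n y : path_wt (upd z n.+1 y) n.+1 = path_wt z n * (w (z n) y / crate (z n)).
Proof.
rewrite /path_wt big_ord_recr /= mulrA /upd /= eqxx ltn_eqF //; congr (_ * _ * _).
by apply: eq_bigr => i _; rewrite !ltn_eqF ?ltnS // ltnW.
Qed.

(** The law at thresholds 0 counts only positive holding times and so gives a lower bound. The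
    weights of the one-step extensions add up to the weight of the path, which by induction also
    bounds the sum of their probabilities; so none can exceed its weight. *)
Lemma path_prob z n : pr (path_ev z n) = path_wt z n.
Proof.
apply: le_anti; rewrite path_wt_le andbT.
elim: n z => [|n ih] z.
  rewrite /path_wt big_ord0 mulr1; case: (eqVneq (z 0%N) x0) => [_|zx] /=.
    exact/pr_le1/measurable_path_ev.
  have h1 : 1 <= pr (path_ev (fun=> x0) 0).
    by apply: le_trans (path_wt_le _ _); rewrite /path_wt eqxx big_ord0 mulr1.
  have := pr_le1 P (measurableU _ _ (measurable_path_ev z 0) (measurable_path_ev (fun=> x0) 0)).
  rewrite prU //; first by lra.
  - exact: measurable_path_ev.
  - exact: measurable_path_ev.
  - apply/seteqP; split => // om [h2 h3]; move: zx.
    by rewrite -(h2 0%N) // (h3 0%N) // eqxx.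
have zE : path_ev z n.+1 = path_ev (upd z n.+1 (z n.+1)) n.+1.
  by congr path_ev; apply/funext => i; rewrite /upd; case: eqP => // ->.
have zW : path_wt z n.+1 = path_wt (upd z n.+1 (z n.+1)) n.+1.
  by congr path_wt; apply/funext => i; rewrite /upd; case: eqP => // ->.
rewrite zE zW path_ev_upd path_wt_upd; set y := z n.+1.
pose a (v : C) := path_wt z n * (w (z n) v / crate (z n)).
have ha v : a v <= pr (path_ev z n `&` site n.+1 @^-1` [set v]).
  by rewrite /a -path_wt_upd -path_ev_upd; exact: path_wt_le.
pose s : seq C := y :: rem y (nbr (z n)).
have us : uniq s by rewrite /s /= rem_uniq ?fset_uniq // mem_rem_uniq ?fset_uniq // !inE eqxx.
have tot : \sum_(v <- s) a v = path_wt z n.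
  transitivity (\sum_(v <- nbr (z n)) a v).
    symmetry; apply: (uniq_sum_eq (fset_uniq _) us).
      move=> v vn; rewrite inE; case: eqVneq => //= vy.
      by rewrite mem_rem_uniq ?fset_uniq // !inE vy.
    by move=> v _; rewrite (in_nbr (R := R)) /a => /wN ->; rewrite mul0r mulr0.
  by rewrite /a -mulr_sumr -mulr_suml divff ?mulr1 // gt_eqF // crate_gt0.
have tot2 : \sum_(v <- s) pr (path_ev z n `&` site n.+1 @^-1` [set v]) <= path_wt z n.
  rewrite pr_seq_fiber //.
  - apply: le_trans (ih z); apply: pr_le; [|exact: measurable_path_ev|by move=> om []].
    apply: measurableI; first exact: measurable_path_ev.
    by apply: measurable_preim => v; exact: measurable_site.
  - by move=> v; exact: measurable_site.
  - exact: measurable_path_ev.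
rewrite -/(a y); move: tot2; rewrite -tot !big_cons => tot2.
have : \sum_(v <- rem y (nbr (z n))) a v <=
  \sum_(v <- rem y (nbr (z n))) pr (path_ev z n `&` site n.+1 @^-1` [set v]) by apply: ler_sum.
lra.
Qed.

(** Extends the law to fewer holding times than sites and to thresholds of any sign. By [path_prob]
    the holding times along the path are almost surely positive, so raising negative thresholds to 0
    loses nothing. *)
Lemma path_hold_prob z n m s : (m <= n.+1)%N -> pr (path_ev z n `&` hold_ev s m) =
  path_wt z n * \prod_(i < m) expR (- crate (z i) * Num.max (s i) 0).
Proof.
move=> mn; pose s' i := if (i < m)%N then Num.max (s i) 0 else 0.
have s'0 i : 0 <= s' i by rewrite /s'; case: ifP => // _; rewrite le_max lexx orbT.
have mp := measurable_path_ev z n.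
have -> : \prod_(i < m) expR (- crate (z i) * Num.max (s i) 0) =
    \prod_(i < n.+1) expR (- crate (z i) * s' i).
  rewrite (big_ord_widen _ (fun i => expR (- crate (z i) * Num.max (s i) 0)) mn).
  rewrite [LHS]big_mkcond; apply: eq_bigr => i _; rewrite /s'.
  by case: ifP => // _; rewrite mulr0 expR0.
rewrite -vsrw_law //; symmetry; apply: pr_eq_diff0.
- by apply: measurableI => //; exact: measurable_hold_ev.
- by apply: measurableI => //; exact: measurable_hold_ev.
- move=> om [po h]; split => // i im; have := h i (leq_trans im mn); rewrite /s' im.
  by rewrite gt_max => /andP[].
apply: (@pr_null _ _ _ _ _ (path_ev z n `\` hold_ev (fun=> 0) n.+1)).
- by apply: measurableD; apply: measurableI => //; exact: measurable_hold_ev.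
- by apply: measurableD => //; exact: measurable_hold_ev.
- move=> om [[po h1] h2]; split => // h3; apply: h2; split => // i ilt; rewrite /s'.
  case: ifP => im; last exact: h3.
  by rewrite gt_max h1 // h3.
have := prDI P mp (measurable_hold_ev (fun=> 0) n.+1).
rewrite vsrw_law // path_prob [X in _ * X]big1 ?mulr1; last by move=> i _; rewrite mulr0 expR0.
lra.
Qed.

(** A pi-system generating the sigma-algebra of the first [n] holding times. A threshold -1 imposes
    no condition, as holding times are nonnegative. *)
Definition hold_sys (n : nat) : set (set T) := [set E | exists s, E = hold_ev s n].

Lemma hold_sys_setI n : setI_closed (hold_sys n).
Proof.
move=> _ _ [s ->] [s' ->]; exists (fun i => Num.max (s i) (s' i)).
apply/seteqP; split => [om [h1 h2] i ilt|om h]; first by rewrite gt_max h1 ?h2.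
by split => i ilt; have := h i ilt; rewrite gt_max => /andP[].
Qed.

Lemma hold_sys_measurable n E : hold_sys n E -> measurable E.
Proof. by move=> [s ->]; exact: measurable_hold_ev. Qed.

Lemma hold_sigma_measurable n E : <<s hold_sys n >> E -> measurable E.
Proof.
apply: smallest_sub; first exact: sigma_algebra_measurable.
exact: hold_sys_measurable.
Qed.

Definition hgt (n : nat) (u : R) : set T := [set om | u < holding n om].

Lemma hold_ev_recr s n : hold_ev s n.+1 = hold_ev s n `&` hgt n (s n).
Proof.
apply/seteqP; split => [om h|om [h1 h2] i].
  by split => [i ilt|]; apply: h => //; exact: ltnW.
by rewrite ltnS leq_eqVlt => /predU1P[->//|]; exact: h1.
Qed.

Lemma path_holding z n E u : <<s hold_sys n >> E -> 0 <= u ->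
  pr (E `&` (path_ev z n `&` hgt n u)) = expR (- crate (z n) * u) * pr (E `&` path_ev z n).
Proof.
move=> sE u0; move: E sE.
have mp := measurable_path_ev z n.
have key s : pr (hold_ev s n `&` (path_ev z n `&` hgt n u)) =
    expR (- crate (z n) * u) * pr (hold_ev s n `&` path_ev z n).
  have -> : hold_ev s n `&` (path_ev z n `&` hgt n u) = path_ev z n `&` hold_ev (upd s n u) n.+1.
    rewrite hold_ev_recr /upd eqxx setIA [hold_ev s n `&` _]setIC -setIA; congr (_ `&` (_ `&` _)).
    by apply/seteqP; split => om h i ilt; have := h i ilt; rewrite ltn_eqF.
  rewrite [_ `&` path_ev z n]setIC !path_hold_prob // big_ord_recr /= /upd eqxx max_l // mulrA mulrC.
  congr (_ * (_ * _)); apply: eq_bigr => i _; by rewrite ltn_eqF.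
apply: (pr_lambda (@hold_sys_setI n) (@hold_sys_measurable n)) => //.
- by apply: measurableI => //; exact: mhold.
- have := key (fun=> -1); have -> : hold_ev (fun=> -1) n = setT.
    by apply/seteqP; split => // om _ i _; apply: lt_le_trans (holding_ge0 i om); rewrite ltrN10.
  by rewrite !setTI.
- by move=> _ [s ->]; exact: key.
Qed.

Lemma path_jump z n E y : <<s hold_sys n.+1 >> E ->
  pr (E `&` (path_ev z n `&` site n.+1 @^-1` [set y])) =
  w (z n) y / crate (z n) * pr (E `&` path_ev z n).
Proof.
move: E; have mp := measurable_path_ev z n.
have key s : pr (hold_ev s n.+1 `&` (path_ev z n `&` site n.+1 @^-1` [set y])) =
    w (z n) y / crate (z n) * pr (hold_ev s n.+1 `&` path_ev z n).
  rewrite -path_ev_upd ![hold_ev _ _ `&` _]setIC !path_hold_prob // path_wt_upd.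
  rewrite [RHS]mulrCA [RHS]mulrA; congr (_ * _); apply: eq_bigr => i _.
  by rewrite /upd ltn_eqF.
apply: (pr_lambda (@hold_sys_setI n.+1) (@hold_sys_measurable n.+1)) => //.
- by apply: measurableI => //; exact: measurable_site.
- have := key (fun=> -1); have -> : hold_ev (fun=> -1) n.+1 = setT.
    by apply/seteqP; split => // om _ i _; apply: lt_le_trans (holding_ge0 i om); rewrite ltrN10.
  by rewrite !setTI.
- by move=> _ [s ->]; exact: key.
Qed.

(** The law is known along whole paths only. [Q z j] fixes the sites [j] to [n]; raising [j] forgets
    one earlier site at a time, by summation over its values. *)
Lemma sum_out_path (n : nat) (B D : set T) (y : C) (c : R) : 0 <= c -> measurable B -> measurable D ->
  (forall z, z n = y -> pr (B `&` path_ev z n) = c * pr (D `&` path_ev z n)) ->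
  pr (B `&` site n @^-1` [set y]) = c * pr (D `&` site n @^-1` [set y]).
Proof.
move=> c0 mB mD h.
pose Q z j : set T := [set om | forall i, (j <= i <= n)%N -> site i om = z i].
have mQ z j : measurable (Q z j).
  have -> : Q z j = \bigcap_(i in [set i | (j <= i <= n)%N]) (site i @^-1` [set z i]).
    by apply/seteqP; split.
  by apply: bigcap_measurableType => i _; exact: measurable_site.
have key j : (j <= n)%N -> forall z, z n = y -> pr (B `&` Q z j) = c * pr (D `&` Q z j).
  elim: j => [_ z zn|j ih jn z zn].
    have QE : Q z 0%N = path_ev z n by apply/seteqP; split => om h1 i; exact: h1.
    by rewrite QE; exact: h.
  apply: (pr_fiber (f := @site _ _ _ _ X j)) => //.
  - by move=> v; exact: measurable_site.
  - exact: measurableI.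
  - exact: measurableI.
  move=> v; have QE : Q z j.+1 `&` site j @^-1` [set v] = Q (upd z j v) j.
    apply/seteqP; split => [om [h1 h2] i /andP[ji iN]|om h1].
      rewrite /upd; case: eqP => [->//|/eqP ne]; apply: h1.
      by rewrite ltn_neqAle eq_sym ne ji.
    split => [i /andP[ji iN]|]; last by rewrite /= (h1 j) ?leqnn ?(ltnW jn) // /upd eqxx.
    by rewrite (h1 i) ?iN ?(ltnW ji) // /upd gtn_eqF.
  by rewrite -!setIA QE (ih (ltnW jn)) // /upd gtn_eqF.
have := key n (leqnn n) (fun=> y) erefl.
have -> : Q (fun=> y) n = site n @^-1` [set y].
  apply/seteqP; split => [om|om h1 i]; first by apply; rewrite leqnn.
  by move=> /andP[ni iN]; rewrite (_ : i = n) //; apply/eqP; rewrite eqn_leq iN.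
by [].
Qed.

Lemma site_holding n y E u : <<s hold_sys n >> E -> 0 <= u ->
  pr (E `&` hgt n u `&` site n @^-1` [set y]) = expR (- crate y * u) * pr (E `&` site n @^-1` [set y]).
Proof.
move=> sE u0; have mE := hold_sigma_measurable sE.
apply: sum_out_path => //; rewrite ?expR_ge0 //.
  by apply: measurableI => //; exact: mhold.
by move=> z <-; rewrite -setIA [hgt n u `&` _]setIC; exact: path_holding.
Qed.

Lemma site_jump n y y' E : <<s hold_sys n.+1 >> E ->
  pr (E `&` site n.+1 @^-1` [set y'] `&` site n @^-1` [set y]) =
  w y y' / crate y * pr (E `&` site n @^-1` [set y]).
Proof.
move=> sE; have mE := hold_sigma_measurable sE.
apply: sum_out_path => //; first by rewrite divr_ge0 // ltW // crate_gt0.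
  by apply: measurableI => //; exact: measurable_site.
by move=> z <-; rewrite -setIA [_ `&` path_ev z n]setIC; exact: path_jump.
Qed.

End Walk.

Lemma expRN_taylor {R : realType} (x : R) : 0 <= x -> `|expR (- x) - 1 + x| <= x ^+ 2.
Proof.
move=> x0; have h1 := expR_ge1Dx (- x).
have h2 : expR (- x) <= (1 + x)^-1.
  by rewrite expRN lef_pV2 ?posrE ?expR_gt0 ?expR_ge1Dx //; lra.
have h3 : (1 + x)^-1 <= 1 - x + x ^+ 2.
  rewrite -[leLHS]mul1r ler_pdivrMr; last by lra.
  have : 0 <= x ^+ 2 * x by rewrite mulr_ge0 // sqr_ge0.
  rewrite !expr2; lra.
by rewrite ger0_norm; lra.
Qed.

(** A population [k] with arrivals [m] and departures at rate [r]: those present at [s] survive with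
    factor [exp (- r (t - s))], and those arriving later are still there up to a second order error.
    To first order this is [k' = m' - r k]. *)
Lemma renewal_uderiv {R : realType} (T r : R) (m k mu : R -> R) : 0 <= r ->
  ucont T mu -> uderiv T m mu ->
  (forall t, 0 <= t -> t <= T -> 0 <= k t <= 1) ->
  (forall s t, 0 <= s -> s <= t -> t <= T ->
    `|k t - expR (- r * (t - s)) * k s - (m t - m s)| <= r * (t - s) * (m t - m s)) ->
  uderiv T k (fun t => mu t - r * k t).
Proof.
move=> r0 cmu dm k01 H e e0.
have [B B0 hB] := ucont_bounded cmu.
have e30 : 0 < e / 3 by lra.
have [d1 d10 D1] := dm _ e30.
pose N := r * B + r ^+ 2 + 1.
have N0 : 0 < N by rewrite /N; have := mulr_ge0 r0 B0; have := sqr_ge0 r; lra.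
exists (Num.min d1 (e / 3 / N)); first by rewrite lt_min d10 divr_gt0.
move=> s t s0 st tT; rewrite le_min ler_pdivlMr // => /andP[h1 h2].
have i1 := H s t s0 st tT; have i2 := D1 s t s0 st tT h1.
have sT : s <= T by lra.
have /andP[k0 k1] := k01 s s0 sT.
have ts : 0 <= t - s by lra.
have i3 := expRN_taylor (mulr_ge0 r0 ts).
have mB : m t - m s <= B * (t - s).
  apply: (uderiv_incr dm) => // u su ut; apply: le_trans (ler_norm _) _; apply: hB; lra.
have i4 : r * (t - s) * (m t - m s) <= r * (t - s) * (B * (t - s)) by rewrite ler_wpM2l // mulr_ge0.
set a := k t - _ - _ in i1; set b := m t - m s - _ in i2.
set c := expR (- (r * (t - s))) - 1 + r * (t - s) in i3.
have -> : k t - k s - (t - s) * (mu s - r * k s) = a + b + c * k s.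
  by rewrite /a /b /c mulNr; ring.
have ck : `|c * k s| <= (r * (t - s)) ^+ 2.
  rewrite normrM -[leRHS]mulr1 ler_pM //; first by rewrite ger0_norm.
apply: le_trans (ler_normD _ _) _; apply: le_trans (lerD (ler_normD _ _) ck) _.
have : (t - s) * N * (t - s) <= e / 3 * (t - s) by rewrite ler_wpM2r.
have : 0 <= (t - s) * (t - s) by rewrite mulr_ge0.
have : 0 <= e * (t - s) by rewrite mulr_ge0 // ltW.
have a1 := le_trans i1 i4.
rewrite /N !expr2 => h3 h4 h5; lra.
Qed.

(** * Jump times and the equations of the walk *)

Section JumpTimes.
Context {R : realType} {d : nat} (omega : lattice d -> lattice d -> R) (C : set (lattice d)) (A : R).
Context (hw : quadratic_rates omega A) (hC : unique_infinite_component omega C).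
Implicit Types (x y : C) (z : nat -> C).
Local Notation w x y := (omega (val x) (val y)).
Local Notation crate := (@crate R d omega C).
Local Notation nbr := (@nbr d C).
Context (X : vsrw omega C) (x0 : C).
Local Notation P := (law X x0).
Local Notation T := (vsrw_space X).
Local Notation pr := (@pr R _ T P).
Local Notation hold_sys := (@hold_sys R d omega C X).
Local Notation hgt := (@hgt R d omega C X).

Let w0 x y : 0 <= w x y. Proof. by case: hw => -[]. Qed.

Definition site_at n y : set T := site n @^-1` [set y].

Lemma measurable_site_at n y : measurable (site_at n y). Proof. exact: measurable_site. Qed.

Lemma jump_time_sigma n (B : set R) : measurable B -> <<s hold_sys n >> (@jump_time _ _ _ _ X n @^-1` B).
Proof.
move=> mB; pose TT := g_sigma_algebraType (hold_sys n).
have mh (i : 'I_n) : measurable_fun [set: TT] (fun om : TT => holding i (om : T)).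
  apply: (measurability _ (RGenOInfty.measurableE R)).
  move=> _ [_ [a ->] <-]; rewrite setTI; apply: sub_sigma_algebra.
  exists (fun j : nat => if j == i then a else -1); apply/seteqP; split => om /=.
    rewrite in_itv /= andbT => h j jn /=; case: eqP => [->//|_].
    by apply: lt_le_trans (holding_ge0 j om); rewrite ltrN10.
  by move=> /(_ i (ltn_ord i)); rewrite eqxx in_itv /= andbT.
have := measurable_sum (index_enum 'I_n) mh measurableT mB.
by rewrite setTI.
Qed.

Definition jle n (t : R) : set T := [set om | jump_time n om <= t].
Definition jgt n (t : R) : set T := [set om | t < jump_time n om].

Lemma jle_sigma n t : <<s hold_sys n >> (jle n t).
Proof.
have := @jump_time_sigma n `]-oo, t]%classic (measurable_itv _).
by congr (<<s _ >> _); apply/seteqP; split => om /=; rewrite in_itv.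
Qed.

Arguments jle_sigma : clear implicits.

Lemma sigmaD n E F : <<s hold_sys n >> E -> <<s hold_sys n >> F -> <<s hold_sys n >> (E `\` F).
Proof.
move=> sE sF; pose TT := g_sigma_algebraType (hold_sys n).
exact: (@measurableD _ TT E F sE sF).
Qed.

Arguments sigmaD : clear implicits.

Lemma measurable_jle n t : measurable (jle n t).
Proof. exact: hold_sigma_measurable (jle_sigma n t). Qed.

Lemma jgtE n t : jgt n t = ~` jle n t.
Proof. by apply/seteqP; split => om /=; rewrite /jgt /jle /= ltNge => /negP. Qed.

Lemma measurable_jgt n t : measurable (jgt n t).
Proof. by rewrite jgtE; apply: measurableC; exact: measurable_jle. Qed.

Lemma jump_timeS n (om : T) : jump_time n.+1 om = jump_time n om + holding n om.
Proof. by rewrite /jump_time big_ord_recr. Qed.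

Lemma jump_time_ge0 n (om : T) : 0 <= jump_time n om.
Proof. by apply: sumr_ge0 => i _; exact: holding_ge0. Qed.

(** Arrivals at [y] by the [n]-th jump and, for [kt], those still present at [t]; the difference
    counts the departures, which feed [mt] at the next level. *)
Definition mt n t y := pr (jle n t `&` site_at n y).
Definition kt n t y := pr (jle n t `&` jgt n.+1 t `&` site_at n y).

Let mY n y := measurable_site_at n y.
Let mle n t := measurable_jle n t.
Let mgt n t := measurable_jgt n t.
Let mhg n u : measurable (hgt n u).
Proof.
have := @measurable_holding _ _ _ _ X n measurableT `]u, +oo[%classic (measurable_itv _).
rewrite setTI; congr measurable; apply/seteqP; split => om /=; rewrite in_itv /= andbT //.
Qed.

(** In the cell the jump time lies between [a] and [b], so survival past [u] is squeezed between
    holding times above [u - a] and above [u - b], whose probabilities are exact. *)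
Lemma cell_bounds n y a b u : 0 <= a -> a <= b -> b <= u ->
  expR (- crate y * (u - a)) * pr ((jle n b `\` jle n a) `&` site_at n y)
    <= pr ((jle n b `\` jle n a) `&` jgt n.+1 u `&` site_at n y)
    <= expR (- crate y * (u - b)) * pr ((jle n b `\` jle n a) `&` site_at n y).
Proof.
move=> a0 ab bu.
have sE := sigmaD _ _ _ (jle_sigma n b) (jle_sigma n a); have mE := hold_sigma_measurable sE.
have mm F : measurable F -> measurable ((jle n b `\` jle n a) `&` F `&` site_at n y).
  by move=> mF; apply: measurableI => //; exact: measurableI.
have ua : 0 <= u - a by lra.
have ub : 0 <= u - b by lra.
rewrite -!(site_holding hw hC x0 y sE) //; apply/andP; split; apply: (pr_le _ _ _);
  do ?[exact: (mm _ (mhg n _))|exact: (mm _ (mgt n.+1 u))].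
- move=> om [[[h1 h2] h3] h4]; split => //; split => //.
  move: h2 h3; rewrite /jle /jgt /hgt /= jump_timeS => /negP; rewrite -ltNge; lra.
- move=> om [[[h1 h2] h3] h4]; split => //; split => //.
  move: h1 h3; rewrite /jle /jgt /hgt /= jump_timeS; lra.
Qed.

Lemma start_cell n y u : 0 <= u ->
  pr (jle n 0 `&` jgt n.+1 u `&` site_at n y) = expR (- crate y * u) * pr (jle n 0 `&` site_at n y).
Proof.
move=> u0; rewrite -(site_holding hw hC x0 y (jle_sigma n 0) u0); congr pr.
apply/seteqP; split => om [[h1 h2] h3]; split => //; split => //; move: h1 h2;
  have := jump_time_ge0 n om; rewrite /jle /jgt /hgt /= jump_timeS; lra.
Qed.

Lemma jle_split n y a b F : a <= b -> measurable F ->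
  pr (jle n b `&` F `&` site_at n y) =
  pr (jle n a `&` F `&` site_at n y) + pr ((jle n b `\` jle n a) `&` F `&` site_at n y).
Proof.
move=> ab mF.
have mA : measurable (jle n b `&` F `&` site_at n y) by do 2!apply: measurableI => //.
rewrite (prDI P mA (mle n a)) addrC.
congr (_ + _); congr pr; apply/seteqP; split => [om|om].
- move=> [[[h1 h2] h3] h4]; by split.
- move=> [[h1 h2] h3]; split => //; split => //; split => //.
  by move: h1; rewrite /jle /=; lra.
- by move=> [[[h1 h2] h3] h4].
- by move=> [[[h1 h2] h3] h4]; split.
Qed.

Lemma jle_diff n y a b : a <= b ->
  pr ((jle n b `\` jle n a) `&` site_at n y) = mt n b y - mt n a y.
Proof.
move=> ab; have := jle_split n y ab measurableT; rewrite !setIT /mt; lra.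
Qed.

Lemma mt_incr n y a b : a <= b -> mt n a y <= mt n b y.
Proof. by move=> ab; have := jle_diff n y ab; have := pr_ge0 P ((jle n b `\` jle n a) `&` site_at n y); lra. Qed.

(* Memorylessness, by cutting [0, s] into cells on which [jump_time n] is nearly constant. *)
Lemma memoryless n y s t : 0 <= s -> s <= t ->
  pr (jle n s `&` jgt n.+1 t `&` site_at n y) = expR (- crate y * (t - s)) * kt n s y.
Proof.
move=> s0 st; have t0 : 0 <= t by lra.
set r := crate y; have r0 : 0 <= r by exact: crate_ge0 hw _.
(* With the factor [exp (r u)], a cell []a, a + h]] contributes between [exp (r a)] and
   [exp (r (a + h))] times its mass, whatever [u]. The discrepancies between [u = t] and [u = s]
   therefore sum to [O(h)]. *)
pose g u a := expR (r * u) * pr (jle n a `&` jgt n.+1 u `&` site_at n y).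
suff key : g t s = g s s.
  rewrite /kt; have E : expR (r * t) != 0 by rewrite gt_eqF // expR_gt0.
  apply: (mulfI E); rewrite -/(g t s) key /g mulrA -expRD; congr (expR _ * _); ring.
apply/eqP; rewrite -subr_eq0 -normr_le0.
apply: (@ler_inv_nat_from _ _ _ (r * s * expR (r * s) * expR (r * s)) 0).
  by rewrite !mulr_ge0 // expR_ge0.
move=> N N0; rewrite add0r; pose h := s / N%:R.
have N0' : 0 < N%:R :> R by rewrite ltr0n.
have h0 : 0 <= h by rewrite divr_ge0.
have Nh : N%:R * h = s by rewrite /h mulrC divfK // gt_eqF.
have ind (j : nat) : (j <= N)%N ->
  `|g t (j%:R * h) - g s (j%:R * h)| <= (expR (r * h) - 1) * expR (r * (j%:R * h)) * mt n (j%:R * h) y.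
  elim: j => [_|j ih jN].
    have E u : expR (r * u) * (expR (- crate y * u) * pr (jle n 0 `&` site_at n y)) =
        pr (jle n 0 `&` site_at n y).
      by rewrite mulrA -expRD mulNr subrr expR0 mul1r.
    rewrite mul0r /g !start_cell // !E subrr normr0 !mulr_ge0 ?expR_ge0 ?pr_ge0 //.
    by rewrite subr_ge0 -expR0 ler_expR mulr_ge0.
  have := ih (ltnW jN); set a := j%:R * h; have -> : j.+1%:R * h = a + h by rewrite /a -natr1; ring.
  have a0 : 0 <= a by rewrite mulr_ge0.
  have ahs : a + h <= s.
    by rewrite -Nh (_ : a + h = j.+1%:R * h) ?ler_wpM2r ?ler_nat // /a -natr1; ring.
  have aah : a <= a + h by lra.
  move=> IH.
  have inc u : a + h <= u -> expR (r * a) * (mt n (a + h) y - mt n a y) <= g u (a + h) - g u a <=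
      expR (r * (a + h)) * (mt n (a + h) y - mt n a y).
    move=> ahu; have /andP[c1 c2] := cell_bounds n y a0 aah ahu.
    have -> : g u (a + h) - g u a =
        expR (r * u) * pr ((jle n (a + h) `\` jle n a) `&` jgt n.+1 u `&` site_at n y).
      by rewrite /g (jle_split n y aah (mgt n.+1 u)) mulrDr addrAC subrr add0r.
    rewrite jle_diff // in c1 c2.
    have e1 : expR (r * a) = expR (r * u) * expR (- crate y * (u - a)).
      by rewrite -expRD; congr expR; rewrite -/r; ring.
    have e2 : expR (r * (a + h)) = expR (r * u) * expR (- crate y * (u - (a + h))).
      by rewrite -expRD; congr expR; rewrite -/r; ring.
    by rewrite e1 e2 -!mulrA !ler_wpM2l ?expR_ge0.
  have /andP[i1 i2] := inc t (le_trans ahs st); have /andP[i3 i4] := inc s ahs.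
  have D0 : 0 <= mt n (a + h) y - mt n a y by have := mt_incr n y aah; lra.
  have m0 : 0 <= mt n a y by exact: pr_ge0.
  have E : expR (r * (a + h)) = expR (r * h) * expR (r * a) by rewrite -expRD; congr expR; ring.
  have H1 : 1 <= expR (r * h) by rewrite -expR0 ler_expR mulr_ge0.
  have Ea : 0 < expR (r * a) by exact: expR_gt0.
  move: i2 i4; rewrite E; set p := expR (r * h) in H1 IH *; set v := expR (r * a) in Ea i1 i3 IH *.
  set D := mt n (a + h) y - mt n a y in D0 i1 i3 * => i2 i4.
  have -> : mt n (a + h) y = mt n a y + D by rewrite /D; ring.
  have v0 : 0 <= (p - 1) * v * mt n a y by rewrite !mulr_ge0 ?(ltW Ea) ?subr_ge0.
  have j1 : (p - 1) * v * D <= (p - 1) * (p * v) * D.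
    rewrite ler_wpM2r // ler_wpM2l //; first by lra.
    by rewrite ler_peMl // ltW.
  have j2 : (p - 1) * v * mt n a y <= (p - 1) * (p * v) * mt n a y.
    rewrite ler_wpM2r // ler_wpM2l //; first by lra.
    by rewrite ler_peMl // ltW.
  have K : `|(g t (a + h) - g t a) - (g s (a + h) - g s a)| <= (p - 1) * v * D.
    rewrite ler_norml; apply/andP; split; lra.
  have := ler_normD ((g t (a + h) - g t a) - (g s (a + h) - g s a)) (g t a - g s a).
  have -> : g t (a + h) - g t a - (g s (a + h) - g s a) + (g t a - g s a) = g t (a + h) - g s (a + h) by ring.
  lra.
have := ind N (leqnn N); rewrite Nh => /le_trans; apply.
have m1 : mt n s y <= 1 by apply: pr_le1; exact: measurableI.
have m0 : 0 <= mt n s y by exact: pr_ge0.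
have hs : h <= s by rewrite /h ler_pdivrMr // ler_peMr // ler1n.
have e1 : expR (r * h) - 1 <= r * h * expR (r * s).
  have := expR_ge1Dx (- (r * h)); rewrite expRN.
  have q0 := expR_gt0 (r * h); have q1 : expR (r * h) <= expR (r * s) by rewrite ler_expR ler_wpM2l.
  move=> q2; have : expR (r * h) * (1 - r * h) <= 1.
    by rewrite mulrC -ler_pdivlMr // mul1r.
  have : r * h * expR (r * h) <= r * h * expR (r * s) by rewrite ler_wpM2l // mulr_ge0.
  lra.
have e0 : 0 <= expR (r * h) - 1 by rewrite subr_ge0 -expR0 ler_expR mulr_ge0.
have -> : r * s * expR (r * s) * expR (r * s) / N%:R = r * h * expR (r * s) * expR (r * s) * 1.
  by rewrite /h; ring.
apply: ler_pM => //; first by rewrite mulr_ge0 // expR_ge0.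
by rewrite ler_wpM2r ?expR_ge0.
Qed.

(** Those present at [t] either arrived by [s] and survived, which is [memoryless], or arrived in
    []s, t]], where [cell_bounds] leaves an error of [crate y (t - s)] times the mass. *)
Lemma kt_renewal n y s t : 0 <= s -> s <= t ->
  `|kt n t y - expR (- crate y * (t - s)) * kt n s y - (mt n t y - mt n s y)|
  <= crate y * (t - s) * (mt n t y - mt n s y).
Proof.
move=> s0 st; rewrite -memoryless // /kt (jle_split n y st (mgt n.+1 t)).
rewrite [X in `|X - _|]addrAC subrr add0r.
have /andP[c1 c2] := cell_bounds n y s0 st (lexx t).
move: c1 c2; rewrite jle_diff // subrr mulr0 expR0 mul1r => c1 c2.
have D0 : 0 <= mt n t y - mt n s y by have := mt_incr n y st; lra.
have := expR_ge1Dx (- crate y * (t - s)) => h.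
have : (1 + - crate y * (t - s)) * (mt n t y - mt n s y) <= expR (- crate y * (t - s)) * (mt n t y - mt n s y).
  by rewrite ler_wpM2r.
have : 0 <= crate y * (t - s) * (mt n t y - mt n s y).
  by apply: mulr_ge0 => //; apply: mulr_ge0; [exact: crate_ge0 hw _|lra].
by rewrite ler_norml => ? ?; apply/andP; split; lra.
Qed.

Lemma kt_bounds n t y : 0 <= kt n t y <= 1.
Proof. by rewrite pr_ge0 pr_le1 //; do 2!apply: measurableI => //. Qed.

(** Given the current site, the next one is independent of the holding times. So a departure from
    [v] by time [t], of probability [mt - kt], leads to [y] with probability [w y v / crate v]. *)
Lemma mtS n t y : mt n.+1 t y = \sum_(v <- nbr y) w y v / crate v * (mt n t v - kt n t v).
Proof.
have sE := jle_sigma n.+1 t.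
have hj v : pr (jle n.+1 t `&` site_at n.+1 y `&` site_at n v) =
    w y v / crate v * (mt n t v - kt n t v).
  rewrite (site_jump hw hC x0 v y sE) (_ : w v y = w y v); last by case: hw => -[].
  congr (_ * _); rewrite /mt /kt.
  rewrite (prDI P (measurableI _ _ (mle n t) (mY n v)) (mgt n.+1 t)).
  rewrite (_ : jle n t `&` jgt n.+1 t `&` site_at n v = jle n t `&` site_at n v `&` jgt n.+1 t).
    rewrite addrK; congr pr; apply/seteqP; split => om.
      move=> [h1 h2]; split; last by move: h1; rewrite /jle /jgt /= ltNge => ->.
      split => //; move: h1; rewrite /jle /= jump_timeS; have := holding_ge0 n om; lra.
    by move=> [[h1 h2]]; rewrite jgtE /= not_notE.
  by rewrite setIAC.
rewrite /mt.
under eq_bigr => v _ do rewrite -hj.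
rewrite (pr_seq_fiber P (f := @site _ _ _ _ X n)) ?fset_uniq //; first last.
- exact: measurableI.
- by move=> v; exact: measurable_site.
rewrite -[RHS]mul1r; apply: (pr_fiber (f := @site _ _ _ _ X n)) => //.
- by move=> v; exact: measurable_site.
- exact: measurableI.
- apply: measurableI; first exact: measurableI.
  by apply: measurable_preim => v; exact: measurable_site.
move=> v; rewrite mul1r.
have [vn|vn] := boolP (v \in nbr y).
  congr pr; apply/seteqP; split => [om [h1 h2]|om [[h1 h2] h3]]; split => //.
  by split => //=; rewrite h2.
rewrite (hj v) (_ : w y v = 0); last first.
  by case: hw => -[_ _ h] _ _; apply: h; rewrite -(in_nbr (R := R)).
rewrite !mul0r; symmetry; rewrite (_ : _ `&` _ = set0) ?pr0 //.
by apply/seteqP; split => // om [[_ /= h1] /= h2]; rewrite h2 (negbTE vn) in h1.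
Qed.

Lemma mt0 t y : 0 <= t -> mt 0 t y = (y == x0)%:R.
Proof.
move=> t0; have := path_prob hw hC X x0 (fun=> y) 0.
rewrite /path_wt big_ord0 mulr1 => <-; congr pr; apply/seteqP; split => om.
  by move=> [_ h] i; rewrite leqn0 => /eqP ->.
move=> h; split; last exact: h.
by rewrite /jle /= /jump_time big_ord0.
Qed.

Definition mu_t n t y := if n is n'.+1 then \sum_(v <- nbr y) w y v * kt n' t v else 0.

(** Once [mt n] is differentiable, the renewal relation differentiates [kt n]; in the derivative of
    [mtS] the two terms [mu_t n] then cancel and leave the flow [w y v * kt n]. *)
Lemma mt_uderiv n S y : ucont S (fun t => mu_t n t y) /\
  uderiv S (fun t => mt n t y) (fun t => mu_t n t y).
Proof.
elim: n S y => [|n ih] S y.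
  split; first exact: ucont_cst.
  by apply: eq_uderiv (uderiv_cst S (y == x0)%:R) => // t t0 _; rewrite mt0.
have dk v : uderiv S (fun t => kt n t v) (fun t => mu_t n t v - crate v * kt n t v).
  have [cm dm] := ih S v; apply: (renewal_uderiv (crate_ge0 hw v) cm dm) => [t _ _|s t s0 st _].
    exact: kt_bounds.
  exact: kt_renewal.
have ck v : ucont S (fun t => kt n t v).
  have [cm _] := ih S v; have [B B0 hB] := ucont_bounded cm.
  apply: (@ucont_lip _ _ _ (B + crate v)) => s t s0 st tS.
  apply: (uderiv_lip (dk v) s0 st tS) => u su ut.
  have /andP[k0 k1] := kt_bounds n u v.
  apply: le_trans (ler_normB _ _) _; apply: lerD; first by apply: hB; lra.
  by rewrite normrM !ger0_norm ?(crate_ge0 hw) // ler_piMr // (crate_ge0 hw).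
split; first by apply: ucont_sum => v; exact: ucontZ.
apply: eq_uderiv (_ : uderiv S (fun t => \sum_(v <- nbr y) w y v / crate v * (mt n t v - kt n t v))
  (fun t => \sum_(v <- nbr y) w y v / crate v * (mu_t n t v - (mu_t n t v - crate v * kt n t v)))).
- by move=> t _ _; rewrite mtS.
- move=> t _ _; apply: eq_bigr => v _; have := crate_gt0 hw hC v => c0.
  by field; rewrite gt_eqF.
- by apply: uderiv_sum => v; apply: uderivZ; apply: uderivB => //; have [] := ih S v.
Qed.

Lemma kt_uderiv n S y : uderiv S (fun t => kt n t y) (fun t => mu_t n t y - crate y * kt n t y).
Proof.
have [cm dm] := mt_uderiv n S y; apply: (renewal_uderiv (crate_ge0 hw y) cm dm) => [t _ _|s t s0 st _].
  exact: kt_bounds.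
exact: kt_renewal.
Qed.

Lemma kt_ucont n S y : ucont S (fun t => kt n t y).
Proof.
have [cm _] := mt_uderiv n S y; have [B B0 hB] := ucont_bounded cm.
apply: (@ucont_lip _ _ _ (B + crate y)) => s t s0 st tS.
apply: (uderiv_lip (kt_uderiv n S y) s0 st tS) => u su ut.
have /andP[k0 k1] := kt_bounds n u y.
apply: le_trans (ler_normB _ _) _; apply: lerD; first by apply: hB; lra.
by rewrite normrM !ger0_norm ?(crate_ge0 hw) // ler_piMr // (crate_ge0 hw).
Qed.

Lemma kt_start n y : kt n 0 y = mt n 0 y.
Proof. by rewrite /kt start_cell // mulr0 expR0 mul1r. Qed.

Lemma kt0 n y : kt n.+1 0 y = 0.
Proof.
rewrite kt_start mtS big1 // => v _; by rewrite kt_start subrr mulr0.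
Qed.

(** Summing the equations of [kt n] over [n] shifts the inflow by one level, which is the recursion
    of [picard]; uniqueness for the scalar linear equation concludes. *)
Lemma picard_walk N t y : 0 <= t -> \sum_(n < N) kt n t y = picard omega x0 N t y.
Proof.
elim: N t y => [|N ih] t y t0; first by rewrite big_ord0.
have cs : ucont t (fun t => \sum_(n < N.+1) kt n t y) by apply: ucont_sum => n; exact: kt_ucont.
have ds := @uderiv_sum _ t _ (index_enum 'I_N.+1) (fun n t => kt n t y) _ (fun n => kt_uderiv n t y).
apply: (linear_ode_unique cs (ucont_picard omega t x0 N.+1 y) _ (uderiv_picard omega t x0 N y) _ t0 (lexx t)).
  apply: eq_uderiv ds => // s s0 _; rewrite sumrB big_ord_recl /= add0r addrC mulNr -mulr_sumr.
  congr (_ + _); rewrite exchange_big /=; apply: eq_bigr => v _.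
  by rewrite -ih // mulr_sumr.
rewrite big_ord_recl big1 ?addr0; last by move=> i _; exact: kt0.
by rewrite kt_start mt0 // picard0 eq_sym.
Qed.

Definition at_jump (t : R) (y : C) (n : nat) : set T := jle n t `&` jgt n.+1 t `&` site_at n y.

Lemma jump_time_le (n m : nat) (om : T) : (n <= m)%N -> jump_time n om <= jump_time m om.
Proof.
move=> /subnK <-; elim: (m - n)%N => [|k ih]; first by rewrite add0n.
by rewrite addSn jump_timeS; have := holding_ge0 (k + n) om; lra.
Qed.

Lemma jump_time_explosion n (om : T) : ((jump_time n om)%:E <= explosion_time om)%E.
Proof.
rewrite /explosion_time /jump_time -sumEFin.
have := @nneseries_lim_ge R (fun k => (holding k om)%:E) xpredT 0 n.
rewrite big_mkord; apply => k _ _; by rewrite lee_fin holding_ge0.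
Qed.

Lemma walk_at_jumps t y :
  walk_at t y `&` [set om : T | (t%:E < explosion_time om)%E] = \bigcup_n at_jump t y n.
Proof.
apply/seteqP; split => [om [[n /andP[h1 h2] h3] _]|om [n _ [[h1 h2] h3]]].
  by exists n.
split; first by exists n => //; apply/andP.
by apply: lt_le_trans (jump_time_explosion n.+1 om); rewrite lte_fin.
Qed.

Lemma measurable_at_jump t y n : measurable (at_jump t y n).
Proof. by do 2!apply: measurableI => //. Qed.

Lemma heat_kernel_heat t y : 0 <= t -> heat_kernel X t x0 y = heat omega x0 t y.
Proof.
move=> t0; rewrite /heat_kernel -/(pr _) walk_at_jumps.
pose F N := \bigcup_(n in [set n | (n < N)%N]) at_jump t y n.
have mF N : measurable (F N).
  by apply: bigcup_measurable => n _; exact: measurable_at_jump.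
have FE N : pr (F N) = \sum_(n < N) kt n t y.
  elim: N => [|N ih].
    by rewrite big_ord0 -(pr0 P); congr pr; apply/seteqP; split => // om [].
  rewrite big_ord_recr /= -ih -prU //.
  - congr pr; apply/seteqP; split => [om [n /= nN h]|om [[n /= nN h]|h]].
    + by move: nN; rewrite ltnS leq_eqVlt => /predU1P[<-|nN]; [right|left; exists n].
    + by exists n => //=; exact: ltnW.
    + by exists N => //=.
  - exact: measurable_at_jump.
  - apply/seteqP; split => // om [[n /= nN [[_ h1] _]] [[h2 _] _]].
    have := jump_time_le om nN; move: h1 h2; rewrite /jgt /jle /=; lra.
have c1 : pr (F N) @[N --> \oo] --> pr (\bigcup_n at_jump t y n).
  have -> : \bigcup_n at_jump t y n = \bigcup_N F N.
    apply/seteqP; split => [om [n _ h]|om [N _ [n _ h]]]; last by exists n.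
    by exists n.+1 => //; exists n => //=.
  by apply: pr_cvg => // N om [n /= nN h]; exists n => //=; exact: ltnW.
have E : (fun N => pr (F N)) = (fun N => picard omega x0 N t y).
  by apply/funext => N; rewrite FE picard_walk.
rewrite E in c1; apply: (cvg_unique _ c1); last exact: (picard_cvg hw).
exact: norm_hausdorff.
Qed.

(** Being at some site at time [n] forces the explosion time beyond [n]. These events are disjoint
    for different sites, and their probabilities add up to the full mass of [heat]. *)
Lemma non_explosion : P [set om : T | explosion_time om = +oo%E] = 1%E.
Proof.
have mex : measurable_fun [set: T] (@explosion_time _ _ _ _ X).
  apply: (@ge0_emeasurable_sum _ T R setT (fun k om => (holding k om)%:E) xpredT) => [k om _ _|k _].
    by rewrite lee_fin holding_ge0.
  by apply/measurable_EFinP; exact: measurable_holding.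
pose G (n : nat) : set T := [set om | (n%:R%:E < explosion_time om)%E].
have mG n : measurable (G n).
  rewrite -[G n]setTI; exact: emeasurable_fun_o_infty.
have G1 n : pr (G n) = 1.
  have n0 : 0 <= n%:R :> R by [].
  have [B [n0' [B0 hB]]] := heat_mass_box hw x0 n0.
  apply: le_anti; rewrite pr_le1 //=.
  apply: (@ler_inv_nat_from _ _ _ B n0') => // m m0.
  have := hB m m0; have := ler_norm (1 - \sum_(y <- box (R := R) C m) heat omega x0 n%:R y).
  suff : \sum_(y <- box (R := R) C m) heat omega x0 n%:R y <= pr (G n) by lra.
  under eq_bigr => y _ do rewrite -heat_kernel_heat // /heat_kernel -/(pr _) walk_at_jumps.
  pose H y := \bigcup_k at_jump n%:R y k.
  have mH y : measurable (H y) by apply: bigcup_measurable => k _; exact: measurable_at_jump.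
  have Hsum (s : seq C) : uniq s -> \sum_(y <- s) pr (H y) = pr (\big[setU/set0]_(y <- s) H y).
    elim: s => [|y s ih] /=; first by rewrite !big_nil pr0.
    move=> /andP[ys us]; rewrite !big_cons ih // prU //.
      by apply: bigsetU_measurable => v _.
    apply/seteqP; split => // om [[k _ [[h1 h2] h3]]].
    rewrite -bigcup_seq => -[v /= vs [k' _ [[h1' h2'] h3']]].
    have kk : k = k'.
      apply/eqP; rewrite eqn_leq; apply/andP; split; rewrite leqNgt; apply/negP => lt.
        have := jump_time_le om lt; move: h1 h2'; rewrite /jle /jgt /=; lra.
      have := jump_time_le om lt; move: h1' h2; rewrite /jle /jgt /=; lra.
    by move: ys; rewrite -h3 kk h3' vs.
  rewrite Hsum ?fset_uniq //; apply: pr_le => //; first by apply: bigsetU_measurable => v _.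
  rewrite -bigcup_seq => om [v _ [k _ [[_ h2] _]]].
  by apply: lt_le_trans (jump_time_explosion k.+1 om); rewrite lte_fin.
have -> : [set om : T | explosion_time om = +oo%E] = ~` \bigcup_n ~` G n.
  rewrite setC_bigcup; apply/seteqP; split => [om /= h n _ /=|om h /=].
    by move=> Gn; apply: Gn; rewrite /G /= h ltry.
  have h' n : G n om by apply: contrapT; exact: h.
  case E : (explosion_time om) => [r| |] //.
    have [n nr] := exists_nat_gt r; have := h' n.+1; rewrite /G /= E lte_fin.
    by move=> h2; have := lt_trans nr h2; rewrite ltxx.
  by have := h' 0%N; rewrite /G /= E.
have mU : measurable (\bigcup_n ~` G n) by apply: bigcup_measurable => n _; exact: measurableC.
have nG n : P (~` G n) = 0%E.
  rewrite prE; last exact: measurableC.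
  have := prDI P (@measurableT _ T) (mG n); rewrite setTD setTI prT G1; set a := pr _ => h.
  by congr EFin; lra.
have h0 : P (\bigcup_n ~` G n) = 0%E.
  apply/negligibleP => //; apply: negligible_bigcup => n.
  by exists (~` G n); split => //; [exact: measurableC|exact: nG].
rewrite probability_setC // h0 sube0 //.
Qed.

End JumpTimes.

(** * Brownian paths *)

Section MeanBounds.
Context {R : realType} {dT : measure_display} {T : measurableType dT} (P : probability T R).
Implicit Types (f g : T -> R) (c k : R).

(** Bundled so that bounds on expectations can be added, scaled and passed to limits without
    separate side conditions. *)
Definition mean_le f c := [/\ measurable_fun [set: T] f, forall w, 0 <= f w &
  (\int[P]_w (f w)%:E <= c%:E)%E].

Lemma mean_le_trans f c c' : c <= c' -> mean_le f c -> mean_le f c'.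
Proof. by move=> cc [mf f0 h]; split => //; apply: le_trans h _; rewrite lee_fin. Qed.

Lemma mean_leD f g c c' : mean_le f c -> mean_le g c' -> mean_le (fun w => f w + g w) (c + c').
Proof.
move=> [mf f0 hf] [mg g0 hg]; split; first exact: measurable_funD.
  by move=> w; rewrite addr_ge0.
under eq_integral do rewrite EFinD.
rewrite ge0_integralD //; [by rewrite EFinD leeD| | | |] => *; rewrite ?lee_fin //; exact/measurable_EFinP.
Qed.

Lemma mean_leZ f c k : 0 <= k -> mean_le f c -> mean_le (fun w => k * f w) (k * c).
Proof.
move=> k0 [mf f0 hf]; split; first exact: measurable_funM.
  by move=> w; rewrite mulr_ge0.
under eq_integral do rewrite EFinM.
rewrite ge0_integralZl //; [by rewrite EFinM lee_wpmul2l|exact/measurable_EFinP|] => *; exact: f0.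
Qed.

Lemma mean_le0 : mean_le (fun=> 0) 0.
Proof. by split => //; rewrite integral0. Qed.

Lemma mean_le_sum (I : Type) (s : seq I) (F : I -> T -> R) (c : I -> R) :
  (forall i, mean_le (F i) (c i)) -> mean_le (fun w => \sum_(i <- s) F i w) (\sum_(i <- s) c i).
Proof.
move=> h; elim: s => [|i s ih].
  rewrite big_nil (_ : (fun w => _) = fun=> 0); first exact: mean_le0.
  by apply/funext => w; rewrite big_nil.
rewrite big_cons (_ : (fun w => _) = fun w => F i w + \sum_(i <- s) F i w); first exact: mean_leD.
by apply/funext => w; rewrite big_cons.
Qed.

Lemma mean_le_ae f g c : measurable_fun [set: T] f -> (forall w, 0 <= f w) ->
  {ae P, forall w, f w <= g w} -> mean_le g c -> mean_le f c.
Proof.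
move=> mf f0 fg [mg g0 hg]; split => //; apply: le_trans hg.
apply: ae_ge0_le_integral => //.
- by move=> w _; rewrite lee_fin.
- exact/measurable_EFinP.
- by move=> w _; rewrite lee_fin.
- exact/measurable_EFinP.
- by apply: filterS fg => w h _; rewrite lee_fin.
Qed.

Lemma mean_le_mono f g c : measurable_fun [set: T] f -> (forall w, 0 <= f w <= g w) ->
  mean_le g c -> mean_le f c.
Proof.
move=> mf h; apply: mean_le_ae => //; first by move=> w; have /andP[] := h w.
by apply/aeW => w; have /andP[] := h w.
Qed.

Lemma mean_le_lim (F : nat -> T -> R) g c : (forall n, mean_le (F n) c) ->
  measurable_fun [set: T] g -> (forall w, 0 <= g w) ->
  {ae P, forall w, F n w @[n --> \oo] --> g w} -> mean_le g c.
Proof.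
move=> hF mg g0 h; split => //.
have mF n : measurable_fun [set: T] (EFin \o F n) by have [/measurable_EFinP] := hF n.
have F0 n w : (0 <= (EFin \o F n) w)%E by rewrite lee_fin; have [_ ->] := hF n.
have hl : (\int[P]_w limn_einf (fun n => (EFin \o F n) w) <= c%:E)%E.
  apply: le_trans (fatou P measurableT mF (fun n w _ => F0 n w)) _.
  rewrite limn_einf_lim; apply: lime_le; first exact: is_cvg_einfs.
  apply: nearW => n; apply: le_trans (_ : _ <= \int[P]_w (EFin \o F n) w)%E _; last by have [] := hF n.
  by apply: ereal_inf_lbound; exists n => /=.
apply: le_trans hl; apply: ae_ge0_le_integral => //.
- by move=> w _; rewrite lee_fin.
- exact/measurable_EFinP.
- by move=> w _; rewrite limn_einf_lim; apply: lime_ge; [exact: is_cvg_einfs|];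
    apply: nearW => n; apply: le_ereal_inf_tmp => _ [m _ <-]; exact: F0.
- under eq_fun do rewrite -(oppeK (limn_einf _)) -limn_esupN.
  apply: measurableT_comp => //; apply: measurable_fun_limn_esup => n.
  exact: measurableT_comp.
- apply: filterS h => w h _.
  have h' : (EFin \o F n) w @[n --> \oo] --> (g w)%:E by apply/cvg_EFin; [exact: nearW|exact: h].
  by have [-> _] := cvg_limn_einf_sup h'.
Qed.

(** By monotone convergence the supremum has finite mean, hence is finite almost surely. *)
Lemma mean_le_bounded (S : nat -> T -> R) c : (forall n, mean_le (S n) c) ->
  (forall n w, S n w <= S n.+1 w) -> {ae P, forall w, exists M, forall n, S n w <= M}.
Proof.
move=> hS nS.
have mS n : measurable_fun [set: T] (EFin \o S n) by have [/measurable_EFinP] := hS n.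
have S0 n w : (0 <= (EFin \o S n) w)%E by rewrite lee_fin; have [_ ->] := hS n.
have ndS w : nondecreasing_seq (fun n => (EFin \o S n) w).
  by apply/nondecreasing_seqP => n; rewrite lee_fin.
pose f w := limn (fun n => (EFin \o S n) w).
have fub n w : ((S n w)%:E <= f w)%E.
  apply: lime_ge; first exact: ereal_nondecreasing_is_cvgn.
  by exists n => // m /= nm; exact: ndS.
have fint : P.-integrable [set: T] f.
  apply/integrableP; split.
    apply: (emeasurable_fun_cvg (fun n => EFin \o S n)) => // w _.
    exact: ereal_nondecreasing_is_cvgn.
  under eq_integral do rewrite gee0_abs ?(le_trans (S0 0%N _) (fub _ _)) //.
  rewrite monotone_convergence //.
  apply: le_lt_trans (ltry c); apply: lime_le.
    by apply: ereal_nondecreasing_is_cvgn => m n mn; apply: ge0_le_integral => // w _; exact: ndS.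
  by apply: nearW => n; have [] := hS n.
have := integrable_ae measurableT fint; apply: filterS => w /(_ I) fw.
by exists (fine (f w)) => n; rewrite -lee_fin fineK.
Qed.

End MeanBounds.

Section LimitVariable.
Context {R : realType} {dT : measure_display} {T : measurableType dT}.

(** An upper limit exists at every [w], so the result is measurable for any sigma-algebra that makes
    all [F n] measurable; no null set has to be added to the filtration. *)
Definition lim_rv (F : nat -> T -> R) (w : T) : R := fine (limn_esup (fun n => (F n w)%:E)).

Lemma measurable_lim_rv F : (forall n, measurable_fun [set: T] (F n)) ->
  measurable_fun [set: T] (lim_rv F).
Proof.
move=> mF; apply: measurableT_comp; first exact: fine_measurable.
by apply: measurable_fun_limn_esup => n; exact/measurable_EFinP.
Qed.

Lemma lim_rvE F w a : F n w @[n --> \oo] --> a -> lim_rv F w = a.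
Proof.
move=> h; rewrite /lim_rv.
have h' : (F n w)%:E @[n --> \oo] --> a%:E by apply/cvg_EFin; [exact: nearW|exact: h].
by have [_ ->] := cvg_limn_einf_sup h'.
Qed.

End LimitVariable.

Lemma ler_sqrW {R : realType} (a b : R) : 0 <= b -> a ^+ 2 <= b ^+ 2 -> a <= b.
Proof.
move=> b0 h; have [a0|a0] := leP 0 a; last by lra.
by rewrite -(ler_pXn2r (n := 2)) // nnegrE.
Qed.

(** Weighted Cauchy-Schwarz. With summable weights [a] it plays the part of the triangle inequality
    in [L^2]. *)
Lemma sum_sqr_le {R : realType} (I : Type) (s : seq I) (a D : I -> R) : (forall i, 0 < a i) ->
  (\sum_(i <- s) D i) ^+ 2 <= (\sum_(i <- s) a i) * (\sum_(i <- s) (a i)^-1 * D i ^+ 2).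
Proof.
move=> a0; elim: s => [|i s ih]; first by rewrite !big_nil mul0r expr0n.
rewrite !big_cons; move: ih.
set S := \sum_(j <- s) D j; set Q := \sum_(j <- s) (a j)^-1 * _; set A := \sum_(j <- s) a j.
move=> ih.
have A0 : 0 <= A by apply: sumr_ge0 => j _; exact: ltW.
have Q0 : 0 <= Q by apply: sumr_ge0 => j _; rewrite mulr_ge0 ?sqr_ge0 // invr_ge0 ltW.
have ai := a0 i; set X := D i; set al := a i in ai *.
have e : al * (al^-1 * X ^+ 2) = X ^+ 2 by rewrite mulrA divff ?mul1r // gt_eqF.
set Y := al^-1 * X ^+ 2 in e *.
have Y0 : 0 <= Y by rewrite mulr_ge0 ?sqr_ge0 // invr_ge0 ltW.
suff : 2 * X * S <= al * Q + A * Y by rewrite !expr2 in e *; lra.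
apply: ler_sqrW; first by rewrite addr_ge0 // mulr_ge0 // ltW.
have : S ^+ 2 * X ^+ 2 <= (A * Q) * (al * Y) by rewrite e ler_wpM2r ?sqr_ge0.
have := sqr_ge0 (al * Q - A * Y); rewrite !expr2; lra.
Qed.

(** * Gaussian moments *)

Section NormalMoments.
Context {R : realType}.
Local Notation mu := (@lebesgue_measure R).
Import HBNNSimple.
Implicit Types (f h : R -> R).

Lemma normal_prob_nnsfun (sg : R) (f : {nnsfun R >-> R}) :
  (\int[normal_prob 0 sg]_x (f x)%:E = \int[mu]_x ((f x)%:E * (normal_pdf 0 sg x)%:E))%E.
Proof.
have mp : measurable_fun setT (fun x => (normal_pdf 0 sg x)%:E).
  by apply/measurable_EFinP; exact: measurable_normal_pdf.
have p0 x : (0 <= (normal_pdf 0 sg x)%:E)%E by rewrite lee_fin normal_pdf_ge0.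
have mf r : measurable (f @^-1` [set r]) by exact: measurable_funPTI.
have mi r : measurable_fun setT (fun x => \1_(f @^-1` [set r]) x : R) by exact: measurable_indic.
have mri r : measurable_fun setT (fun x => (r * \1_(f @^-1` [set r]) x)%:E).
  by apply/measurable_EFinP; apply: measurable_funM.
under [LHS]eq_integral do rewrite fimfunE -fsumEFin//.
rewrite [LHS]ge0_integral_fsum//; last by move=> n x _; rewrite EFinM nnfun_muleindic_ge0.
under [RHS]eq_integral.
  move=> x xD; rewrite fimfunE -fsumEFin// ge0_mule_fsuml; last first.
    by move=> r; rewrite EFinM nnfun_muleindic_ge0.
  over.
rewrite [RHS]ge0_integral_fsum//; last 2 first.
  - by move=> r; apply: emeasurable_funM => //; exact: mri.
  - by move=> n x _; rewrite EFinM mule_ge0// nnfun_muleindic_ge0.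
apply: eq_fsbigr => r _.
under [RHS]eq_integral do rewrite EFinM -muleA.
have [r0|r0] := leP 0 r; last first.
  have -> : f @^-1` [set r] = set0.
    by apply/seteqP; split => // x /= fx; have fx0 : 0 <= f x := fun_ge0 x; move: fx0; rewrite fx leNgt r0.
  rewrite !integral0_eq // => x _; rewrite indic0 ?mulr0 ?mul0e ?mule0 //.
rewrite [RHS]ge0_integralZl //; last 2 first.
  - by apply: emeasurable_funM; [apply/measurable_EFinP; exact: (mi r)|exact: mp].
  - by move=> x _; rewrite mule_ge0 // lee_fin.
under [LHS]eq_integral do rewrite EFinM.
rewrite [LHS]ge0_integralZl //; last by apply/measurable_EFinP; exact: (mi r).
congr (_ * _)%E; rewrite integral_indic /=; last exact: (mf r).
rewrite setIT /normal_prob integral_mkcond.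
apply: eq_integral => x _; rewrite patchE indicE; case: ifP => _; by rewrite ?mul1e ?mul0e.
exact: measurableT.
Qed.

(** The dominating Gaussian density has total mass one, so a pointwise comparison of densities
    bounds a moment without computing an integral. *)
Lemma normal_prob_mean_le (sg sg' c : R) h : measurable_fun setT h -> (forall x, 0 <= h x) ->
  0 <= c -> (forall x, h x * normal_pdf 0 sg x <= c * normal_pdf 0 sg' x) ->
  (\int[normal_prob 0 sg]_x (h x)%:E <= c%:E)%E.
Proof.
move=> mh h0 c0 hc.
have mh' : measurable_fun setT (EFin \o h) by exact/measurable_EFinP.
pose f := nnsfun_approx measurableT mh'.
have mf n : measurable_fun setT (fun x => (f n x)%:E : \bar R).
  by apply/measurable_EFinP; exact: measurable_funP.
have nd x m n : (m <= n)%N -> f m x <= f n x.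
  by move=> mn; have /lefP := nd_nnsfun_approx measurableT mh' mn; apply.
have fc x : (f n x)%:E @[n --> \oo] --> (h x)%:E.
  by apply: (cvg_nnsfun_approx measurableT mh') => // y _; rewrite lee_fin.
have fh n x : ((f n x)%:E <= (h x)%:E)%E.
  rewrite -(cvg_lim _ (fc x)) //; apply: lime_ge; first exact: cvgP (fc x).
  by exists n => // m nm; rewrite /= lee_fin; exact: nd.
have -> : (\int[normal_prob 0 sg]_x (h x)%:E)%E = lim (\int[normal_prob 0 sg]_x (f n x)%:E @[n --> \oo])%E.
  rewrite -monotone_convergence//=.
  - apply: eq_integral => x _; apply/esym/cvg_lim => //=.
  - by move=> n x _; rewrite lee_fin.
  - by move=> x _ m n mn; rewrite lee_fin; exact: nd.
apply: lime_le.
  apply: ereal_nondecreasing_is_cvgn => m n mn; apply: ge0_le_integral => //.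
  - by move=> x _; rewrite lee_fin.
  - exact: mf.
  - exact: mf.
  - by move=> x _; rewrite lee_fin; exact: nd.
apply: nearW => n; rewrite normal_prob_nnsfun.
have mp s : measurable_fun setT (fun x => (normal_pdf 0 s x)%:E : \bar R).
  by apply/measurable_EFinP; exact: measurable_normal_pdf.
have -> : c%:E = (\int[mu]_x (c%:E * (normal_pdf 0 sg' x)%:E))%E.
  rewrite ge0_integralZl; [|exact: measurableT|exact: mp| |by rewrite lee_fin].
    by rewrite integral_normal_pdf mule1.
  by move=> x _; rewrite lee_fin normal_pdf_ge0.
apply: ge0_le_integral.
- exact: measurableT.
- by move=> x _; rewrite mule_ge0 // lee_fin ?normal_pdf_ge0.
- by apply: emeasurable_funM; [exact: mf|exact: mp].
- by apply: emeasurable_funM; [exact: measurable_cst|exact: mp].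
- move=> x _; rewrite -!EFinM lee_fin; apply: le_trans (hc x).
  by apply: ler_wpM2r; [exact: normal_pdf_ge0|have := fh n x; rewrite lee_fin].
Qed.

Lemma normal_pdf_widen (sg x : R) : 0 < sg ->
  normal_pdf 0 sg x = 2 * expR (- (3 / 8 * (x ^+ 2 / sg ^+ 2))) * normal_pdf 0 (2 * sg) x.
Proof.
move=> s0; have s20 : 2 * sg != 0 by rewrite gt_eqF // mulr_gt0.
rewrite !normal_pdfE ?(gt_eqF s0) // /normal_peak /normal_fun subr0.
have -> : - x ^+ 2 / (sg ^+ 2 *+ 2) = - (3 / 8 * (x ^+ 2 / sg ^+ 2)) + (- x ^+ 2 / ((2 * sg) ^+ 2 *+ 2)).
  by field; rewrite gt_eqF.
rewrite expRD; have -> : (2 * sg) ^+ 2 * pi *+ 2 = 2 ^+ 2 * (sg ^+ 2 * pi *+ 2) by ring.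
rewrite sqrtrM ?sqrtr_sqr ?ger0_norm // invfM.
by field; rewrite sqrtr_eq0 -ltNge mulrn_wgt0 // mulr_gt0 ?pi_gt0 // exprn_gt0.
Qed.

(** With [y = x^2 / sg^2], widening leaves the factor [2 exp (- 3 y / 8)], and
    [(1 + 3 y / 16)^2 exp (- 3 y / 8) <= 1] bounds [y] and [y^2] times the exponential. The
    constants 6 and 64 round up [16 / 3] and [512 / 9]. *)
Lemma normal_moments (sg x : R) : 0 < sg ->
  x ^+ 2 * normal_pdf 0 sg x <= 6 * sg ^+ 2 * normal_pdf 0 (2 * sg) x /\
  x ^+ 4 * normal_pdf 0 sg x <= 64 * (sg ^+ 2) ^+ 2 * normal_pdf 0 (2 * sg) x.
Proof.
move=> s0; rewrite normal_pdf_widen //.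
have s20 : 0 < sg ^+ 2 by rewrite exprn_gt0.
pose y := x ^+ 2 / sg ^+ 2.
have y0 : 0 <= y by rewrite divr_ge0 ?sqr_ge0.
have xy : x ^+ 2 = y * sg ^+ 2 by rewrite /y divfK // gt_eqF.
have x4 : x ^+ 4 = y ^+ 2 * (sg ^+ 2) ^+ 2 by rewrite -exprMn -xy -exprM.
rewrite -/y x4 xy; set p := normal_pdf _ _ _; have p0 : 0 <= p by exact: normal_pdf_ge0.
set E := expR _; have E0 : 0 <= E by exact: expR_ge0.
have h1 : E * (1 + 3 / 16 * y) ^+ 2 <= 1.
  have e : E * expR (3 / 16 * y) ^+ 2 = 1.
    by rewrite /E [X in _ * X]expr2 -!expRD -[RHS]expR0; congr expR; field.
  rewrite -[leRHS]e ler_wpM2l //.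
  by apply: lerXn2r; rewrite ?nnegrE ?expR_ge0 ?expR_ge1Dx //; lra.
have h2 : 0 <= E * y by rewrite mulr_ge0.
have h3 : 0 <= E * y * y by rewrite mulr_ge0.
have {}h1 : E + 3 / 8 * (E * y) + 9 / 256 * (E * y * y) <= 1 by move: h1; rewrite expr2; lra.
split.
  have -> : y * sg ^+ 2 * (2 * E * p) = 2 * (E * y) * (sg ^+ 2 * p) by ring.
  rewrite -[leRHS]mulrA; apply: ler_wpM2r; first by rewrite mulr_ge0 // ltW.
  lra.
have -> : y ^+ 2 * (sg ^+ 2) ^+ 2 * (2 * E * p) = 2 * (E * y * y) * ((sg ^+ 2) ^+ 2 * p) by ring.
rewrite -[leRHS]mulrA; apply: ler_wpM2r; first by rewrite mulr_ge0 // sqr_ge0.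
lra.
Qed.

End NormalMoments.

Section BrownianMoments.
Context {R : realType} {dT : measure_display} {T : measurableType dT} (P : probability T R).
Context (b : R -> {RV P >-> R}) (hb : brownian_motion b).

Lemma measurable_increment s t : measurable_fun [set: T] (fun w => b t w - b s w).
Proof. exact: measurable_funB. Qed.

Lemma brownian_mean (h : R -> R) (sg' c s t : R) : measurable_fun setT h -> (forall x, 0 <= h x) ->
  0 <= c -> 0 <= s -> s < t ->
  (forall x, h x * normal_pdf 0 (Num.sqrt (t - s)) x <= c * normal_pdf 0 sg' x) ->
  mean_le P (fun w => h (b t w - b s w)) c.
Proof.
move=> mh h0 c0 s0 st hc; split => //; first exact: measurableT_comp (measurable_increment s t).
have [_ _ law _] := hb.
have mf : measurable_fun setT (EFin \o h) by exact/measurable_EFinP.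
have := normal_prob_mean_le mh h0 c0 hc.
have mD : measurable_fun [set: T] (fun w => b t w - b s w : measurableTypeR R).
  exact: measurable_increment.
pose D : {mfun T >-> measurableTypeR R} := HB.pack (fun w => b t w - b s w : measurableTypeR R)
  (isMeasurableFun.Build _ _ _ _ _ mD).
have -> : (\int[normal_prob 0 (Num.sqrt (t - s))]_x (h x)%:E = \int[pushforward P D]_x (h x)%:E)%E.
  by apply: eq_measure_integral => A mA _; exact: esym (law s t s0 st A mA).
by rewrite ge0_integral_pushforward // => x _; rewrite /= lee_fin.
Qed.

Lemma brownian_sq s t : 0 <= s -> s <= t ->
  mean_le P (fun w => (b t w - b s w) ^+ 2) (6 * (t - s)).
Proof.
move=> s0; rewrite le_eqVlt => /predU1P[<-|st].
  rewrite subrr mulr0 (_ : (fun w => _) = fun=> 0); first exact: mean_le0.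
  by apply/funext => w; rewrite subrr expr0n.
have s1 : 0 < Num.sqrt (t - s) by rewrite sqrtr_gt0 subr_gt0.
have s2 : Num.sqrt (t - s) ^+ 2 = t - s by rewrite sqr_sqrtr // subr_ge0 ltW.
have h x := (normal_moments x s1).1; rewrite s2 in h.
apply: (@brownian_mean (fun x => x ^+ 2) (2 * Num.sqrt (t - s))) => //.
- by move=> x; exact: sqr_ge0.
- lra.
Qed.

Lemma brownian_four s t : 0 <= s -> s <= t ->
  mean_le P (fun w => (b t w - b s w) ^+ 4) (64 * (t - s) ^+ 2).
Proof.
move=> s0; rewrite le_eqVlt => /predU1P[<-|st].
  rewrite subrr expr0n mulr0 (_ : (fun w => _) = fun=> 0); first exact: mean_le0.
  by apply/funext => w; rewrite subrr expr0n.
have s1 : 0 < Num.sqrt (t - s) by rewrite sqrtr_gt0 subr_gt0.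
have s2 : Num.sqrt (t - s) ^+ 2 = t - s by rewrite sqr_sqrtr // subr_ge0 ltW.
have h x := (normal_moments x s1).2; rewrite s2 in h.
apply: (@brownian_mean (fun x => x ^+ 4) (2 * Num.sqrt (t - s))) => //.
- by move=> x; rewrite (_ : 4%N = (2 * 2)%N) // exprM sqr_ge0.
- by rewrite mulr_ge0 // sqr_ge0.
Qed.

End BrownianMoments.

(** * Dyadic chaining *)

Section Chaining.
Context {R : realType}.
Implicit Types (b : R -> R) (S L r : R).

(** A point of level [m + 1] either is of level [m] or lies one step of level [m + 1] to the right
    of such a point, so the way to the origin costs one increment per level. *)
Lemma dyadic_chain b S L r : 0 <= L -> 0 <= r ->
  (forall m i, (i < 2 ^ m)%N -> `|b (S * (i.+1%:R / 2 ^+ m)) - b (S * (i%:R / 2 ^+ m))| <= L * r ^+ m) ->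
  forall m i, (i <= 2 ^ m)%N -> `|b (S * (i%:R / 2 ^+ m)) - b 0| <= L * \sum_(k < m.+1) r ^+ k.
Proof.
move=> L0 r0 H; elim=> [|m ih] i.
  rewrite expn0 big_ord_recr big_ord0 /= add0r => i1; have := H 0%N 0%N isT.
  rewrite !expr0 !divr1 !mulr1 mulr0; move: i1; case: i => [|[|//]] _ //.
    by rewrite mulr0 subrr normr0.
  by rewrite mulr1.
move=> im; rewrite big_ord_recr /= mulrDr.
have E j : (j.*2)%:R / 2 ^+ m.+1 = j%:R / 2 ^+ m :> R.
  by rewrite -muln2 natrM exprS invfM; field; rewrite expf_neq0.
have rm : 0 <= L * r ^+ m.+1 by rewrite mulr_ge0 // exprn_ge0.
have i2 := odd_double_half i; move: im; rewrite -i2 expnS mul2n.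
case: (odd i); rewrite ?add0n ?add1n => im; last first.
  by rewrite E; have := ih i./2; rewrite leq_double in im; move=> /(_ im); lra.
have im' : (i./2 < 2 ^ m)%N by rewrite -ltn_double (leq_trans _ im).
have := H m.+1 (i./2).*2; rewrite expnS mul2n ltn_double im' => /(_ isT).
rewrite E; have := ih i./2 (ltnW im').
set y := b (S * ((i./2)%:R / 2 ^+ m)); set x := b (S * _).
have := ler_normD (x - y) (y - b 0); rewrite addrA subrK; lra.
Qed.

Lemma geometric_le r m : 0 <= r -> r < 1 -> (\sum_(k < m) r ^+ k) * (1 - r) <= 1.
Proof.
move=> r0 r1; have -> : (\sum_(k < m) r ^+ k) * (1 - r) = 1 - r ^+ m.
  elim: m => [|m ih]; first by rewrite big_ord0 mul0r expr0 subrr.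
  by rewrite big_ord_recr /= mulrDl ih exprS; ring.
by have := exprn_ge0 m r0; lra.
Qed.

(** Some dyadic point lies within [S / 2 ^ m] to the left of [t], and continuity carries the bound
    over to [t]. *)
Lemma dyadic_bound b S L r t : 0 <= L -> 0 <= r -> r < 1 -> ucont S b ->
  (forall m i, (i < 2 ^ m)%N -> `|b (S * (i.+1%:R / 2 ^+ m)) - b (S * (i%:R / 2 ^+ m))| <= L * r ^+ m) ->
  0 <= t -> t <= S -> `|b t - b 0| * (1 - r) <= L.
Proof.
move=> L0 r0 r1 cb H t0 tS; have [S0|S0] := leP S 0.
  have -> : t = 0 by lra.
  by rewrite subrr normr0 mul0r.
apply: (@ler_eps _ _ _ (1 - r)); first lra.
move=> e /cb [dl dl0 hd].
have [m mS] := exists_nat_gt (S / dl).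
have m2 : m.+1%:R <= 2 ^+ m :> R.
  by rewrite -natrX ler_nat; exact: ltn_expl.
have p0 : 0 < 2 ^+ m :> R by rewrite exprn_gt0.
have St : 0 <= t / S * 2 ^+ m by rewrite mulr_ge0 ?divr_ge0 // ltW.
have /andP[i1 i2] := truncn_itv St; set i := Num.truncn _ in i1 i2.
have q1 : t / S <= 1 by rewrite ler_pdivrMr // mul1r.
have im : (i <= 2 ^ m)%N.
  rewrite -(ler_nat R) natrX; apply: le_trans i1 _.
  by rewrite ler_piMl // ltW.
have h := dyadic_chain L0 r0 H im.
have e1 : S * (i%:R / 2 ^+ m) <= t.
  by rewrite mulrA ler_pdivrMr // mulrC -ler_pdivlMr // mulrAC.
have e2 : t <= S * (i.+1%:R / 2 ^+ m).
  by rewrite mulrA ler_pdivlMr // [leRHS]mulrC -ler_pdivrMr // mulrAC ltW.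
have e3 : S * (i.+1%:R / 2 ^+ m) = S * (i%:R / 2 ^+ m) + S / 2 ^+ m by rewrite -natr1; ring.
have e4 : S / 2 ^+ m <= dl.
  rewrite ler_pdivrMr //; move: mS; rewrite ltr_pdivrMr // => /ltW/le_trans; apply.
  by rewrite mulrC ler_wpM2l // ltW.
have e0 : 0 <= S * (i%:R / 2 ^+ m) by rewrite mulr_ge0 ?divr_ge0 // ltW.
have {}hd := hd _ t e0 e1 tS.
have {}hd : `|b t - b (S * (i%:R / 2 ^+ m))| <= e by apply: hd; lra.
have g := geometric_le m.+1 r0 r1.
have := ler_normD (b t - b (S * (i%:R / 2 ^+ m))) (b (S * (i%:R / 2 ^+ m)) - b 0).
rewrite addrA subrK => h2; have {}h2 := le_trans h2 (lerD hd h).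
have r1' : 0 <= 1 - r by lra.
have := ler_wpM2r r1' h2; rewrite mulrDl => h3.
have := ler_wpM2l L0 g; rewrite mulr1 mulrA; lra.
Qed.

End Chaining.

Lemma ae_countable {R : realType} {dT : measure_display} {T : measurableType dT}
  (P : probability T R) (I : countType) (Q : I -> T -> Prop) :
  (forall i, {ae P, forall w, Q i w}) -> {ae P, forall w, forall i, Q i w}.
Proof.
move=> h.
have := @ae_foralln _ _ _ P (fun n w => if choice.unpickle n is Some i then Q i w else True).
move=> /(_ _)-[n|].
  by case: choice.unpickle => [i|]; [exact: h|exact/aeW].
move=> N [mN N0 sN]; exists N; split => // w hw; apply: sN => /= k; apply: hw => i.
by have := k (choice.pickle i); rewrite choice.pickleK.
Qed.

(** * Growth of the Brownian paths in space *)

Section BrownianPaths.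
Context {R : realType} {d : nat} (C : set (lattice d)).
Context {dT : measure_display} {T : measurableType dT} (P : probability T R).
Context (B : C -> R -> {RV P >-> R}) (hB : forall y, brownian_motion (B y)).
Implicit Types (x y : C) (w : T).
Local Notation J x := (japanese R (val x)).
Local Notation q := (2 * d).+1.
Local Notation box := (@box R d C).

Definition dyadic_increment (S : nat) y m i w :=
  B y (S%:R * (i.+1%:R / 2 ^+ m)) w - B y (S%:R * (i%:R / 2 ^+ m)) w.

(* [kap = (9/8)^4]: the weighted fourth moments remain summable because [kap < 2], and each term of
   the sum then bounds a level-[m] increment by [(8/9)^m]. *)
Definition kap : R := 6561 / 4096.

Lemma kap0 : 0 <= kap. Proof. by rewrite /kap; lra. Qed.

(** Kolmogorov's moment method for all sites at once: level [m] has [2 ^ m] increments with fourth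
    moments [O(4 ^ -m)], which leaves room for [kap ^ m], and [J ^- q] makes the sum over sites
    converge. *)
Definition chain_sum S n w := \sum_(y <- box n) J y ^- q *
  (\sum_(m < n) kap ^+ m * (\sum_(i < 2 ^ m) dyadic_increment S y m i w ^+ 4)).

Lemma chain_term S y m i : mean_le P (fun w => dyadic_increment S y m i w ^+ 4)
  (64 * (S%:R / 2 ^+ m) ^+ 2).
Proof.
have p0 : 0 < 2 ^+ m :> R by rewrite exprn_gt0.
have -> : S%:R / 2 ^+ m = S%:R * (i.+1%:R / 2 ^+ m) - S%:R * (i%:R / 2 ^+ m) :> R by rewrite -natr1; ring.
apply: brownian_four => //.
by rewrite ler_wpM2l // ler_wpM2r ?invr_ge0 ?ler_nat // ltW.
Qed.

Lemma chain_sum_mean S n : mean_le P (chain_sum S n) (6 ^+ d * (64 * S%:R ^+ 2 * 6)).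
Proof.
have h y := mean_le_sum (index_enum 'I_n) (fun m : 'I_n => mean_leZ (exprn_ge0 m kap0)
  (mean_le_sum (index_enum 'I_(2 ^ m)) (fun i : 'I_(2 ^ m) => chain_term S y m i))).
have {}h := mean_le_sum (box n) (fun y => mean_leZ (@jap_expV_ge0 R _ _ y q) (h y)).
apply: mean_le_trans h.
(* The 6 bounds the geometric series: [1 / (1 - kap / 2) = 8192 / 1631]. *)
set c := 64 * _ * 6.
suff E : \sum_(m < n) kap ^+ m * (\sum_(i < 2 ^ m) 64 * (S%:R / 2 ^+ m) ^+ 2) <= c :> R.
  apply: le_trans (_ : _ <= \sum_(y <- box n) J y ^- q * c) _.
    by apply: ler_sum => y _; rewrite ler_wpM2l // jap_expV_ge0.
  by rewrite -mulr_suml ler_wpM2r ?sum_jap_le ?fset_uniq // !mulr_ge0 // sqr_ge0.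
have -> : \sum_(m < n) kap ^+ m * (\sum_(i < 2 ^ m) 64 * (S%:R / 2 ^+ m) ^+ 2) =
    64 * S%:R ^+ 2 * \sum_(m < n) (kap / 2) ^+ m.
  rewrite mulr_sumr; apply: eq_bigr => m _; rewrite sumr_const card_ord -[X in _ * X = _]mulr_natl natrX.
  have E (k p s : R) : p != 0 -> k * (p * (64 * (s / p) ^+ 2)) = 64 * s ^+ 2 * (k * p^-1).
    by move=> p0; field.
  by rewrite [(kap / 2) ^+ m]exprMn exprVn E // expf_neq0.
have K0 : 0 <= kap / 2 by have := kap0; lra.
have K1 : kap / 2 < 1 by rewrite /kap; lra.
rewrite /c ler_wpM2l ?mulr_ge0 ?sqr_ge0 //; have := geometric_le n K0 K1.
by set s := \sum_(k < n) _; rewrite /kap; lra.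
Qed.

Lemma chain_sum_incr S n w : chain_sum S n w <= chain_sum S n.+1 w.
Proof.
have t0 y m (i : 'I_(2 ^ m)) : 0 <= dyadic_increment S y m i w ^+ 4 by have [_ ->] := chain_term S y m i.
have T0 y m : 0 <= kap ^+ m * (\sum_(i < 2 ^ m) dyadic_increment S y m i w ^+ 4).
  by rewrite mulr_ge0 ?exprn_ge0 ?kap0 // sumr_ge0.
apply: le_trans (_ : _ <= \sum_(y <- box n) J y ^- q *
  (\sum_(m < n.+1) kap ^+ m * (\sum_(i < 2 ^ m) dyadic_increment S y m i w ^+ 4))) _.
  apply: ler_sum => y _; rewrite ler_wpM2l ?jap_expV_ge0 // big_ord_recr /=.
  by have := T0 y n; lra.
apply: uniq_sum_le; rewrite ?fset_uniq //; first exact: box_sub.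
by move=> y _; rewrite mulr_ge0 ?jap_expV_ge0 // sumr_ge0.
Qed.

Lemma chain_sum_term S n w y m i : y \in box n -> (m < n)%N -> (i < 2 ^ m)%N ->
  J y ^- q * (kap ^+ m * dyadic_increment S y m i w ^+ 4) <= chain_sum S n w.
Proof.
have t0 y' m' (i' : 'I_(2 ^ m')) : 0 <= dyadic_increment S y' m' i' w ^+ 4.
  by have [_ ->] := chain_term S y' m' i'.
have T0 y' m' : 0 <= kap ^+ m' * (\sum_(i < 2 ^ m') dyadic_increment S y' m' i w ^+ 4).
  by rewrite mulr_ge0 ?exprn_ge0 ?kap0 // sumr_ge0.
move=> yn mn im; rewrite /chain_sum (bigD1_seq y) ?fset_uniq //=.
apply: ler_wpDr; first by apply: sumr_ge0 => y' _; rewrite mulr_ge0 ?jap_expV_ge0 // sumr_ge0.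
rewrite ler_wpM2l ?jap_expV_ge0 // (bigD1 (Ordinal mn)) //=.
apply: ler_wpDr; first exact: sumr_ge0.
rewrite ler_wpM2l ?exprn_ge0 ?kap0 // (bigD1 (Ordinal im)) //=.
by apply: ler_wpDr => //; exact: sumr_ge0.
Qed.

(** All that the pathwise construction uses of the Brownian motions. *)
Definition regular_paths w := [/\ forall y S, ucont S (fun t => B y t w), forall y, B y 0 w = 0 &
  forall S, exists2 K, 0 <= K & forall t, 0 <= t -> t <= S -> poly_bound K q (fun y => B y t w)].

Lemma brownian_regular : {ae P, forall w, regular_paths w}.
Proof.
have a1 : {ae P, forall w, forall y, B y 0 w = 0}.
  by apply: (@ae_countable _ _ _ P C (fun y w => B y 0 w = 0)) => y; have [] := hB y.
have a2 : {ae P, forall w, forall y, {within `[0, +oo[, continuous (fun t : R => B y t w)}}.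
  apply: (@ae_countable _ _ _ P C (fun y w => {within `[0, +oo[, continuous (fun t : R => B y t w)})) => y.
  by have [] := hB y.
have a3 : {ae P, forall w, forall S, exists M, forall n, chain_sum S n w <= M}.
  apply: ae_foralln => S; exact: mean_le_bounded (chain_sum_mean S) (chain_sum_incr S).
apply: filterS3 a1 a2 a3 => w h1 h2 h3.
have cB y S : ucont S (fun t => B y t w).
  apply: continuous_ucont; apply: continuous_subspaceW (h2 y).
  by move=> t /=; rewrite !in_itv /= => /andP[-> _].
split => // S.
have [N NS] := exists_nat_gt S; have [M hM] := h3 N.+1.
have M0 : 0 <= M by apply: le_trans (hM 0%N); have [_ ->] := chain_sum_mean N.+1 0.
(* The 9 is [1 / (1 - 8 / 9)], from the geometric series of increments. *)
exists (9 * (1 + M)); first by lra.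
move=> t t0 tS y; have tN : t <= N.+1%:R by lra.
have Jq : 1 <= J y ^+ q by rewrite exprn_ege1 // jap_ge1.
(* The added 1 ensures [L >= 1], hence [L <= L ^ 4], so that no fourth root is needed. *)
pose L := (1 + M) * J y ^+ q.
have L1 : 1 <= L by rewrite -[leLHS]mulr1 /L ler_pM //; lra.
have := @dyadic_bound _ (fun t => B y t w) N.+1%:R L (8 / 9) t _ _ _ (cB y _).
rewrite h1 subr0 => h; suff : `|B y t w| * (1 - 8 / 9) <= L by rewrite /L; lra.
have L0 : 0 <= L by lra.
have r0 : 0 <= (8 / 9 : R) by lra.
have r1 : (8 / 9 : R) < 1 by lra.
apply: h => //.
move=> m i im; rewrite -/(dyadic_increment N.+1 y m i w).
have [n yn] := @in_box_ex R _ _ y.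
have mn : (m < maxn n.+1 m.+1)%N by rewrite leq_maxr.
have yn' : y \in box (maxn n.+1 m.+1) by apply: box_sub yn; exact: leq_maxl.
have := le_trans (chain_sum_term N.+1 w yn' mn im) (hM _).
set D := dyadic_increment _ _ _ _ _ => h4.
have k0 : 0 < kap ^+ m by rewrite exprn_gt0 // /kap; lra.
have J0 : 0 < J y ^+ q by lra.
have h5 : D ^+ 4 <= L * (8 / 9) ^+ m ^+ 4.
  have -> : (8 / 9 : R) ^+ m ^+ 4 = (kap ^+ m)^-1.
    by rewrite exprAC -exprVn /kap; congr (_ ^+ m); field.
  rewrite ler_pdivlMr // mulrC; apply: (@le_trans _ _ (M * J y ^+ q)).
    by rewrite -ler_pdivrMr // [leLHS]mulrC.
  by rewrite /L ler_wpM2r //; lra.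
have h6 : `|D| ^+ 4 <= (L * (8 / 9) ^+ m) ^+ 4.
  rewrite -normrX ger0_norm; last by rewrite (_ : 4%N = (2 * 2)%N) // exprM sqr_ge0.
  apply: le_trans h5 _; rewrite [leRHS]exprMn ler_wpM2r ?exprn_ge0 //.
  by rewrite exprS ler_peMr ?exprn_ege1 //; lra.
rewrite -(ler_pXn2r (n := 4)) // nnegrE //.
by rewrite mulr_ge0 ?exprn_ge0 //; lra.
Qed.

End BrownianPaths.

(** * Wiener integrals *)

Lemma exists_pow2_gt {R : realType} (x : R) : exists j, x < 2 ^+ j.
Proof.
have [n xn] := exists_nat_gt x; exists n.+1; apply: lt_le_trans xn _.
by rewrite -natrX ler_nat ltnW // ltn_expl.
Qed.

Section StieltjesSums.
Context {R : realType}.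
Implicit Types (f g b G : R -> R) (S : R).

Definition grid S (n i : nat) : R := i%:R * (S / n%:R).

Definition stieltjes f b S n := \sum_(i < n) (f (grid S n i.+1) - f (grid S n i)) * b (grid S n i).

Lemma gridS S n i : grid S n i.+1 - grid S n i = S / n%:R.
Proof. by rewrite /grid -natr1; ring. Qed.

Lemma grid_ge0 S n i : 0 <= S -> 0 <= grid S n i.
Proof. by move=> S0; rewrite mulr_ge0 ?divr_ge0. Qed.

Lemma grid_le S n i j : 0 <= S -> (i <= j)%N -> grid S n i <= grid S n j.
Proof. by move=> S0 ij; rewrite ler_wpM2r ?divr_ge0 // ler_nat. Qed.

Lemma gridn S n : (0 < n)%N -> grid S n n = S.
Proof. by move=> n0; rewrite /grid mulrC divfK // pnatr_eq0 -lt0n. Qed.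

Lemma grid0 S n : grid S n 0 = 0. Proof. exact: mul0r. Qed.

(** Replacing [f (s + h) - f s] by [h g s] costs [o(h)], and [h g s b s] is the increment of [G] up
    to [o(h)]. *)
Lemma stieltjes_cvg f g b G S : 0 <= S -> uderiv S f g -> ucont S b ->
  uderiv S G (fun s => g s * b s) -> stieltjes f b S (2 ^ j) @[j --> \oo] --> G S - G 0.
Proof.
move=> S0 df cb dG; apply/cvgrPdist_le => e e0.
have [K K0 bK] := ucont_bounded cb.
have S1 : 0 < S + 1 by lra.
pose c := e / (S + 1); have c0 : 0 < c by rewrite divr_gt0.
have h1 : 0 < c / 2 / (K + 1) by rewrite !divr_gt0 //; lra.
have h2 : 0 < c / 2 by lra.
have [d1 d10 D1] := df _ h1; have [d2 d20 D2] := dG _ h2.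
have [J SJ] := exists_pow2_gt (S / Num.min d1 d2).
exists J => // j /= Jj; set n := (2 ^ j)%N.
have n0 : (0 < n)%N by rewrite expn_gt0.
have h0 : 0 <= S / n%:R by rewrite divr_ge0.
have : S / n%:R <= Num.min d1 d2.
  have n0' : 0 < n%:R :> R by rewrite ltr0n.
  rewrite ler_pdivrMr // mulrC -ler_pdivrMr ?lt_min ?d10 //; apply: le_trans (ltW SJ) _.
  by rewrite natrX ler_weXn2l // ler1n.
rewrite le_min => /andP[hd1 hd2].
have ind k : (k <= n)%N -> `|G (grid S n k) - G 0 -
    \sum_(i < k) (f (grid S n i.+1) - f (grid S n i)) * b (grid S n i)| <= c * grid S n k.
  elim: k => [_|k ih kn]; first by rewrite big_ord0 grid0 !subrr normr0 mulr0.
  have {}ih := ih (ltnW kn); rewrite big_ord_recr /=.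
  have s0 := grid_ge0 n k S0; have st : grid S n k <= grid S n k.+1 by exact: grid_le.
  have tS : grid S n k.+1 <= S by rewrite -[leRHS](gridn S n0); exact: grid_le.
  have i1 := D1 _ _ s0 st tS; have i2 := D2 _ _ s0 st tS; rewrite gridS in i1 i2.
  have {}i1 := i1 hd1; have {}i2 := i2 hd2.
  have i3 := bK _ s0 (le_trans st tS).
  have Eg : grid S n k.+1 = grid S n k + S / n%:R by have := gridS S n k; lra.
  rewrite Eg in i1 i2 *; move: ih i1 i2 i3.
  set s := grid S n k; set h := S / n%:R; set A := \sum_(i < k) _.
  move=> i0 i1 i2 i3.
  have -> : G (s + h) - G 0 - (A + (f (s + h) - f s) * b s) =
      (G s - G 0 - A) + (G (s + h) - G s - h * (g s * b s)) - (f (s + h) - f s - h * g s) * b s by ring.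
  have i4 : `|(f (s + h) - f s - h * g s) * b s| <= c / 2 / (K + 1) * h * K.
    by rewrite normrM ler_pM.
  have i5 : c / 2 / (K + 1) * h * K <= c / 2 * h.
    have -> : c / 2 / (K + 1) * h * K = (c / 2 * h) * (K / (K + 1)) by ring.
    have : 0 <= c / 2 * h by rewrite mulr_ge0 // ltW.
    by move=> p0; rewrite ler_piMr // ler_pdivrMr; lra.
  apply: le_trans (ler_normB _ _) _; apply: le_trans (lerD (ler_normD _ _) i4) _.
  lra.
have := ind n (leqnn n); rewrite gridn // -/(stieltjes f b S n) => /le_trans; apply.
by rewrite /c mulrAC ler_pdivrMr // ler_wpM2l ?(ltW e0) //; lra.
Qed.

Lemma sum_mul (F : nat -> R) n k : \sum_(r < n * k) F r = \sum_(i < n) \sum_(j < k) F (i * k + j)%N.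
Proof.
elim: n => [|n ih]; first by rewrite !big_ord0.
by rewrite big_ord_recr /= -ih mulSnr big_split_ord.
Qed.

(** Written on a finer grid, the coarse sum has the fine increments of [f] and reads [b] at the last
    coarse point, so that coarse and fine sums can be subtracted term by term. *)
Lemma stieltjes_refine f b S n k : (0 < k)%N -> stieltjes f b S n =
  \sum_(r < n * k) (f (grid S (n * k) r.+1) - f (grid S (n * k) r)) * b (grid S n (r %/ k)).
Proof.
move=> k0; rewrite (sum_mul (fun r => (f (grid S (n * k) r.+1) - f (grid S (n * k) r)) * b (grid S n (r %/ k)))).
apply: eq_bigr => i _.
have E j : grid S (n * k) (j * k) = grid S n j.
  by rewrite /grid !natrM invfM; field; rewrite !pnatr_eq0 -!lt0n k0 andbT; case: n i => // -[].
under eq_bigr => j _ do rewrite divnMDl // divn_small // addn0.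
rewrite -mulr_suml; congr (_ * _).
rewrite -(big_mkord xpredT (fun j => f (grid S (n * k) (i * k + j).+1) - f (grid S (n * k) (i * k + j)))).
have := telescope_sumr (fun j => f (grid S (n * k) (i * k + j))) (leq0n k).
rewrite addn0 -mulSnr !E => <-.
by apply: eq_bigr => j _; rewrite addnS.
Qed.

End StieltjesSums.

Lemma sum_iota {R : realType} (F : nat -> R) n : \sum_(i <- iota 0 n) F i = \sum_(i < n) F i.
Proof. by rewrite -(big_mkord xpredT F) /index_iota subn0. Qed.

Section WienerIntegral.
Context {R : realType} {dT : measure_display} {T : measurableType dT} (P : probability T R).
Context (b : R -> {RV P >-> R}) (hb : brownian_motion b).
Context (S : R) (S0 : 0 <= S) (f : R -> R) (L : R) (L0 : 0 <= L).
Context (fL : forall s t, 0 <= s -> s <= t -> t <= S -> `|f t - f s| <= L * (t - s)).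

(** The step integral after summation by parts: the differences fall on the regular [f], which
    allows convergence path by path. *)
Definition wiener_sum n w := f S * b S w - f 0 * b 0 w - stieltjes f (fun s => b s w) S n.

Definition step_list n := [seq (f (grid S n i.+1), grid S n i, grid S n i.+1) | i <- iota 0 n].

Lemma wiener_sum_step n w : (0 < n)%N -> wiener_sum n w = step_integral (fun s => b s) (step_list n) w.
Proof.
move=> n0; rewrite /step_integral /step_list big_map sum_iota /=.
rewrite /wiener_sum /stieltjes.
have E k : f (grid S n k) * b (grid S n k) w - f 0 * b 0 w -
    \sum_(i < k) (f (grid S n i.+1) - f (grid S n i)) * b (grid S n i) w =
    \sum_(i < k) f (grid S n i.+1) * (b (grid S n i.+1) w - b (grid S n i) w).
  elim: k => [|k ih]; first by rewrite !big_ord0 grid0 !subrr.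
  by rewrite !big_ord_recr /= -ih; ring.
by have := E n; rewrite gridn.
Qed.

Lemma measurable_wiener_sum n : measurable_fun [set: T] (wiener_sum n).
Proof.
apply: measurable_funB; first by apply: measurable_funB; apply: measurable_funM.
by apply: measurable_sum => i; apply: measurable_funM.
Qed.

Lemma stieltjes_coef n i : (i < n)%N -> (f (grid S n i.+1) - f (grid S n i)) ^+ 2 <= (L * (S / n%:R)) ^+ 2.
Proof.
move=> ilt; rewrite -real_normK ?num_real // lerXn2r ?nnegrE ?mulr_ge0 ?divr_ge0 //.
have n0 : (0 < n)%N by exact: leq_ltn_trans ilt.
rewrite -(gridS S n i); apply: fL; [exact: grid_ge0|exact: grid_le|].
by rewrite -[leRHS](gridn S n0); exact: grid_le.
Qed.

(** Cauchy-Schwarz for [N] terms with coefficients at most [L S / N]; the factors [N] cancel. *)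
Lemma wiener_sum_sq N (D : nat -> T -> R) c : (0 < N)%N -> 0 <= c ->
  (forall r, measurable_fun [set: T] (D r)) -> (forall r, (r < N)%N -> mean_le P (fun w => D r w ^+ 2) c) ->
  mean_le P (fun w => (\sum_(r < N) (f (grid S N r.+1) - f (grid S N r)) * D r w) ^+ 2)
    ((L * S) ^+ 2 * c).
Proof.
move=> N0 c0 mD hD.
have h := mean_leZ (ler0n R N) (mean_le_sum (index_enum 'I_N) (fun r : 'I_N =>
  mean_leZ (sqr_ge0 (L * (S / N%:R))) (hD r (ltn_ord r)))).
have N0' : N%:R != 0 :> R by rewrite pnatr_eq0 -lt0n.
apply: mean_le_mono (mean_le_trans _ h); last 2 first.
- move=> w; rewrite sqr_ge0 /=.
  have := sum_sqr_le (index_enum 'I_N)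
    (fun r : 'I_N => (f (grid S N r.+1) - f (grid S N r)) * D r w) (fun=> ltr01).
  rewrite sumr_const card_ord => /le_trans; apply; rewrite ler_wpM2l //.
  apply: ler_sum => r _; rewrite invr1 mul1r exprMn ler_wpM2r ?sqr_ge0 //.
  exact: stieltjes_coef.
- rewrite sumr_const card_ord -[X in _ * X <= _]mulr_natl !exprMn exprVn.
  have E (p s l : R) : p != 0 -> p * (p * (l * (s * (p ^+ 2)^-1) * c)) = l * s * c.
    by move=> p0; field.
  by rewrite E.
- by apply: measurable_funX; apply: measurable_sum => r; apply: measurable_funM.
Qed.

(** On the common refinement only the values of [b] differ, by increments over times at most
    [S / n]. *)
Lemma wiener_sum_cauchy n k : (0 < n)%N -> (0 < k)%N ->
  mean_le P (fun w => (wiener_sum (n * k) w - wiener_sum n w) ^+ 2) (6 * L ^+ 2 * S ^+ 3 / n%:R).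
Proof.
move=> n0 k0; have nk0 : (0 < n * k)%N by rewrite muln_gt0 n0.
have n0' : 0 < n%:R :> R by rewrite ltr0n.
have k0' : 0 < k%:R :> R by rewrite ltr0n.
pose D r w := b (grid S (n * k) r) w - b (grid S n (r %/ k)) w.
have E r : grid S n (r %/ k) = grid S (n * k) (r %/ k * k).
  by rewrite /grid !natrM invfM; field; rewrite !gt_eqF.
have h := @wiener_sum_sq (n * k) D (6 * (S / n%:R)) nk0 _ _ _.
have {h} : mean_le P (fun w => (\sum_(r < n * k) (f (grid S (n * k) r.+1) - f (grid S (n * k) r)) * D r w) ^+ 2)
    ((L * S) ^+ 2 * (6 * (S / n%:R))).
  apply: h; first by rewrite mulr_ge0 // divr_ge0.
    by move=> r; apply: measurable_funB.
  move=> r _; apply: mean_le_trans (_ : mean_le _ _ (6 * (grid S (n * k) r - grid S n (r %/ k)))).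
    rewrite ler_wpM2l // E /grid -mulrBl -natrB ?leq_divM // natrM invfM.
    have rk (m s u v : R) : m * (s * (u / v)) = (s * u) * (m / v) by ring.
    rewrite rk ler_piMr ?divr_ge0 // ler_pdivrMr // mul1r ler_nat.
    by rewrite {1}(divn_eq r k) addKn ltnW // ltn_pmod.
  by apply: (brownian_sq hb); [exact: grid_ge0|rewrite E; apply: grid_le; rewrite // leq_divM].
have -> : (L * S) ^+ 2 * (6 * (S / n%:R)) = 6 * L ^+ 2 * S ^+ 3 / n%:R by ring.
congr (mean_le P _ _); apply/funext => w; rewrite /wiener_sum (stieltjes_refine _ _ _ n k0) /stieltjes.
have -> (x u v : R) : x - u - (x - v) = v - u by ring.
rewrite -sumrB -sqrrN -sumrN; congr (_ ^+ 2); apply: eq_bigr => r _; rewrite /D; ring.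
Qed.

Lemma wiener_sum_sqr n : (0 < n)%N ->
  mean_le P (fun w => wiener_sum n w ^+ 2) (12 * S * (f S ^+ 2 + (L * S) ^+ 2)).
Proof.
move=> n0; pose D r w := b (grid S n r) w - b 0 w.
have mD r : measurable_fun [set: T] (D r) by apply: measurable_funB.
have hD r : (r < n)%N -> mean_le P (fun w => D r w ^+ 2) (6 * S).
  move=> rn; apply: mean_le_trans (brownian_sq hb (lexx 0) (grid_ge0 n r S0)).
  by rewrite subr0 ler_wpM2l // -[leRHS](gridn S n0); apply: grid_le => //; exact: ltnW.
have S6 : 0 <= 6 * S by rewrite mulr_ge0.
have h1 := wiener_sum_sq n0 S6 mD hD.
have h2 := mean_leZ (sqr_ge0 (f S)) (brownian_sq hb (lexx 0) S0).
have h := mean_leD (mean_leZ (ler0n R 2) h2) (mean_leZ (ler0n R 2) h1).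
apply: mean_le_mono (mean_le_trans _ h); last 2 first.
- move=> w; rewrite sqr_ge0 /=.
  set V := \sum_(r < n) _; have -> : wiener_sum n w = f S * (b S w - b 0 w) - V.
    rewrite /wiener_sum /stieltjes /V.
    have -> : \sum_(r < n) (f (grid S n r.+1) - f (grid S n r)) * D r w =
        \sum_(i < n) (f (grid S n i.+1) - f (grid S n i)) * b (grid S n i) w -
        (\sum_(i < n) (f (grid S n i.+1) - f (grid S n i))) * b 0 w.
      by rewrite mulr_suml -sumrB; apply: eq_bigr => r _; rewrite /D; ring.
    rewrite -(big_mkord xpredT (fun i => f (grid S n i.+1) - f (grid S n i))) telescope_sumr //.
    by rewrite gridn // grid0; ring.
  have := sqr_ge0 (f S * (b S w - b 0 w) + V); rewrite !expr2; lra.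
- by rewrite subr0 !expr2; lra.
- by apply: measurable_funX; exact: measurable_wiener_sum.
Qed.

Context (J : {RV P >-> R}).
Context (hJ : {ae P, forall w, wiener_sum (2 ^ j) w @[j --> \oo] --> J w}).

Lemma wiener_limit_sqr : mean_le P (fun w => J w ^+ 2) (12 * S * (f S ^+ 2 + (L * S) ^+ 2)).
Proof.
apply: (mean_le_lim (F := fun j w => wiener_sum (2 ^ j) w ^+ 2)).
- by move=> j; apply: wiener_sum_sqr; rewrite expn_gt0.
- exact: measurable_funX.
- by move=> w; exact: sqr_ge0.
- by apply: filterS hJ => w h; rewrite expr2; under eq_fun do rewrite expr2; exact: cvgM.
Qed.

(** Fatou along the refinements [2 ^ j * 2 ^ i] of a fixed level [j]. *)
Lemma wiener_limit_dist j : mean_le P (fun w => (J w - wiener_sum (2 ^ j) w) ^+ 2)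
  (6 * L ^+ 2 * S ^+ 3 / (2 ^ j)%:R).
Proof.
apply: (mean_le_lim (F := fun i w => (wiener_sum (2 ^ j * 2 ^ i) w - wiener_sum (2 ^ j) w) ^+ 2)).
- by move=> i; apply: wiener_sum_cauchy; rewrite expn_gt0.
- by apply: measurable_funX; apply: measurable_funB => //; exact: measurable_wiener_sum.
- by move=> w; exact: sqr_ge0.
- apply: filterS hJ => w h.
  have {}h : wiener_sum (2 ^ j * 2 ^ i) w - wiener_sum (2 ^ j) w @[i --> \oo] -->
      J w - wiener_sum (2 ^ j) w.
    apply: cvgB; last exact: cvg_cst.
    have h' : wiener_sum (2 ^ (i + j)) w @[i --> \oo] --> J w.
      by rewrite (cvg_shiftn j (fun x => wiener_sum (2 ^ x) w)).
    by under eq_fun => i do rewrite -expnD addnC.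
  by rewrite expr2; under eq_fun do rewrite expr2; exact: cvgM.
Qed.

Lemma step_list_grid n k s : 0 < s -> s <= grid S n k ->
  exists2 i, grid S n i < s <= grid S n i.+1 /\ (i < k)%N &
    \sum_(i < k) f (grid S n i.+1) * \1_(`]grid S n i, grid S n i.+1] : set R) s = f (grid S n i.+1).
Proof.
have out k' s' : grid S n k' < s' ->
    \sum_(i < k') f (grid S n i.+1) * \1_(`]grid S n i, grid S n i.+1] : set R) s' = 0.
  move=> ks; apply: big1 => i _; rewrite indicE memNset ?mulr0 //= in_itv /= => /andP[_].
  have : grid S n i.+1 <= grid S n k' by apply: grid_le.
  lra.
elim: k => [|k ih] s0; first by rewrite grid0; lra.
move=> sk; rewrite big_ord_recr /=; have [h|h] := leP s (grid S n k).
  have [i [h1 h2] ->] := ih s0 h; exists i; first by split => //; exact: ltnW.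
  rewrite indicE memNset ?mulr0 ?addr0 //= in_itv /=; lra.
exists k; first by rewrite h sk.
by rewrite out // add0r indicE mem_set ?mulr1 //= in_itv /= h.
Qed.

Lemma wiener_limit_is_integral : is_wiener_integral b S f J.
Proof.
have cf : ucont S f by exact: ucont_lip fL.
have mf : measurable_fun `[0, S] f.
  by apply: subspace_continuous_measurable_fun; [exact: measurable_itv|exact: ucont_continuous].
split => // e e0.
pose V := 6 * L ^+ 2 * S ^+ 3; have V0 : 0 <= V by rewrite !mulr_ge0 ?sqr_ge0 ?exprn_ge0.
have [j hj] := exists_pow2_gt (V / e).
have n0 : (0 < 2 ^ j)%N by rewrite expn_gt0.
have n0' : 0 < (2 ^ j)%:R :> R by rewrite ltr0n.
have Ve : V / (2 ^ j)%:R < e.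
  by rewrite ltr_pdivrMr // mulrC -ltr_pdivrMr // natrX.
exists (step_list (2 ^ j)); split.
- move=> p /mapP[i]; rewrite mem_iota add0n => /andP[_ ij] -> /=; split.
  + exact: grid_ge0.
  + exact: grid_le.
  + by rewrite -[leRHS](gridn S n0); exact: grid_le.
- set n := (2 ^ j)%N in n0 n0' Ve *.
  have E s : step_fun (step_list n) s =
      \sum_(i < n) f (grid S n i.+1) * \1_(`]grid S n i, grid S n i.+1] : set R) s.
    by rewrite /step_fun /step_list big_map sum_iota.
  have ms : measurable_fun [set: R] (step_fun (step_list n)).
    apply: (eq_measurable_fun (fun s => \sum_(i < n) f (grid S n i.+1) * \1_(`]grid S n i, grid S n i.+1] : set R) s)).
      by move=> s _; rewrite E.
    by apply: measurable_sum => i; apply: measurable_funM => //; exact: measurable_indic.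
  have mg : measurable_fun `]0, S] (fun s => ((f s - step_fun (step_list n) s) ^+ 2)%:E : \bar R).
    apply/measurable_EFinP; apply: measurable_funX; apply: measurable_funB.
      by apply: measurable_funS mf => // s /=; rewrite !in_itv /= => /andP[/ltW -> ->].
    exact: measurable_funTS.
  (* The steps are left-open, so the step function vanishes at 0 and does not approximate [f] there;
     dropping this point leaves the integral unchanged. *)
  rewrite -integral_itv_obnd_cbnd //.
  apply: (@le_lt_trans _ _ (V / n%:R)%:E); last by rewrite lte_fin.
  apply: (@le_trans _ _ (\int[lebesgue_measure]_(s in `]0%R, S]) (cst ((L * (S / n%:R)) ^+ 2)%:E s))%E).
    apply: ge0_le_integral => //.
    - by move=> s _; rewrite lee_fin sqr_ge0.
    - move=> s /=; rewrite in_itv /= => /andP[s0 sS]; rewrite lee_fin E.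
      have [|i [/andP[h1 h2] ik] ->] := @step_list_grid n n s s0; first by rewrite gridn.
      rewrite -real_normK ?num_real // lerXn2r ?nnegrE ?mulr_ge0 ?divr_ge0 // distrC.
      have h3 : grid S n i.+1 <= S by rewrite -[leRHS](gridn S n0); exact: grid_le.
      apply: le_trans (fL (ltW s0) h2 h3) _; rewrite ler_wpM2l // -(gridS S n i); lra.
  rewrite integral_cst //= lebesgue_measure_itv /= lte_fin.
  have c0 : 0 <= (L * (S / n%:R)) ^+ 2 * S by rewrite mulr_ge0 ?sqr_ge0.
  have c1 : (L * (S / n%:R)) ^+ 2 * S <= V / n%:R.
    have -> : (L * (S / n%:R)) ^+ 2 * S = L ^+ 2 * S ^+ 3 / n%:R * n%:R^-1 by ring.
    have n1 : n%:R^-1 <= 1 :> R by rewrite invf_le1 // ler1n.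
    have z0 : 0 <= L ^+ 2 * S ^+ 3 / n%:R by rewrite divr_ge0 ?mulr_ge0 ?sqr_ge0 ?exprn_ge0.
    have := ler_wpM2l z0 n1; rewrite mulr1 /V => h; apply: le_trans h _.
    have -> : 6 * L ^+ 2 * S ^+ 3 / n%:R = 6 * (L ^+ 2 * S ^+ 3 / n%:R) by ring.
    lra.
  case: ifP => _; first by rewrite oppr0 adde0 -EFinM lee_fin.
  by rewrite mule0 lee_fin; exact: le_trans c0 c1.
- have [_ _ h] := wiener_limit_dist j.
  under eq_integral => w _ do rewrite -wiener_sum_step //.
  by apply: le_lt_trans h _; rewrite lte_fin.
Qed.

End WienerIntegral.

(** * Unconditional convergence in [L^2] *)

Section L2Sums.
Context {R : realType} {d : nat} (C : set (lattice d)).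
Context {dT : measure_display} {T : measurableType dT} (P : probability T R).
Context (Y : C -> {RV P >-> R}) (Z : {RV P >-> R}) (K : R).
Local Notation J x := (japanese R (val x)).
Local Notation q := (2 * d).+1.
Local Notation box := (@box R d C).
Context (K0 : 0 <= K) (hY : forall y, mean_le P (fun w => Y y w ^+ 2) (K * J y ^- (2 * q))).
Context (hZ : {ae P, forall w, \sum_(y <- box n) Y y w @[n --> \oo] --> Z w}).

(** Half of the decay [J ^- (2 q)] is spent on the weights [J ^- q] of Cauchy-Schwarz; the other
    half sums with tail [1 / n]. *)
Lemma finite_sum_sqr (s : seq C) n : uniq s -> (0 < n)%N -> (forall y, y \in s -> n%:R <= J y) ->
  mean_le P (fun w => (\sum_(y <- s) Y y w) ^+ 2) (6 ^+ d * (K * (6 ^+ d / n%:R))).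
Proof.
move=> us n0 sn; have Jq (y : C) : 0 < J y ^- q by rewrite invr_gt0 jap_exp_gt0.
have S0 : 0 <= (6 : R) ^+ d by rewrite exprn_ge0.
have h := mean_leZ S0 (mean_le_sum s (fun y => mean_leZ (ltW (@jap_exp_gt0 R _ _ y q)) (hY y))).
apply: mean_le_mono (mean_le_trans _ h); last 2 first.
- move=> w; rewrite sqr_ge0 /=; apply: le_trans (sum_sqr_le s _ Jq) _.
  under [X in _ * X <= _]eq_bigr => y _ do rewrite invrK.
  rewrite ler_wpM2r ?sum_jap_le // sumr_ge0 // => y _.
  by rewrite mulr_ge0 ?sqr_ge0 // ltW // jap_exp_gt0.
- rewrite ler_wpM2l //.
  have -> : \sum_(y <- s) J y ^+ q * (K * J y ^- (2 * q)) = K * \sum_(y <- s) J y ^- q.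
    rewrite mulr_sumr; apply: eq_bigr => y _; rewrite (_ : 2 * q = q + q)%N; last by lia.
    rewrite exprD invfM mulrCA; congr (_ * _).
    by rewrite mulrA divff ?mul1r // gt_eqF // jap_exp_gt0.
  by rewrite ler_wpM2l // sum_jap_tail.
- by apply: measurable_funX; apply: measurable_sum.
Qed.

(** The difference is the almost sure limit of sums over large boxes without [F], whose sites all
    lie outside [box n]; Fatou applies. Allowing any [F] containing the box gives convergence along
    the net. *)
Lemma L2_sum_dist (F : {fset C}) n : (0 < n)%N -> {subset box n <= F} ->
  mean_le P (fun w => (Z w - \sum_(y <- F) Y y w) ^+ 2) (6 ^+ d * (K * (6 ^+ d / n%:R))).
Proof.
move=> n0 nF; have [m0 Fm] := @subset_box R _ _ F.
pose D m := [seq y <- box (m + m0.+1) | y \notin F].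
have E m w : \sum_(y <- D m) Y y w = \sum_(y <- box (m + m0.+1)) Y y w - \sum_(y <- F) Y y w.
  rewrite big_filter (bigID (fun y => y \in F) xpredT) /= addrC.
  have -> : \sum_(y <- box (m + m0.+1) | y \in F) Y y w = \sum_(y <- F) Y y w; last by rewrite addrK.
  rewrite -big_filter; apply: perm_big; apply: uniq_perm; rewrite ?filter_uniq ?fset_uniq // => y.
  rewrite mem_filter.
  case yF : (y \in F) => //=; apply: box_sub (Fm _ yF); exact: leq_addl.
apply: (mean_le_lim (F := fun m w => (\sum_(y <- D m) Y y w) ^+ 2)).
- move=> m; apply: finite_sum_sqr => //; first by rewrite filter_uniq ?fset_uniq.
  move=> y; rewrite mem_filter => /andP[yF _]; rewrite leNgt; apply/negP => yn.
  by move: yF; rewrite nF // in_box ltW.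
- by apply: measurable_funX; apply: measurable_funB => //; apply: measurable_sum.
- by move=> w; exact: sqr_ge0.
- apply: filterS hZ => w h.
  have {}h : \sum_(y <- D m) Y y w @[m --> \oo] --> Z w - \sum_(y <- F) Y y w.
    have h' : \sum_(y <- box (m + m0.+1)) Y y w @[m --> \oo] --> Z w.
      by rewrite (cvg_shiftn m0.+1 (fun n => \sum_(y <- box n) Y y w)).
    by under eq_fun do rewrite E; apply: cvgB; last exact: cvg_cst.
  by rewrite expr2; under eq_fun do rewrite expr2; exact: cvgM.
Qed.

Lemma L2_sum_box : is_L2_sum Y Z.
Proof.
move=> A [e /= e0 he].
pose c := 6 ^+ d * (K * 6 ^+ d) : R.
have c0 : 0 <= c by rewrite !mulr_ge0 // exprn_ge0.
have [n hn] := exists_nat_gt (c / e).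
exists (box n.+1) => //= F /fsubsetP nF.
have [_ _ hI] := L2_sum_dist (ltn0Sn n) nF.
have I0 : (0 <= \int[P]_w ((Z w - \sum_(i <- F) Y i w)%R ^+ 2)%:E)%E.
  by apply: integral_ge0 => w _; rewrite lee_fin sqr_ge0.
have cn : 6 ^+ d * (K * (6 ^+ d / n.+1%:R)) < e.
  have -> : 6 ^+ d * (K * (6 ^+ d / n.+1%:R)) = c / n.+1%:R by rewrite /c; ring.
  by rewrite ltr_pdivrMr // mulrC -ltr_pdivrMr.
move: I0 hI; rewrite /preimage /=; case: (\int[P]_w _)%E => [r| |] //; rewrite !lee_fin => r0 rc.
by apply: he; rewrite /= sub0r normrN ger0_norm //; exact: le_lt_trans rc cn.
Qed.

End L2Sums.

(** * Solutions in weighted spaces *)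

Section WeightedSpaces.
Context {R : realType} {d : nat} (C : set (lattice d)).
Implicit Types (x y : C) (f g u : C -> R).
Local Notation J x := (japanese R (val x)).
Local Notation q := (2 * d).+1.
Local Notation box := (@box R d C).

Lemma Hnorm2_nat (N : nat) f :
  Hnorm2 (- N%:R) f = (\esum_(x in [set: C]) (J x ^- (2 * N) * `|f x| ^+ 2)%:E)%E.
Proof.
apply: eq_esum => x _; congr (_%:E); congr (_ * _).
by rewrite mulrN -natrM powRN powR_mulrn // jap_ge0.
Qed.

Lemma Hnorm2_ge (N : R) f x : ((J x `^ (2 * N) * `|f x| ^+ 2)%:E <= Hnorm2 N f)%E.
Proof.
rewrite /Hnorm2; apply: le_trans (esum_ge _); last first.
  exists [set x]; first by split => //; exact: finite_set1.
  by rewrite fsbig_set1.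
by [].
Qed.

Lemma Hnorm2_ge0 (N : R) f : (0 <= Hnorm2 N f)%E.
Proof. by apply: esum_ge0 => x _; rewrite lee_fin mulr_ge0 ?powR_ge0 // sqr_ge0. Qed.

Lemma Hnorm2_pointwise (N : nat) f e x : (Hnorm2 (- N%:R) f <= (e ^+ 2)%:E)%E -> 0 <= e ->
  `|f x| <= e * J x ^+ N.
Proof.
move=> h e0; have := le_trans (Hnorm2_ge (- N%:R) f x) h.
rewrite lee_fin mulrN -natrM powRN powR_mulrn ?jap_ge0 // mulrC ler_pdivrMr ?jap_exp_gt0 //.
rewrite mulnC exprM -exprMn; apply: ler_sqrW.
by rewrite mulr_ge0 // ltW // jap_exp_gt0.
Qed.

Lemma Hspace_pointwise (N : nat) f : Hspace (- N%:R) f -> exists2 K, 0 <= K & poly_bound K N f.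
Proof.
rewrite /Hspace /=; have := Hnorm2_ge0 (- N%:R) f.
case E : (Hnorm2 _ f) => [r| |] //; rewrite lee_fin => r0 _.
exists (Num.sqrt r); first exact: sqrtr_ge0.
by move=> x; apply: Hnorm2_pointwise; rewrite ?sqrtr_ge0 // sqr_sqrtr // E.
Qed.

Lemma Hnorm2_le_mono (N N' : R) f : N <= N' -> (Hnorm2 N f <= Hnorm2 N' f)%E.
Proof.
move=> NN; apply: le_esum => x _; rewrite lee_fin ler_wpM2r ?sqr_ge0 //.
by rewrite ler_powR ?jap_ge1 // ler_wpM2l.
Qed.

Lemma Sdual_pointwise f : Sdual f -> exists K (M : nat), 0 <= K /\ poly_bound K M f.
Proof.
move=> [N N0 fN]; have [M NM] := exists_nat_gt N.
have fM : Hspace (- M.+1%:R) f by apply: le_lt_trans fN; apply: Hnorm2_le_mono; lra.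
by have [K K0 hK] := Hspace_pointwise fM; exists K, M.+1.
Qed.

(** The gap [q] between growth exponent and norm exponent pays for the sum over the lattice. *)
Lemma Hnorm2_box (N M n : nat) f K : 0 <= K -> poly_bound K M f -> (M + q <= N)%N -> (0 < n)%N ->
  (Hnorm2 (- N%:R) f <= (\sum_(x <- box n) J x ^- q * `|f x| ^+ 2 + K ^+ 2 * (6 ^+ d / n%:R))%:E)%E.
Proof.
move=> K0 fK MN n0; rewrite Hnorm2_nat.
have g0 x : 0 <= J x ^- (2 * N) * `|f x| ^+ 2 by rewrite mulr_ge0 ?jap_expV_ge0 ?sqr_ge0.
have gK x : J x ^- (2 * N) * `|f x| ^+ 2 <= K ^+ 2 * J x ^- q.
  apply: (@le_trans _ _ (J x ^- (2 * N) * (K * J x ^+ M) ^+ 2)).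
    by rewrite ler_wpM2l ?jap_expV_ge0 // lerXn2r ?nnegrE // (le_trans _ (fK x)).
  rewrite exprMn mulrCA ler_wpM2l ?sqr_ge0 // mulrC ler_pdivrMr ?jap_exp_gt0 //.
  rewrite mulrC ler_pdivlMr ?jap_exp_gt0 // -exprM -exprD ler_weXn2l ?jap_ge1 //; lia.
have K20 := sqr_ge0 K.
have [fin /andP[_ h]] := esum_box K20 g0 gK n0.
have e0 : (0 <= \esum_(x in [set: C]) (J x ^- (2 * N) * `|f x| ^+ 2)%:E)%E.
  by apply: esum_ge0 => x _; rewrite lee_fin.
rewrite -[leLHS]fineK ?ge0_fin_numE // lee_fin; apply: le_trans h _; rewrite lerD2r.
apply: ler_sum => x _; rewrite ler_wpM2r ?sqr_ge0 // jap_expV_le //; lia.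
Qed.

Lemma Hspace_poly (N M : nat) f K : 0 <= K -> poly_bound K M f -> (M + q <= N)%N -> Hspace (- N%:R) f.
Proof. by move=> K0 fK MN; apply: le_lt_trans (Hnorm2_box K0 fK MN (ltn0Sn 0)) _; rewrite ltry. Qed.

(** The counterpart of [csum_small]: under a common growth bound, convergence on finite boxes
    implies convergence in norm. *)
Lemma Hnorm2_small (N M : nat) K e : 0 <= K -> (M + q <= N)%N -> 0 < e -> exists n h, 0 < h /\
  forall f, poly_bound K M f -> (forall x, x \in box n -> `|f x| <= h) -> (Hnorm2 (- N%:R) f < e%:E)%E.
Proof.
move=> K0 MN e0; have S0 : 0 < (6 : R) ^+ d by rewrite exprn_gt0.
have [n hn] := exists_nat_gt (K ^+ 2 * 6 ^+ d / (e / 2)).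
exists n.+1, (Num.min 1 (e / 4 / 6 ^+ d)); split; first by rewrite lt_min ltr01 !divr_gt0.
set h := Num.min _ _ => f fK fh; apply: le_lt_trans (Hnorm2_box K0 fK MN (ltn0Sn n)) _; rewrite lte_fin.
have h0 : 0 < h by rewrite lt_min ltr01 !divr_gt0.
have : K ^+ 2 * (6 ^+ d / n.+1%:R) < e / 2.
  by rewrite mulrA ltr_pdivrMr // [ltRHS]mulrC -ltr_pdivrMr // divr_gt0.
have : \sum_(x <- box n.+1) J x ^- q * `|f x| ^+ 2 <= e / 4.
  apply: (@le_trans _ _ (\sum_(x <- box n.+1) J x ^- q * h)).
    rewrite big_seq [leRHS]big_seq; apply: ler_sum => x xb; rewrite ler_wpM2l ?jap_expV_ge0 //.
    apply: le_trans (_ : `|f x| * 1 <= _); last by rewrite mulr1 fh.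
    rewrite expr2 ler_wpM2l //; apply: le_trans (fh x xb) _.
    by rewrite ge_min lexx.
  rewrite -mulr_suml; apply: (@le_trans _ _ (6 ^+ d * h)).
    by rewrite ler_wpM2r ?sum_jap_le ?fset_uniq // ltW.
  by rewrite mulrC -ler_pdivlMr // ge_min lexx orbT.
by move=> a1 /ltW a2; apply: le_lt_trans (lerD a1 a2) _; lra.
Qed.

Lemma Sspace_decay u (N : nat) : Sspace u -> exists2 K, 0 <= K & forall x, `|u x| <= K * J x ^- N.
Proof.
move=> /(_ N%:R (ler0n _ _)); rewrite /Hspace /=; have := Hnorm2_ge0 N%:R u.
case E : (Hnorm2 _ u) => [r| |] //; rewrite lee_fin => r0 _.
exists (Num.sqrt r); first exact: sqrtr_ge0.
move=> x; have := Hnorm2_ge N%:R u x; rewrite E lee_fin -natrM powR_mulrn ?jap_ge0 // => h.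
rewrite ler_pdivlMr ?jap_exp_gt0 //; apply: ler_sqrW; first exact: sqrtr_ge0.
by rewrite sqr_sqrtr // exprMn -exprM mulrC (mulnC N).
Qed.

Context (v : R -> C -> R) (M : nat).
Context (cv : forall x S, ucont S (v^~ x)).
Context (bv : forall S, exists2 K, 0 <= K & forall t, 0 <= t -> t <= S -> poly_bound K M (v t)).

Lemma close_on_box t n h : 0 <= t -> 0 < h -> exists2 dl, 0 < dl & forall s, 0 <= s -> `|s - t| < dl ->
  s <= t + 1 /\ forall x, x \in box n -> `|v s x - v t x| <= h.
Proof.
move=> t0 h0; have [dl dl0 D] := ucont_finite (box n) (fun x => cv x (t + 1)) h0.
exists (Num.min dl 1); first by rewrite lt_min dl0 ltr01.
move=> s s0; rewrite lt_min ltr_norml => /andP[/andP[h1 h2] h3]; move: h3; rewrite ltr_norml => /andP[h3 h4].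
split; first lra.
move=> x xb; have [st|ts] := leP s t; first by rewrite distrC; apply: D => //; lra.
by apply: D => //; lra.
Qed.

Lemma poly_continuous_in_H (N : nat) : (M + q <= N)%N -> continuous_in_H (- N%:R) v.
Proof.
move=> MN; split => t t0.
  by have [K K0 hK] := bv t; exact: Hspace_poly K0 (hK t t0 (lexx t)) MN.
have [K K0 hK] := bv (t + 1); have K20 : 0 <= 2 * K by lra.
move=> X [e /= e0 he].
have [n [h [h0 H]]] := Hnorm2_small K20 MN e0.
have [dl dl0 D] := close_on_box n t0 h0.
exists dl => // s /= st s0; have [|s1 hs] := D s s0; first by rewrite distrC.
have : (Hnorm2 (- N%:R) (fun x => (v s x - v t x)%R) < e%:E)%E.
  apply: H hs => x; apply: le_trans (ler_normB _ _) _.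
  have := hK s s0 s1 x; have := hK t t0 _ x => /(_ _)-h2 h1.
  have {}h2 : `|v t x| <= K * J x ^+ M by apply: h2; lra.
  lra.
have := Hnorm2_ge0 (- N%:R) (fun x => (v s x - v t x)%R).
rewrite /preimage /=; case: (Hnorm2 _ _) => [r| |] //; rewrite lee_fin lte_fin => r0 re.
by apply: he; rewrite /= sub0r normrN ger0_norm.
Qed.

Lemma pairing_term (K K' : R) (f u : C -> R) : 0 <= K -> 0 <= K' -> poly_bound K M f ->
  (forall x, `|u x| <= K' * J x ^- (M + q)) -> forall x, `|f x * u x| <= K' * K * J x ^- q.
Proof.
by move=> K0 K'0 fK uK x; rewrite mulrC; exact: (kernel_mul_le K'0 K0 fK uK).
Qed.

Lemma poly_continuous_in_Sdual : continuous_in_Sdual v.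
Proof.
split => [t t0|u uS].
  have [K K0 hK] := bv t; exists (M + q)%:R => //; exact: Hspace_poly K0 (hK t t0 (lexx t)) _.
have [K' K'0 uK] := Sspace_decay (M + q) uS.
apply/subspace_continuousP => t /=; rewrite in_itv /= andbT => t0.
apply/cvg_withinP => e e0.
have [K K0 hK] := bv (t + 1).
have KK0 : 0 <= K' * (2 * K) by rewrite !mulr_ge0.
have [n [h [_ h0 H]]] := @csum_small R d C _ _ KK0 e0.
have u0 x : x \in box n -> `|u x| <= K'.
  move=> _; apply: le_trans (uK x) _; rewrite ler_piMr // invf_le1 ?jap_exp_gt0 //.
  by rewrite exprn_ege1 // jap_ge1.
have h1 : 0 < h / (K' + 1) by rewrite divr_gt0 //; lra.
have [dl dl0 D] := close_on_box n t0 h1.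
exists dl => // s; rewrite /= in_itv /= andbT => s0 st; have [s1 hs] := D s s0 st.
have ks := hK s s0 s1; have kt : poly_bound K M (v t) by apply: hK => //; lra.
have kst : poly_bound (2 * K) M (fun x => v s x - v t x).
  by move=> x; apply: le_trans (ler_normB _ _) _; have := ks x; have := kt x; lra.
have K20 : 0 <= 2 * K by lra.
have Dt : pairing (v s) u - pairing (v t) u = csum (fun x => (v s x - v t x) * u x).
  have bt : forall x, `|- 1 * (v t x * u x)| <= K' * K * J x ^- q.
    by move=> x; rewrite mulN1r normrN; exact: pairing_term K0 K'0 kt uK x.
  have := csumD (mulr_ge0 K'0 K0) (mulr_ge0 K'0 K0) (pairing_term K0 K'0 ks uK) bt.
  rewrite (csumZ (-1) (mulr_ge0 K'0 K0) (pairing_term K0 K'0 kt uK)) mulN1r /pairing => <-.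
  by congr csum; apply/funext => x; ring.
rewrite Dt; apply: H; first exact: pairing_term K20 K'0 kst uK.
move=> x xb; rewrite normrM.
apply: le_trans (ler_pM _ _ (hs x xb) (u0 x xb)) _ => //.
by rewrite mulrAC ler_pdivrMr ?ler_wpM2l ?(ltW h0) //; lra.
Qed.

(** At finitely many sites the Riemann sums converge with a common mesh, and all errors obey one
    growth bound, with constant [K + t K']; [Hnorm2_small] makes this convergence in norm. *)
Lemma poly_integral_in_H (g : R -> C -> R) (N : nat) t : v 0 = (fun=> 0) -> (M + q <= N)%N -> 0 <= t ->
  (forall x S, ucont S (g^~ x)) -> (forall x S, uderiv S (v^~ x) (g^~ x)) ->
  (forall S, exists2 K, 0 <= K & forall t, 0 <= t -> t <= S -> poly_bound K M (g t)) ->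
  is_integral_in_H (- N%:R) g t (v t).
Proof.
move=> v0 MN t0 cg dv bg.
have [K K0 hK] := bv t; have [K' K'0 hK'] := bg t.
split; first exact: Hspace_poly K0 (hK t t0 (lexx t)) MN.
move=> e e0; have KK : 0 <= K + t * K' by rewrite addr_ge0 // mulr_ge0.
have [n [h [h0 H]]] := Hnorm2_small KK MN e0.
have [dl dl0 D] : exists2 dl, 0 < dl & forall x, x \in (box n : seq C) -> forall (n : nat) (s u : nat -> R),
    s 0%N = 0 -> s n = t -> (forall i, (i < n)%N -> s i <= u i <= s i.+1 /\ s i.+1 - s i < dl) ->
    `|v t x - \sum_(i < n) (s i.+1 - s i) * g (u i) x| <= h.
  elim: (box n : seq C) => [|x l [d1 d10 ih]]; first by exists 1.
  have [d2 d20 D] := riemann_sum t0 (cg x t) (dv x t) h0.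
  exists (Num.min d1 d2); first by rewrite lt_min d10.
  move=> y; rewrite inE => /orP[/eqP->|yl] m s u s0 sm hs.
    have := D t m s u t0 (lexx t) s0 sm; rewrite v0 subr0; apply => i im.
    by have [h1] := hs i im; rewrite lt_min => /andP[].
  apply: (ih y yl m s u s0 sm) => i im.
  by have [h1] := hs i im; rewrite lt_min => /andP[].
exists dl => // m s u s0 sm hs; apply: H => x; last by move=> xb; exact: D.
have incr i : (i < m)%N -> s i <= s i.+1 by move=> im; have [/andP[h1 h2] _] := hs i im; lra.
have s_ge0 i : (i <= m)%N -> 0 <= s i.
  by elim: i => [|i ih] im; [rewrite s0|have := incr i im; have := ih (ltnW im); lra].
have s_le i : (i <= m)%N -> s i <= t.
  move=> im; rewrite -sm -(subnKC im).
  have : (i + (m - i) <= m)%N by rewrite subnKC.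
  elim: (m - i)%N => [|k ih] ikm; first by rewrite addn0.
  by rewrite addnS in ikm *; have := ih (ltnW ikm); have := incr _ ikm; lra.
apply: le_trans (ler_normB _ _) _; rewrite mulrDl; apply: lerD; first exact: hK.
apply: le_trans (ler_norm_sum _ _ _) _.
apply: (@le_trans _ _ (\sum_(i < m) (s i.+1 - s i) * (K' * J x ^+ M))).
  apply: ler_sum => i _; have im := ltn_ord i; have [/andP[h1 h2] _] := hs i im.
  rewrite normrM ger0_norm ?subr_ge0 ?incr // ler_wpM2l ?subr_ge0 ?incr //.
  by apply: hK'; have := s_ge0 i (ltnW im); have := s_le i.+1 im; lra.
rewrite -mulr_suml -(big_mkord xpredT (fun i => s i.+1 - s i)) telescope_sumr // sm s0 subr0 mulrA lexx //.
Qed.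

End WeightedSpaces.

(** * Existence and uniqueness path by path *)

Section PathSolutions.
Context {R : realType} {d : nat} (omega : lattice d -> lattice d -> R) (C : set (lattice d)) (A : R).
Context (hw : quadratic_rates omega A).
Implicit Types (x y : C) (psi beta : R -> C -> R) (N : nat).
Local Notation J x := (japanese R (val x)).
Local Notation L := (laplacian omega).
Local Notation q := (2 * d).+1.

Definition path_solution beta phi0 N psi := continuous_in_H (- N%:R) psi /\
  forall t, 0 <= t -> exists2 I : C -> R,
    is_integral_in_H (- (N + 2)%:R) (fun s => L (psi s)) t I &
    forall x, psi t x = phi0 x - I x + Num.sqrt 2 * beta t x.

Lemma H_continuous_close N psi t e : continuous_in_H (- N%:R) psi -> 0 <= t -> 0 < e ->
  exists2 dl, 0 < dl & forall s, 0 <= s -> `|s - t| < dl -> poly_bound e N (fun x => psi s x - psi t x).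
Proof.
move=> [_ cH] t0 e0; have e20 : 0 < e ^+ 2 by rewrite exprn_gt0.
have := cH t t0 [set z | (z <= (e ^+ 2)%:E)%E]; rewrite /nbhs /=.
move=> [|dl /= dl0 D].
  exists (e ^+ 2) => // r; rewrite /= sub0r normrN lee_fin => h.
  by apply: ltW; apply: le_lt_trans (ler_norm r) h.
exists dl => // s s0 st x; apply: (@Hnorm2_pointwise _ _ _ N (fun x => psi s x - psi t x)); last exact: ltW.
by apply: D => //=; rewrite distrC.
Qed.

Lemma H_continuous_ucont N psi x S : continuous_in_H (- N%:R) psi -> ucont S (psi^~ x).
Proof.
move=> cH; apply: continuous_ucont; apply/subspace_continuousP => t /=; rewrite in_itv /= => /andP[t0 _].
apply/cvg_withinP => e e0; have Jx := @jap_exp_gt0 R d C x N.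
have [dl dl0 D] := H_continuous_close cH t0 (divr_gt0 e0 Jx).
exists dl => // s; rewrite /= in_itv /= => /andP[s0 _] st.
by have := D s s0 st x; rewrite divfK // gt_eqF.
Qed.

Lemma H_continuous_bounded N psi S : continuous_in_H (- N%:R) psi ->
  exists2 K, 0 <= K & forall t, 0 <= t -> t <= S -> poly_bound K N (psi t).
Proof.
(* With [e^-1] as the bound, a smaller parameter is a weaker claim, as [segment_covering]
   requires. *)
move=> cH; have [|dl dl0 D] := @segment_covering R S (fun e t => poly_bound e^-1 N (psi t)); last first.
  by exists dl^-1 => //; rewrite invr_ge0 ltW.
move=> t t0 tS; have [dl dl0 D] := H_continuous_close cH t0 ltr01.
have [h _] := cH; have [K K0 hK] := Hspace_pointwise (h t t0).
have K1 : 0 < K + 1 by lra.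
exists (Num.min dl (K + 1)^-1); first by rewrite lt_min dl0 invr_gt0.
move=> s e s0 sS; rewrite lt_min => /andP[st _] e0; rewrite lt_min => /andP[_ eK] x.
have K1e : K + 1 <= e^-1 by rewrite -[leLHS]invrK lef_pV2 ?posrE ?invr_gt0 // ltW.
have h1 := D s s0 st x; have h2 := hK x.
have := ler_normD (psi s x - psi t x) (psi t x); rewrite subrK => h3.
apply: (@le_trans _ _ ((K + 1) * J x ^+ N)); first by lra.
by rewrite ler_wpM2r // ltW // jap_exp_gt0.
Qed.

(** Both are limits of the same Riemann sums over uniform grids: one in norm, hence at [x], the
    other by [riemann_sum]. *)
Lemma integral_in_H_primitive N (g : R -> C -> R) t (I : C -> R) x : 0 <= t -> ucont t (g^~ x) ->
  is_integral_in_H (- N%:R) g t I -> I x = primitive (g^~ x) t.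
Proof.
move=> t0 cg [_ hI]; apply/eqP; rewrite -subr_eq0 -normr_le0.
apply: (@ler_eps _ _ _ (J x ^+ N + 1)) => [|e e0]; first by rewrite addr_ge0 // ltW // jap_exp_gt0.
have e20 : 0 < e ^+ 2 by rewrite exprn_gt0.
have [d1 d10 D1] := hI _ e20.
have [d2 d20 D2] := riemann_sum t0 cg (uderiv_primitive cg) e0.
have [n hn] := exists_nat_gt (t / Num.min d1 d2).
have n0 : 0 < n.+1%:R :> R by [].
have : t / n.+1%:R < Num.min d1 d2.
  by rewrite ltr_pdivrMr // mulrC -ltr_pdivrMr // lt_min d10.
rewrite lt_min => /andP[h1 h2].
have gi i : grid t n.+1 i <= grid t n.+1 i <= grid t n.+1 i.+1.
  by rewrite lexx; exact: grid_le.
have i1 := D1 n.+1 (grid t n.+1) (grid t n.+1) (grid0 _ _) (gridn _ (ltn0Sn n)).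
have i2 := D2 t n.+1 (grid t n.+1) (grid t n.+1) t0 (lexx t) (grid0 _ _) (gridn _ (ltn0Sn n)).
have {}i1 := i1 (fun i _ => conj (gi i) (eq_ind_r (fun r => r < d1) h1 (gridS t n.+1 i))).
have {}i2 := i2 (fun i _ => conj (gi i) (eq_ind_r (fun r => r < d2) h2 (gridS t n.+1 i))).
have {}i1 := Hnorm2_pointwise x (ltW i1) (ltW e0).
rewrite primitive0 subr0 in i2; move: i1 i2; set V := \sum_(i < _) _ => i1 i2.
have := ler_normB (I x - V) (primitive (g^~ x) t - V).
have -> : I x - V - (primitive (g^~ x) t - V) = I x - primitive (g^~ x) t by ring.
lra.
Qed.

Lemma path_solution_deriv beta phi0 N psi : path_solution beta phi0 N psi ->
  (forall x S, uderiv S (fun t => psi t x - Num.sqrt 2 * beta t x) (fun t => - L (psi t) x)) /\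
  (forall x, psi 0 x = phi0 x + Num.sqrt 2 * beta 0 x).
Proof.
move=> [cH eqn].
have cL x S : ucont S (fun t => L (psi t) x).
  by apply: ucont_laplacian => y; exact: H_continuous_ucont cH.
have E x t : 0 <= t -> psi t x = phi0 x - primitive (fun s => L (psi s) x) t + Num.sqrt 2 * beta t x.
  by move=> t0; have [I hI ->] := eqn t t0; rewrite (integral_in_H_primitive t0 (cL x t) hI).
split => [x S|x]; last by rewrite E // primitive0 subr0.
apply: eq_uderiv (uderivB (uderiv_cst S (phi0 x)) (uderiv_primitive (cL x S))) => t t0 _.
  by rewrite E //; ring.
by rewrite sub0r.
Qed.

(** The noise cancels in the difference, which solves the heat equation from zero; [N + N'] is a
    common growth exponent. *)
Lemma path_solution_unique beta phi0 N N' psi psi' :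
  path_solution beta phi0 N psi -> path_solution beta phi0 N' psi' ->
  forall t, 0 <= t -> psi t = psi' t.
Proof.
move=> h h' t t0; have [[cH _] [cH' _]] := (h, h').
have [d1 i1] := path_solution_deriv h; have [d2 i2] := path_solution_deriv h'.
have [K K0 hK] := H_continuous_bounded t cH; have [K' K'0 hK'] := H_continuous_bounded t cH'.
apply/funext => x; apply/eqP; rewrite -subr_eq0; apply/eqP.
apply: (@heat_unique _ _ _ _ _ hw t (fun t x => psi t x - psi' t x) (K + K') (N + N')) => //.
- by rewrite addr_ge0.
- by move=> y; apply: ucontB; [exact: H_continuous_ucont cH|exact: H_continuous_ucont cH'].
- move=> y; apply: eq_uderiv (uderivB (d1 y t) (d2 y t)) => s s0 st; first by ring.
  by rewrite laplacianB; ring.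
- move=> s y s0 st; apply: le_trans (ler_normB _ _) _; rewrite mulrDl; apply: lerD.
    apply: le_trans (hK s s0 st y) _; rewrite ler_wpM2l // ler_weXn2l ?jap_ge1 // leq_addr //.
  apply: le_trans (hK' s s0 st y) _; rewrite ler_wpM2l // ler_weXn2l ?jap_ge1 // leq_addl //.
- by move=> y; rewrite i1 i2 subrr.
Qed.

Section Construction.
Context (phi0 : C -> R) (K0 : R) (M0 : nat) (K00 : 0 <= K0) (hphi0 : poly_bound K0 M0 phi0).
Context (b : R -> C -> R) (cb : forall y S, ucont S (b^~ y)) (b0 : forall y, b 0 y = 0).
Context (bb : forall S, exists2 K, 0 <= K & forall t, 0 <= t -> t <= S -> poly_bound K q (b t)).

Definition free_field t x := Psem omega t phi0 x +
  Num.sqrt 2 * (b t x - L (duhamel omega b t) x).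

(** Without the noise term the field is [P phi0 - sqrt 2 L U]; as [U' = b - L U], its derivative is
    [- L] of the whole field. *)
Lemma free_field_uderiv x S :
  uderiv S (fun t => free_field t x - Num.sqrt 2 * b t x) (fun t => - L (free_field t) x).
Proof.
have [S0|S0] := leP 0 S; last by move=> e e0; exists 1 => // s t s0 st tS; lra.
have [K K0' bK] := bb S.
have dP := uderiv_Psem hw S x K00 hphi0.
have dU y := uderiv_duhamel hw K0' (fun y => cb y S) bK y S0.
have dL := uderiv_laplacian omega x dU.
apply: eq_uderiv (uderivB dP (uderivZ (Num.sqrt 2) dL)) => t t0 tS; rewrite /free_field; first by ring.
rewrite (laplacianD omega (Psem omega t phi0) (fun x => Num.sqrt 2 * (b t x - L (duhamel omega b t) x))).
by rewrite laplacianZ; ring.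
Qed.

(** The exponent dominates [M0 + q] from the semigroup, [q] from the Brownian growth and [2 q + 2]
    from the Laplacian of [U]. *)
Lemma free_field_bound S : exists2 K, 0 <= K &
  forall t, 0 <= t -> t <= S -> poly_bound K (M0 + 2 * q + 2) (free_field t).
Proof.
have [S0|S0] := leP 0 S; last by exists 0 => // t t0 tS; lra.
have A0 : 0 <= A by case: hw.
have [K K0' bK] := bb S.
have [n1 n2 n3] : [/\ M0 + q <= M0 + 2 * q + 2, q <= M0 + 2 * q + 2 & q + q + 2 <= M0 + 2 * q + 2]%N.
  by clear; split; lia.
have J1 (x : C) m : (m <= M0 + 2 * q + 2)%N -> J x ^+ m <= J x ^+ (M0 + 2 * q + 2).
  by move=> hm; rewrite ler_weXn2l ?jap_ge1.
pose K1 := 2 * 6 ^+ d * (decay_fac C hw (M0 + q) S * K0).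
pose K2 := duh_fac C hw S K q * S.
have K10 : 0 <= K1 by rewrite /K1 !mulr_ge0 ?exprn_ge0 // ltW // decay_fac_gt0.
have K20 : 0 <= K2 by rewrite /K2 /duh_fac !mulr_ge0 ?exprn_ge0 // ltW // decay_fac_gt0.
pose K3 := A * (1 + 2 ^+ (q + q)) * K2.
have K30 : 0 <= K3 by rewrite /K3; nneg.
have s2 : 0 <= Num.sqrt 2 :> R by exact: sqrtr_ge0.
exists (K1 + Num.sqrt 2 * (K + K3)); first by rewrite addr_ge0 // mulr_ge0 // addr_ge0.
move=> t t0 tS x; rewrite /free_field mulrDl.
apply: le_trans (ler_normD _ _) _; apply: lerD.
  apply: le_trans (Psem_le hw t0 tS K00 hphi0 x) _; apply: ler_wpM2l; [exact: K10|exact: J1 n1].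
rewrite normrM ger0_norm // -mulrA ler_wpM2l // mulrDl.
apply: le_trans (ler_normB _ _) _; apply: lerD.
  by apply: le_trans (bK t t0 tS x) _; apply: ler_wpM2l; [exact: K0'|exact: J1 n2].
have hU := laplacian_poly hw (fun y => duhamel_le hw K0' (fun y => cb y S) bK y t0 tS) x.
by apply: le_trans hU _; apply: ler_wpM2l; [exact: K30|exact: J1 n3].
Qed.

Lemma free_field_ucont x S : ucont S (free_field^~ x).
Proof.
have [S0|S0] := leP 0 S; last by move=> e e0; exists 1 => // s t s0 st tS; lra.
have [K K0' bK] := bb S.
apply: ucontD; first exact: (ucont_Psem hw S x K00 hphi0).
apply: ucontZ; apply: ucontB; first exact: cb.
apply: ucont_laplacian => y; exact: (ucont_duhamel hw K0' (fun y => cb y S) bK y S0).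
Qed.

Lemma free_field0 x : free_field 0 x = phi0 x.
Proof.
have E : L (duhamel omega b 0) x = 0.
  by rewrite laplacian_nbr; apply: big1 => y _; rewrite !duhamel0 subrr mulr0.
by rewrite /free_field b0 E subr0 mulr0 addr0 (Psem0 hw).
Qed.

Lemma free_field_solution N : (M0 + 2 * q + 2 + q <= N)%N ->
  [/\ continuous_in_Sdual free_field, path_solution b phi0 N free_field &
      forall t, 0 <= t -> Hspace (- (N + 2)%:R) (b t)].
Proof.
move=> MN.
have cF := free_field_ucont; have bF := free_field_bound.
split.
- exact: poly_continuous_in_Sdual cF bF.
- split; first exact: poly_continuous_in_H cF bF _ MN.
  move=> t t0; exists (fun x => phi0 x - free_field t x + Num.sqrt 2 * b t x); last by move=> x; ring.
  (* The integral prescribed by the equation. Its derivative is [L] of the field, which accounts for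
     the two additional powers. *)
  pose v t x := phi0 x - free_field t x + Num.sqrt 2 * b t x.
  apply: (@poly_integral_in_H _ _ _ v (M0 + 2 * q + 2 + 2)) => //.
  + move=> S; have [K1 K10 h1] := bF S; have [K2 K20 h2] := bb S.
    have s2 : 0 <= Num.sqrt 2 :> R by exact: sqrtr_ge0.
    exists (K0 + K1 + Num.sqrt 2 * K2); first by rewrite !addr_ge0 // mulr_ge0.
    have J1 (x : C) m : (m <= M0 + 2 * q + 2 + 2)%N -> J x ^+ m <= J x ^+ (M0 + 2 * q + 2 + 2).
      by move=> hm; rewrite ler_weXn2l ?jap_ge1.
    move=> s s0 sS x; rewrite /v !mulrDl.
    apply: le_trans (ler_normD _ _) _; apply: lerD.
      apply: le_trans (ler_normB _ _) _; apply: lerD.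
        by apply: le_trans (hphi0 x) _; apply: ler_wpM2l; [exact: K00|apply: J1; lia].
      by apply: le_trans (h1 s s0 sS x) _; apply: ler_wpM2l; [exact: K10|apply: J1; lia].
    rewrite normrM ger0_norm // -mulrA ler_wpM2l //.
    by apply: le_trans (h2 s s0 sS x) _; apply: ler_wpM2l; [exact: K20|apply: J1; lia].
  + by apply/funext => x; rewrite /v free_field0 b0 subrr mulr0 addr0.
  + lia.
  + by move=> x S; apply: ucont_laplacian => y.
  + move=> x S; have := uderivB (uderiv_cst S (phi0 x)) (free_field_uderiv x S).
    apply: eq_uderiv => s s0 sS; rewrite /v; first by ring.
    by rewrite sub0r opprK.
  + move=> S; have [K1 K10 h1] := bF S; have A0 : 0 <= A by case: hw.
    exists (A * (1 + 2 ^+ (M0 + 2 * q + 2)) * K1).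
      by rewrite !mulr_ge0 // addr_ge0 // exprn_ge0.
    by move=> s s0 sS x; apply: (laplacian_poly hw); exact: h1.
- move=> t t0; have [K K0' bK] := bb t; apply: Hspace_poly K0' (bK t t0 (lexx t)) _; lia.
Qed.

End Construction.
End PathSolutions.

(** * The Gaussian field *)

Section NoiseField.
Context {R : realType} {d : nat} (omega : lattice d -> lattice d -> R) (C : set (lattice d)) (A : R).
Context (hw : quadratic_rates omega A).
Context {dT : measure_display} {T : measurableType dT}.
Implicit Types (x y : C) (w : T) (t : R).
Local Notation L := (laplacian omega).

(* The limit of explicit Riemann sums in [B], hence measurable; on regular paths it is the
   noise part of the field. *)
Definition noise_limit (B : C -> R -> T -> R) t x w : R :=
  B x t w - L (fun z => lim_rv (fun n w => duhamel_approx omega (fun s y => B y s w) n t z) w) x.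

Lemma measurable_noise_limit (B : C -> R -> T -> R) t x : 0 <= t ->
  (forall y s, 0 <= s -> s <= t -> measurable_fun [set: T] (B y s)) ->
  measurable_fun [set: T] (noise_limit B t x).
Proof.
move=> t0 mB; apply: measurable_funB; first exact: mB.
have mU z : measurable_fun [set: T]
    (lim_rv (fun n w => duhamel_approx omega (fun s y => B y s w) n t z)).
  apply: measurable_lim_rv => n; apply: measurable_sum => i; apply: measurable_funM => //.
  apply: measurable_sum => y; apply: measurable_funM => //; apply: mB.
    by rewrite mulr_ge0 // divr_ge0.
  have n0 : (0 < n)%N by exact: leq_ltn_trans (ltn_ord i).
  by rewrite -[leRHS](gridn t n0); apply: grid_le => //; exact: ltnW.
under eq_fun do rewrite laplacian_nbr.
by apply: measurable_sum => z; apply: measurable_funM => //; exact: measurable_funB.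
Qed.

Lemma noise_limitE (B : C -> R -> T -> R) K M t x w : 0 <= t -> 0 <= K ->
  (forall y, ucont t (fun s => B y s w)) ->
  (forall s, 0 <= s -> s <= t -> poly_bound K M (fun y => B y s w)) ->
  noise_limit B t x w = B x t w - L (duhamel omega (fun s y => B y s w) t) x.
Proof.
move=> t0 K0 cB bB; rewrite /noise_limit; congr (_ - L _ x); apply/funext => z.
by apply: lim_rvE; apply: (duhamel_approx_cvg hw K0 cB bB).
Qed.

End NoiseField.

(** * Wiener integrals of the kernel *)

Section Representation.
Context {R : realType} {d : nat} (omega : lattice d -> lattice d -> R) (C : set (lattice d)) (A : R).
Context (hw : quadratic_rates omega A).
Context {dT : measure_display} {T : measurableType dT} (P : probability T R).
Context (B : C -> R -> {RV P >-> R}) (hB : forall y, brownian_motion (B y)).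
Context (t : R) (t0 : 0 <= t) (x : C).
Implicit Types (y : C) (w : T).
Local Notation L := (laplacian omega).
Local Notation q := (2 * d).+1.
Local Notation J x := (japanese R (val x)).
Local Notation path w := (fun s y => B y s w).

Definition rv_of (f : T -> R) (mf : measurable_fun [set: T] f) : {RV P >-> R} :=
  HB.pack f (isMeasurableFun.Build _ _ _ _ _ mf).

Definition site_kernel y s := heat omega x (t - s) y.

Definition site_lip y := A * (1 + 2 ^+ q) * decay_fac C hw q t * J x ^+ (q + 2) * J y ^- q.

Let A0 : 0 <= A. Proof. by case: hw. Qed.

Lemma site_lip_ge0 y : 0 <= site_lip y.
Proof.
rewrite /site_lip !mulr_ge0 ?jap_expV_ge0 ?exprn_ge0 ?jap_ge0 //.
exact: ltW (decay_fac_gt0 _ _ _ _).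
Qed.

Lemma site_kernel_lip y r s : 0 <= r -> r <= s -> s <= t ->
  `|site_kernel y s - site_kernel y r| <= site_lip y * (s - r).
Proof.
move=> r0 rs st; rewrite distrC; have h1 : 0 <= t - s by lra.
have h2 : t - s <= t - r by lra.
have h3 : t - r <= t by lra.
have := heat_lip_decay hw q x y h1 h2 h3.
by rewrite (_ : t - r - (t - s) = s - r); last ring.
Qed.

Definition site_rv_fun y : T -> R := lim_rv (fun j => wiener_sum (B y) t (site_kernel y) (2 ^ j)).

Lemma measurable_site_rv y : measurable_fun [set: T] (site_rv_fun y).
Proof. by apply: measurable_lim_rv => j; exact: measurable_wiener_sum. Qed.

Definition site_rv y := rv_of (measurable_site_rv y).

Definition noise_rv : {RV P >-> R} := rv_of (measurable_noise_limit omega x t0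
  (fun y s (_ : 0 <= s) (_ : s <= t) => @measurable_funPT _ _ _ _ (B y s))).

(** Integration by parts on the path: the boundary term at [s = t] is the Kronecker delta of
    [site_noise], and the one at 0 vanishes with [B y 0]. *)
Lemma site_sum_cvg y w : regular_paths B w ->
  wiener_sum (B y) t (site_kernel y) (2 ^ j) w @[j --> \oo] --> site_noise omega (path w) t x y.
Proof.
move=> [cB B0 _].
pose g s := L (heat omega y (t - s)) x.
have cL : ucont t (fun s => L (heat omega y s) x).
  by apply: ucont_laplacian => z; exact: (ucont_heat hw).
have df : uderiv t (site_kernel y) g.
  have := uderiv_rev (ucontN cL) (uderiv_heat_fst hw t x y).
  by apply: eq_uderiv => s _ _ //; rewrite opprK.
have cg : ucont t (fun s => g s * B y s w) by apply: ucontM; [exact: (ucont_rev cL)|exact: cB].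
have h := stieltjes_cvg t0 df (cB y t) (uderiv_primitive cg).
have -> : site_noise omega (path w) t x y = site_kernel y t * B y t w - site_kernel y 0 * B y 0 w -
    (primitive (fun s => g s * B y s w) t - primitive (fun s => g s * B y s w) 0).
  by rewrite primitive0 subr0 B0 mulr0 subr0 /site_kernel subrr (heat0 hw).
by apply: cvgB => //; exact: cvg_cst.
Qed.

Lemma site_rv_cvg y : {ae P, forall w,
  wiener_sum (B y) t (site_kernel y) (2 ^ j) w @[j --> \oo] --> site_rv y w}.
Proof.
apply: filterS (brownian_regular hB) => w hr; have h := @site_sum_cvg y w hr.
by rewrite [X in _ --> X](lim_rvE h).
Qed.

Lemma site_rv_integral y : is_wiener_integral (B y) t (site_kernel y) (site_rv y).
Proof. exact: (wiener_limit_is_integral (hB y) t0 (site_lip_ge0 y) (site_kernel_lip y) (site_rv_cvg y)). Qed.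

(** [J x ^ (2 q)] accounts for the kernel at [s = t], a Kronecker delta: at [y = x] it compensates
    [J y ^- (2 q)]. *)
Definition site_sqr_fac : R := 12 * t * (J x ^+ (2 * q) +
  (A * (1 + 2 ^+ q) * decay_fac C hw q t * J x ^+ (q + 2) * t) ^+ 2).

Lemma site_sqr_fac_ge0 : 0 <= site_sqr_fac.
Proof. by rewrite /site_sqr_fac !mulr_ge0 // addr_ge0 ?sqr_ge0 // exprn_ge0 // jap_ge0. Qed.

Lemma site_rv_sqr y : mean_le P (fun w => site_rv y w ^+ 2) (site_sqr_fac * J y ^- (2 * q)).
Proof.
apply: mean_le_trans (wiener_limit_sqr (hB y) t0 (site_lip_ge0 y) (site_kernel_lip y) (site_rv_cvg y)).
have Jy := @jap_exp_gt0 R d C y (2 * q).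
rewrite /site_sqr_fac -[leRHS]mulrA ler_wpM2l ?mulr_ge0 // [leRHS]mulrDl; apply: lerD.
  rewrite /site_kernel subrr (heat0 hw); case: eqP => [->|_].
    by rewrite expr1n divff // gt_eqF.
  by rewrite expr0n mulr_ge0 ?jap_expV_ge0 // exprn_ge0 // jap_ge0.
have -> : J y ^- (2 * q) = (J y ^- q) ^+ 2 by rewrite (mulnC 2%N q) exprM exprVn.
by rewrite /site_lip -exprMn mulrAC.
Qed.

(** On regular paths [site_noise_sum] gives convergence along boxes, at rate [c / m]; the decay of
    the second moments upgrades it to the net of finite sets. *)
Lemma noise_rv_sum : is_L2_sum site_rv noise_rv.
Proof.
apply: (L2_sum_box site_sqr_fac_ge0 site_rv_sqr).
apply: filterS (brownian_regular hB) => w hr; have [cB B0 bB] := hr.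
have [K K0 hK] := bB t; have [n0 xn] := @in_box_ex R _ _ x.
have -> : noise_rv w = B x t w - L (duhamel omega (path w) t) x.
  exact: (noise_limitE hw x t0 K0 (fun y => cB y t) hK).
apply/cvgrPdist_le => e e0.
pose c := lip_fac C hw (q + q) t * J x ^+ (q + q + 2) * K * 6 ^+ d * t.
have c0 : 0 <= c.
  by rewrite /c; nneg.
have [n hn] := exists_nat_gt (c / e).
exists (n + n0).+1 => // m /= nm.
have m0 : (0 < m)%N by exact: leq_ltn_trans nm.
have xm : x \in box (R := R) C m by apply: box_sub xn; lia.
have := site_noise_sum hw K0 (fun y => cB y t) hK t0 (lexx t) xm m0.
have -> : \sum_(y <- box (R := R) C m) site_rv y w =
    \sum_(y <- box (R := R) C m) site_noise omega (path w) t x y.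
  by apply: eq_bigr => y _; exact: lim_rvE (@site_sum_cvg y w hr).
move=> /le_trans; apply.
have -> : lip_fac C hw (q + q) t * J x ^+ (q + q + 2) * K * (6 ^+ d / m%:R) * t = c / m%:R.
  by rewrite /c; ring.
have m0' : 0 < m%:R :> R by rewrite ltr0n.
rewrite ler_pdivrMr // mulrC -ler_pdivrMr //; apply: le_trans (ltW hn) _; rewrite ler_nat; lia.
Qed.

End Representation.

Lemma quadratic_rates_ex {R : realType} (d : nat) (omega : lattice d -> lattice d -> R) :
  conductances omega -> has_ubound (range (fun x : lattice d => (japanese R x) ^- 2 * total_rate omega x)) ->
  exists A, quadratic_rates omega A.
Proof.
move=> hc [M hM]; exists (Num.max 0 M); split => // [|x]; first by rewrite le_max lexx.
have J2 : 0 < japanese R x ^+ 2 by rewrite exprn_gt0 // jap_gt0.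
rewrite -ler_pdivrMr // mulrC le_max; apply/orP; right; apply: hM; by exists x.
Qed.

(** * The solution and its adaptedness *)

Section Field.
Context {R : realType} {d : nat} (omega : lattice d -> lattice d -> R) (C : set (lattice d)) (A : R).
Context (hw : quadratic_rates omega A).
Context {dT : measure_display} {T : measurableType dT} (P : probability T R).
Context (B : C -> R -> {RV P >-> R}) (hB : forall y, brownian_motion (B y)).
Context (phi0 : C -> R).
Local Notation q := (2 * d).+1.
Local Notation path w := (fun s y => B y s w).

(* The values at negative times are immaterial; this choice makes [field] agree with [free_field]
   at all times on regular paths. *)
Definition field (t : R) (w : T) (x : C) : R :=
  if 0 <= t then Psem omega t phi0 x + Num.sqrt 2 * noise_limit omega (fun y s w => B y s w) t x w
  else free_field omega phi0 (path w) t x.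

Lemma field_free w : regular_paths B w -> (fun t => field t w) = free_field omega phi0 (path w).
Proof.
move=> [cB B0 bB]; apply/funext => t; apply/funext => x; rewrite /field; case: ifPn => // t0.
have [K K0 hK] := bB t.
by rewrite (noise_limitE hw x t0 K0 (fun y => cB y t) hK).
Qed.

(** The sigma-algebra generated up to time [t] is taken as the ambient one; [noise_limit] is
    measurable for it, since it reads [B] on [[0, t]] only. *)
Lemma field_adapted : adapted B field.
Proof.
move=> t x t0.
pose G := \bigcup_(i in [set: C]) \bigcup_(s in [set s : R | 0 <= s <= t])
        preimage_set_system setT (B i s) measurable.
pose TT := g_sigma_algebraType G.
have mB y s : 0 <= s -> s <= t -> measurable_fun [set: TT] (B y s : TT -> R).
  move=> s0 st _ Y mY; apply: sub_sigma_algebra; exists y => //; exists s; first by rewrite /= s0 st.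
  by exists Y.
have mN := measurable_noise_limit omega x t0 mB.
move=> _ [Y mY <-].
have mF : measurable_fun [set: TT] (fun w : TT => field t w x).
  rewrite /field t0; apply: measurable_funD => //; exact: measurable_funM.
exact: (mF measurableT Y mY).
Qed.

Lemma field_solution K0 M0 : 0 <= K0 -> poly_bound K0 M0 phi0 ->
  is_solution omega B phi0 (M0 + 2 * q + 2 + q) field.
Proof.
move=> K00 hphi0; split; first exact: field_adapted.
apply: filterS (brownian_regular hB) => w hr; have [cB B0 bB] := hr.
have [h1 [h2 h3] h4] := free_field_solution hw K00 hphi0 cB B0 bB (leqnn _).
have E := field_free hr; split.
- by rewrite E.
- by rewrite E.
- move=> t t0; have [I hI eqn] := h3 t t0; exists I; split; [|exact: h4|].
    by rewrite -E in hI.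
  by move=> x; rewrite -(eqn x) -E.
Qed.

End Field.

Lemma solution_path {R : realType} {d : nat} (omega : lattice d -> lattice d -> R) (C : set (lattice d))
  {dT : measure_display} {T : measurableType dT} (P : probability T R) (B : C -> R -> {RV P >-> R})
  (phi0 : C -> R) N psi : is_solution omega B phi0 N psi ->
  {ae P, forall w, path_solution omega (fun s y => B y s w) phi0 N (fun t => psi t w)}.
Proof.
move=> [_ h]; apply: filterS h => w [_ cH eqn]; split => // t t0.
by have [I [hI _ e]] := eqn t t0; exists I.
Qed.

Theorem theorem2p3 (R : realType) (d : nat) (hd : (1 <= d)%N)
  (omega : lattice d -> lattice d -> R) (homega : conductances omega)
  (C : set (lattice d)) (hC : unique_infinite_component omega C)
  (hgrowth : has_ubound
     (range (fun x : lattice d => (japanese R x) ^- 2 * total_rate omega x))) :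
  (forall (X : vsrw omega C) (x : C),
     law X x [set w : vsrw_space X | explosion_time w = +oo%E] = 1%E)
  /\
  (forall phi0 : C -> R, Sdual phi0 ->
   exists N : nat,
   forall (dT : measure_display) (T : measurableType dT) (P : probability T R)
     (B : C -> R -> {RV P >-> R}),
   independent_brownian_motions B ->
   exists phi : R -> T -> C -> R,
   [/\ is_solution omega B phi0 N phi,
       (forall (N' : nat) (psi : R -> T -> C -> R),
          is_solution omega B phi0 N' psi -> indistinguishable P psi phi) &
       (forall (X : vsrw omega C) (x : C) (t : R), 0 <= t ->
          summable [set: C] (fun y => (heat_kernel X t x y * phi0 y)%:E) /\
          exists (J : C -> {RV P >-> R}) (Z : {RV P >-> R}),
          [/\ (forall y, is_wiener_integral (B y) t
                           (fun s => heat_kernel X (t - s) x y) (J y)),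
              is_L2_sum J Z &
              {ae P, forall w,
                 phi t w x = semigroup X t phi0 x + Num.sqrt 2 * Z w} ])]).
Proof.
have [A hw] := quadratic_rates_ex homega hgrowth.
split=> [X x|phi0 /Sdual_pointwise[K0 [M0 [K00 hphi0]]]]; first exact: (non_explosion hw hC).
(* The field grows like [J ^ (M0 + 2 q + 2)], and [q] further powers put it in the space of index
   [- N]; the choice precedes the probability space. *)
exists (M0 + 2 * (2 * d).+1 + 2 + (2 * d).+1)%N => dT T P B [hB _].
have sol := field_solution hw hB K00 hphi0.
exists (field omega B phi0); split => // [N' psi hpsi|X x t t0].
  apply: filterS2 (solution_path hpsi) (solution_path sol) => w h1 h2 t t0.
  exact: (path_solution_unique hw h1 h2 t0).
have HE y s : 0 <= s -> heat_kernel X s x y = heat omega x s y.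
  by move=> s0; rewrite (heat_kernel_heat hw hC).
split.
  have -> : (fun y : C => (heat_kernel X t x y * phi0 y)%:E) = (fun y => (heat omega x t y * phi0 y)%:E).
    by apply/funext => y; rewrite HE.
  apply: summable_jap (heat_mul_le hw x t0 (lexx t) K00 hphi0).
  by rewrite !mulr_ge0 // ?exprn_ge0 ?jap_ge0 // ltW // decay_fac_gt0.
exists (site_rv omega B t x), (noise_rv omega B t0 x); split.
- move=> y; have [m1 m2] := site_rv_integral hw hB t0 x y; split.
    apply: eq_measurable_fun m1 => s; rewrite inE /= in_itv /= => /andP[s0 st].
    by rewrite HE // subr_ge0.
  move=> e e0; have [g [h1 h2 h3]] := m2 e e0; exists g; split => //.
  apply: le_lt_trans h2; rewrite le_eqVlt; apply/predU1P; left; apply: eq_integral => s.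
  by rewrite inE /= in_itv /= => /andP[s0 st]; rewrite HE // subr_ge0.
- exact: (noise_rv_sum hw hB).
(* For [t >= 0] the field is defined by this formula, so the identity holds at every [w]. *)
- apply/aeW => w; rewrite /field t0 /semigroup; congr (_ + _).
  by congr csum; apply/funext => y; rewrite HE.
Qed.
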